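(* Suppose that, as the sample size $n$ increases, the rates at which the models increase their number of parameters are $i=O(n)$ and $p=O(n)$, and that there exist positive constants $r$ and $s$ such that $r=\lim_{n,p\to\infty}n/p$ and $s=\lim_{n,i\to\infty}n/i\geq 1$. 1. When sampling from the simpler model $M_{i}$, $B_{pi}(\mathbf{y})\to 0$ in probability as $n\to\infty$. 2. When sampling from the alternative model $M_{p}$, there exists a function $\delta(r,s)$ such that, in probability, $$\lim_{n\to\infty}B_{pi}(\mathbf{y})=\begin{cases}\infty, & \text{if } \lim_{n\to\infty}\delta_{pi}>\delta(r,s),\\ 0, & \text{if } \lim_{n\to\infty}\delta_{pi}<\delta(r,s).\end{cases}$$ This function has the simple explicit form $$\delta(r,s)=\frac{r-1}{(r+1)^{\frac{s(r-1)}{r(s-1)}}-1}-1+\frac{1}{s},$$ and it is a bounded decreasing convex function in $r$ for fixed $s$, with $\delta(r,s)\leq \frac{1}{\log 2}-1$ for all $s>r>1$, and $\lim_{r\to\infty}\delta(r,s)=0$ for all $s$. Further, $\lim_{s\to\infty}\delta(r,s)=\delta(r)$, where $$\delta(r)=\frac{r-1}{(r+1)^{(r-1)/r}-1}-1.$$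
   Context: Let $\mathbf{y}=(y_1,\ldots,y_n)'$ be a vector of independent responses, let $\mathbf{X}_{p}$ be an $n\times p$ design matrix, where $p$ is the number of explanatory variables, and let $\mathbf{X}_{i}$ be an $n\times i$ submatrix of $\mathbf{X}_{p}$. The reduced (simpler) sampling model $M_{i}$ is $N(\mathbf{y}|\mathbf{X}_{i}\boldsymbol{\alpha}_{i},\sigma_{i}^{2}\mathbf{I}_{n})$, nested in the full (alternative) sampling model $M_{p}$, which is $N(\mathbf{y}|\mathbf{X}_{p}\boldsymbol{\beta}_{p},\sigma_{p}^{2}\mathbf{I}_{n})$, where the regression parameter vectors $\boldsymbol{\alpha}_i\in\mathbb{R}^i$, $\boldsymbol{\beta}_p\in\mathbb{R}^p$ and the error variances $\sigma_i^2,\sigma_p^2$ are unknown. The dimensions $i$ and $p$ vary with $n$. Define $\mathbf{H}_{j}=\mathbf{X}_{j}(\mathbf{X}_{j}^{\prime}\mathbf{X}_{j})^{-1}\mathbf{X}_{j}^{\prime}$ for $j=i,p$, $$\mathcal{B}_{ip}=\frac{\mathbf{y}^{\prime}(\mathbf{I}_{n}-\mathbf{H}_{p})\mathbf{y}}{\mathbf{y}^{\prime}(\mathbf{I}_{n}-\mathbf{H}_{i})\mathbf{y}},\qquad \delta_{pi}=\frac{1}{\sigma_{p}^{2}}\boldsymbol{\beta}_{p}^{\prime}\frac{\mathbf{X}_{p}^{\prime}(\mathbf{I}_{n}-\mathbf{H}_{i})\mathbf{X}_{p}}{n}\boldsymbol{\beta}_{p};$$ $\delta_{pi}$ is the ''distance''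 from $M_p$ to $M_i$ for sample size $n$, and its limit as $n\to\infty$ is assumed to be finite. The Bayes factor for intrinsic priors for comparing $M_{p}$ with $M_{i}$ is $$B_{pi}(\mathbf{y})=\frac{2}{\pi}(p+1)^{(p-i)/2}\int_{0}^{\pi/2}\frac{\sin^{p-i}\varphi\,(n+(p+1)\sin^{2}\varphi)^{(n-p)/2}}{(n\mathcal{B}_{ip}+(p+1)\sin^{2}\varphi)^{(n-i)/2}}\,d\varphi.$$ Sampling from a model means sampling from it with a fixed parameter sequence, and limits of $B_{pi}(\mathbf{y})$ are limits in probability under that model.
   Formalization: Assumes r>1 (δ is 0/0 at r=1), and i<p with X_p of full column rank for large n; part 1 assumes p−i→∞ (automatic if r<s; false for r=s, p=i+1); shape claims are on 1<r<s; δ→0 as r→∞ is uniform over s>r (for fixed s the limit is −1+1/s). *)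

(* Defs.v *)
From mathcomp Require Import all_boot all_order all_algebra.
From mathcomp Require Import all_classical all_reals all_analysis.

Set Implicit Arguments.
Unset Strict Implicit.
Unset Printing Implicit Defensive.

Import Order.TTheory GRing.Theory Num.Theory.
Import numFieldTopology.Exports numFieldNormedType.Exports.

Local Open Scope classical_set_scope.
Local Open Scope ring_scope.

Definition hat_mx (R : realType) (n k : nat) (X : 'M[R]_(n, k)) : 'M[R]_n :=
  X *m invmx (X^T *m X) *m X^T.

Definition rss (R : realType) (n k : nat) (X : 'M[R]_(n, k)) (y : 'cV[R]_n) : R :=
  (y^T *m (1%:M - hat_mx X) *m y) 0 0.

Definition Bstat (R : realType) (n i p : nat)
    (Xi : 'M[R]_(n, i)) (Xp : 'M[R]_(n, p)) (y : 'cV[R]_n) : R :=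
  rss Xp y / rss Xi y.

(* [sigma] is the standard deviation of the full model. *)
Definition model_distance (R : realType) (n i p : nat)
    (Xi : 'M[R]_(n, i)) (Xp : 'M[R]_(n, p))
    (beta : 'cV[R]_p) (sigma : R) : R :=
  (sigma ^+ 2)^-1 *
  (beta^T *m (n%:R^-1 *: (Xp^T *m (1%:M - hat_mx Xi) *m Xp)) *m beta) 0 0.

Definition bayes_factor (R : realType) (n i p : nat)
    (Xi : 'M[R]_(n, i)) (Xp : 'M[R]_(n, p)) (y : 'cV[R]_n) : R :=
  2 / pi * p.+1%:R `^ ((p%:R - i%:R) / 2) *
  \int[@lebesgue_measure R]_(phi in `[0, pi / 2])
    (sin phi ^+ (p - i) *
     (n%:R + p.+1%:R * sin phi ^+ 2) `^ ((n%:R - p%:R) / 2) /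
     (n%:R * Bstat Xi Xp y + p.+1%:R * sin phi ^+ 2)
       `^ ((n%:R - i%:R) / 2)).

(* Taking [A j = setT] outside a subset of indices gives the product rule for
   every subfamily, so the single product over all indices is enough. *)
Definition mutually_independent (R : realType) (d : measure_display)
    (T : measurableType d) (P : probability T R) (n : nat)
    (Y : 'I_n -> {RV P >-> R}) : Prop :=
  forall A : 'I_n -> set R, (forall j, measurable (A j)) ->
    P (\bigcap_j (Y j @^-1` A j)) = (\prod_(j < n) P (Y j @^-1` A j))%E.

(* [Y] has law N(mu, sigma^2 I_n); the scale argument of [normal_prob] is the
   standard deviation. *)
Definition normal_sample (R : realType) (d : measure_display)
    (T : measurableType d) (P : probability T R) (n : nat)
    (Y : 'I_n -> {RV P >-> R}) (mu : 'cV[R]_n) (sigma : R) : Prop :=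
  mutually_independent Y /\
  forall (j : 'I_n) (A : set R), measurable A ->
    distribution P (Y j) A = normal_prob (mu j 0) sigma A.

Definition sample_vector (R : realType) (d : measure_display)
    (T : measurableType d) (P : probability T R) (n : nat)
    (Y : 'I_n -> {RV P >-> R}) (w : T) : 'cV[R]_n := \col_j Y j w.

(* The probability space may change with [n]: only the law of each [Z n]
   matters. *)
Definition cvg_in_probability (R : realType) (d : nat -> measure_display)
    (T : forall n, measurableType (d n)) (P : forall n, probability (T n) R)
    (Z : forall n, T n -> R) (l : R) : Prop :=
  forall eps : R, 0 < eps ->
    P n [set w | eps <= `|Z n w - l|] @[n --> \oo] --> 0%E.

Definition cvg_pinfty_in_probability (R : realType) (d : nat -> measure_display)
    (T : forall n, measurableType (d n)) (P : forall n, probability (T n) R)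
    (Z : forall n, T n -> R) : Prop :=
  forall M : R, P n [set w | Z n w <= M] @[n --> \oo] --> 0%E.

(* [X n] is the design matrix of the full model at sample size [n]; the reduced
   design consists of the columns of [X n] selected by [sel n].  The structural
   conditions are required from some sample size on, since
   [i n < p n <= n] is impossible for [n = 0].  The condition [1 < r] makes
   [delta_rs r s] well defined; [r <= s], and hence [1 < s], follows from
   [i n < p n]. *)
Record growth_regime (R : realType) (i p : nat -> nat)
    (sel : forall n, 'I_(i n) -> 'I_(p n)) (X : forall n, 'M[R]_(n, p n))
    (r s : R) : Prop := GrowthRegime {
  regime_nested : \forall n \near \oo, (i n < p n)%N /\ injective (sel n);
  regime_full_rank : \forall n \near \oo, (X n)^T *m X n \in unitmx;
  regime_iO : (fun n => (i n)%:R : R^o) =O_\oo (fun n => n%:R : R^o);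
  regime_pO : (fun n => (p n)%:R : R^o) =O_\oo (fun n => n%:R : R^o);
  regime_r_gt1 : 1 < r;
  regime_s_ge1 : 1 <= s;
  regime_r : n%:R / (p n)%:R @[n --> \oo] --> r;
  regime_s : n%:R / (i n)%:R @[n --> \oo] --> s }.

Definition delta_rs (R : realType) (r s : R) : R :=
  (r - 1) / ((r + 1) `^ (s * (r - 1) / (r * (s - 1))) - 1) - 1 + s^-1.

Definition delta_r (R : realType) (r : R) : R :=
  (r - 1) / ((r + 1) `^ ((r - 1) / r) - 1) - 1.

(* Main.v *)
Require Import Defs.
From mathcomp Require Import all_boot all_order all_algebra.
From mathcomp Require Import all_classical all_reals all_analysis.
From mathcomp Require Import measurable_realfun.
From mathcomp Require Import ring lra.

Set Implicit Arguments.
Unset Strict Implicit.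
Unset Printing Implicit Defensive.

Import Order.TTheory GRing.Theory Num.Theory.
Import numFieldTopology.Exports numFieldNormedType.Exports.

Local Open Scope classical_set_scope.
Local Open Scope ring_scope.

(* Put V = y'(I - H_p)y / sigma^2 and W = y'(H_p - H_i)y / sigma^2.  Then
   B_ip = V / (V + W), and the Bayes factor is a function of B_ip alone whose
   logarithm is, up to o(n), n/2 times
     (1 - p/n) ln (1 + n/(p+1)) - (1 - i/n) ln (1 + n/(p+1) B_ip).
   V and W are quadratic forms in projections of a Gaussian vector; their
   second moments show, by Chebyshev's inequality, that V is close to n - p and
   W to p - i + n delta_pi.  In the full model B_ip therefore tends to
   (1 - 1/r) / (1 - 1/s + L), L being the limit of delta_pi, and delta(r, s) is
   the value of L at which the limiting exponent vanishes.  In the reduced model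
   delta_pi = 0, and the exponent is at most -(p - i) times a positive constant,
   even when r = s.

   With k = s/(s-1) the function delta(r, s) + 1/k is
   (r - 1) / (exp (k (1 - 1/r) ln (r + 1)) - 1), whose second derivative is
   nonnegative as long as k (1 - 1/r) <= 1, that is r <= s.  Strict monotonicity
   follows from convexity since delta(r, s) > 0 = delta(s, s) for r < s. *)

(** * Elementary inequalities *)

(** The integral over [phi] calls for no Laplace expansion. Once the exponent at [phi = pi / 2] is
    nonpositive, it is at most that value at every other angle, so the value at [pi / 2] bounds the
    whole factor; from below, a fixed neighbourhood of [pi / 2] is enough. The obstacle in the
    reduced model is r = s: B_ip then tends to 1 and the exponent, divided by n, tends to 0. The
    decay has to come from the scale p - i at finite n, which is why V and W are compared there with
    n - p and p - i in relative error, whereas in the full model errors of order n are small enough.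
    Independence is given for events only, so the product rule for expectations is built up from
    indicators before any moment can be computed. The sign of the second derivative of the threshold
    is an inequality between r, ln (r + 1) and a power of r + 1. Rational bounds for the logarithm
    and the exponential reduce it to polynomial inequalities, which is where the numerical constants
    come from. *)

Lemma is_derive_ge0_le (R : realType) (f f' : R -> R) (a b : R) : a <= b ->
  (forall x, a <= x <= b -> is_derive x 1 f (f' x)) ->
  (forall x, a <= x <= b -> 0 <= f' x) -> f a <= f b.
Proof.
move=> ab df f'0.
have [||c /[!in_itv]/= cab] := @MVT_segment _ f f' a b ab.
- by move=> x /[!in_itv]/= /andP[/ltW ax /ltW xb]; apply: df; rewrite ax.
- apply: derivable_within_continuous => x /[!in_itv]/= xab.
  by have [] := df _ xab.
by move=> e; rewrite -subr_ge0 e mulr_ge0 ?subr_ge0// f'0.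
Qed.

(* The [3,3] Pade approximant of the exponential: differentiating four times
   leaves [expR x * x ^+ 3]. *)
Lemma pade_expR (R : realType) (u : R) : 0 <= u ->
  expR u * (120 - 60 * u + 12 * u ^+ 2 - u ^+ 3) <=
  120 + 60 * u + 12 * u ^+ 2 + u ^+ 3.
Proof.
move=> u0.
pose h3 (x : R) := 6 - expR x * (6 - 6 * x + 3 * x ^+ 2 - x ^+ 3).
pose h2 (x : R) := 24 + 6 * x - expR x * (24 - 18 * x + 6 * x ^+ 2 - x ^+ 3).
pose h1 (x : R) := 60 + 24 * x + 3 * x ^+ 2
  - expR x * (60 - 36 * x + 9 * x ^+ 2 - x ^+ 3).
pose h0 (x : R) := 120 + 60 * x + 12 * x ^+ 2 + x ^+ 3
  - expR x * (120 - 60 * x + 12 * x ^+ 2 - x ^+ 3).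
have h3_ge0 x : 0 <= x -> 0 <= h3 x.
  move=> x0; have <- : h3 0 = 0 by rewrite /h3 expR0; ring.
  apply: (@is_derive_ge0_le R h3 (fun x => expR x * x ^+ 3) 0 x) x0 _ _.
    move=> y _; rewrite /h3; apply: is_derive_eq.
    by rewrite /GRing.scale/=; ring.
  by move=> y /andP[y0 _]; rewrite mulr_ge0 ?expR_ge0 ?exprn_ge0.
have h2_ge0 x : 0 <= x -> 0 <= h2 x.
  move=> x0; have <- : h2 0 = 0 by rewrite /h2 expR0; ring.
  apply: (@is_derive_ge0_le R h2 h3 0 x) x0 _ _.
    move=> y _; rewrite /h2; apply: is_derive_eq.
    by rewrite /h3 /GRing.scale/=; ring.
  by move=> y /andP[y0 _]; exact: h3_ge0.
have h1_ge0 x : 0 <= x -> 0 <= h1 x.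
  move=> x0; have <- : h1 0 = 0 by rewrite /h1 expR0; ring.
  apply: (@is_derive_ge0_le R h1 h2 0 x) x0 _ _.
    move=> y _; rewrite /h1; apply: is_derive_eq.
    by rewrite /h2 /GRing.scale/=; ring.
  by move=> y /andP[y0 _]; exact: h2_ge0.
rewrite -subr_ge0 -/(h0 u); have <- : h0 0 = 0 by rewrite /h0 expR0; ring.
apply: (@is_derive_ge0_le R h0 h1 0 u) u0 _ _.
  move=> y _; rewrite /h0; apply: is_derive_eq.
  by rewrite /h1 /GRing.scale/=; ring.
by move=> y /andP[y0 _]; exact: h1_ge0.
Qed.

(** The bound is the [2,1] Pade approximant of [ln] at 1. The difference of the two sides has
    derivative [(x - 1)^3 / (x (2 x + 1)^2)], so it is minimal at 1, where it vanishes. *)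
Lemma ln_le_pade (R : realType) (y : R) : 0 < y ->
  ln y <= (y - 1) * (y + 5) / (4 * y + 2).
Proof.
move=> y0; pose f (x : R) := (x - 1) * (x + 5) * (4 * x + 2)^-1 - ln x.
have f1 : f 1 = 0 by rewrite /f subrr !mul0r ln1 subrr.
pose f' (x : R) := (x - 1) ^+ 3 / (x * (2 * x + 1) ^+ 2).
have df (x : R) : 0 < x -> is_derive x 1 f (f' x).
  move=> x0; have x2 : 4 * x + 2 != 0 by rewrite gt_eqF//; nra.
  have := @is_deriveV _ (fun x : R => 4 * x + 2) x _ 1 x2 _.
  have := is_derive1_ln x0 => D1 D2.
  rewrite /f; apply: is_derive_eq.
  rewrite /f' /GRing.scale/=; field.
  by rewrite !gt_eqF//; nra.
suff : 0 <= f y by rewrite subr_ge0.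
have [y1|/ltW y1] := leP 1 y.
  rewrite -f1; apply: (is_derive_ge0_le y1 (f' := f')) => x /andP[x1 xy].
    by apply: df; lra.
  by rewrite divr_ge0 ?exprn_ge0 ?mulr_ge0 ?sqr_ge0 ?subr_ge0//; lra.
rewrite -f1 -lerN2.
apply: (is_derive_ge0_le y1 (f := fun x => - f x) (f' := fun x => - f' x)) => x /andP[x1 xy].
  by have := df x (lt_le_trans y0 x1) => D; apply: is_deriveN.
rewrite -mulNr divr_ge0//.
  have -> : - (x - 1) ^+ 3 = (1 - x) ^+ 3 by ring.
  by rewrite exprn_ge0// subr_ge0.
by rewrite mulr_ge0 ?sqr_ge0//; lra.
Qed.

Lemma ln_ge_pade (R : realType) (y : R) : 0 < y ->
  (y - 1) * (5 * y + 1) / (y * (4 + 2 * y)) <= ln y.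
Proof.
move=> y0; have := @ln_le_pade R y^-1; rewrite invr_gt0 => /(_ y0).
rewrite lnV ?posrE// lerNl; apply: le_trans; rewrite le_eqVlt; apply/orP; left.
by apply/eqP; field; rewrite !gt_eqF//; nra.
Qed.

Lemma ln2_bounds (R : realType) : 692 / 1000 <= ln (2 : R) <= 695 / 1000.
Proof.
(* The approximants are sharp only near 1; each of the two factors is close enough to 1 for the
   stated precision. *)
have -> : (2 : R) = 4 / 3 * (3 / 2) by field.
rewrite lnM ?posrE; [|lra|lra].
have h1 : (0 : R) < 4 / 3 by lra.
have h2 : (0 : R) < 3 / 2 by lra.
have := ln_le_pade h1; have := ln_le_pade h2.
have := ln_ge_pade h1; have := ln_ge_pade h2.
have -> : (3 / 2 - 1) * (5 * (3 / 2) + 1) / (3 / 2 * (4 + 2 * (3 / 2))) = 17 / 42 :> R by field.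
have -> : (4 / 3 - 1) * (5 * (4 / 3) + 1) / (4 / 3 * (4 + 2 * (4 / 3))) = 23 / 80 :> R by field.
have -> : (3 / 2 - 1) * (3 / 2 + 5) / (4 * (3 / 2) + 2) = 13 / 32 :> R by field.
have -> : (4 / 3 - 1) * (4 / 3 + 5) / (4 * (4 / 3) + 2) = 19 / 66 :> R by field.
by lra.
Qed.

(** The rational bounds are applied to [(r + 1) / 4], and [2 * ln 2] is enclosed between 138/100 and
    139/100. The centre [r = 3] lies inside the range [1 < r <= 12] where the bounds are used. *)
Lemma ln1D_near4 (R : realType) (r : R) : -1 < r ->
  138 / 100 + (r - 3) * (5 * r + 9) / (2 * (r + 1) * (r + 9)) <= ln (r + 1)
  <= 139 / 100 + (r - 3) * (r + 21) / (16 * (r + 3)).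
Proof.
move=> r1.
have y0 : 0 < (r + 1) / 4 by lra.
have e : ln (r + 1) = ln 2 + (ln 2 + ln ((r + 1) / 4)).
  rewrite -(@lnM _ 2 ((r + 1) / 4)) ?posrE// -lnM ?posrE//; last by lra.
  by congr ln; field.
have := ln2_bounds R; have := ln_le_pade y0; have := ln_ge_pade y0.
set lo := (X in X <= _ -> _); set hi := (X in _ -> _ <= X -> _).
have -> : lo = (r - 3) * (5 * r + 9) / (2 * (r + 1) * (r + 9)).
  by rewrite /lo; field; rewrite !gt_eqF//; lra.
have -> : hi = (r - 3) * (r + 21) / (16 * (r + 3)).
  by rewrite /hi; field; rewrite !gt_eqF//; lra.
rewrite e; move: (ln 2) (ln _) => l2 ly.
by move=> ? ? /andP[? ?]; apply/andP; split; lra.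
Qed.

(* The square root of the right-hand side is compared with a cubic polynomial [m];
   the two bounds of [ln1D_near4] then leave polynomial inequalities in [r - 1]. *)
Lemma threshold_ineq_le12 (R : realType) (r : R) : 1 < r <= 12 ->
  66 * r ^+ 3 * ((r + 2) * ln (r + 1) - 2 * r) <=
  10 * (((r + 1) * ln (r + 1) + r * (r - 1)) * ln (r + 1)) ^+ 2.
Proof.
move=> /andP[r1 r12].
have /ln1D_near4/andP[] : -1 < r by lra.
set l := ln (r + 1) => llo lhi.
have l0 : 0 <= l by apply: ln_ge0; lra.
pose m := 88 / 100 + (r - 1) * (4 / 10 + 18 / 10 * r + r ^+ 2 / 10).
pose t := r - 1.
have rE : r = t + 1 by rewrite /t; ring.
have [t0 t11] : 0 < t /\ t <= 11 by rewrite /t; split; lra.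
have m0 : 0 <= m by rewrite /m; nra.
have hi : 66 * r ^+ 3 * ((r + 2) * l - 2 * r) <= 10 * m ^+ 2.
  have : 66 * r ^+ 3 * ((r + 2) * (139 / 100 + (r - 3) * (r + 21) / (16 * (r + 3))) - 2 * r) <= 10 * m ^+ 2.
    rewrite -subr_ge0.
    have -> : 10 * m ^+ 2 - 66 * r ^+ 3 * ((r + 2) * (139 / 100 + (r - 3) * (r + 21) / (16 * (r + 3))) - 2 * r) =
      ((41 + 536/1000) + (581 + 504/1000) * t + (1737 + 36/100) * t ^+ 2 + 1956 * t ^+ 3 +
       t ^+ 4 * ((764 + 16/100) - (102 + 24/100) * t + 44/10 * t ^+ 2 + 16/10 * t ^+ 3)) / (16 * (r + 3)).
      by rewrite /m rE; field; rewrite gt_eqF//; lra.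
    apply: divr_ge0; last by lra.
    have t3 : 0 <= t ^+ 3 by rewrite exprn_ge0// ltW.
    have t4 : 0 <= t ^+ 4 by rewrite exprn_ge0// ltW.
    have : 0 <= (764 + 16/100) - (102 + 24/100) * t + 44/10 * t ^+ 2 + 16/10 * t ^+ 3 by nra.
    by move=> /(mulr_ge0 t4); nra.
  have c0 : 0 <= 66 * r ^+ 3 by rewrite mulr_ge0// exprn_ge0//; lra.
  apply: le_trans; rewrite ler_wpM2l//.
  by rewrite lerD2r ler_wpM2l//; lra.
have lo : m <= ((r + 1) * l + r * (r - 1)) * l.
  pose L := 138 / 100 + (r - 3) * (5 * r + 9) / (2 * (r + 1) * (r + 9)).
  have L0 : 0 <= L.
    have -> : L = (276/100 * (r + 1) * (r + 9) + (r - 3) * (5 * r + 9)) / (2 * (r + 1) * (r + 9)).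
      by rewrite /L; field; rewrite !gt_eqF//; lra.
    by apply: divr_ge0; nra.
  apply: (@le_trans _ _ (((r + 1) * L + r * (r - 1)) * L)).
    rewrite -subr_ge0.
    have -> : ((r + 1) * L + r * (r - 1)) * L - m =
      ((35 + 84/100) + (230 + 528/1000) * t + (175 + 249/625) * t ^+ 2 + (196 + 264/625) * t ^+ 3 +
       t ^+ 4 * ((63 + 611/625) - 128/100 * t - 4/10 * t ^+ 2)) / (4 * (r + 1) * (r + 9) ^+ 2).
      by rewrite /m /L rE; field; rewrite !gt_eqF//; lra.
    apply: divr_ge0; last by rewrite !mulr_ge0 ?sqr_ge0//; lra.
    have t3 : 0 <= t ^+ 3 by rewrite exprn_ge0// ltW.
    have t4 : 0 <= t ^+ 4 by rewrite exprn_ge0// ltW.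
    have : 0 <= (63 + 611/625) - 128/100 * t - 4/10 * t ^+ 2 by nra.
    by move=> /(mulr_ge0 t4); nra.
  apply: ler_pM => //; first by rewrite addr_ge0 ?mulr_ge0//; lra.
  by rewrite lerD2r ler_wpM2l//; lra.
apply: (le_trans hi); rewrite ler_pM2l; last by lra.
by rewrite ler_sqr ?nnegrE//; exact: le_trans lo.
Qed.

(** Both coefficients [A] of [l^2] and [B] of [2 l] are nonnegative, so the expression increases
    with [l] and its value at [l = 5 / 2] decides. There the terms of degree five in [r] cancel and
    a quartic with leading coefficient 25/4 is left. The split at 12 is tied to this value of [l],
    since [ln 13 >= 5 / 2]. *)
Lemma threshold_ineq_ge12 (R : realType) (r l : R) : 12 <= r -> 5 / 2 <= l ->
  0 <= l ^+ 2 * (r + 1) ^+ 2 * (r + 2) * (r - 1)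
    + 2 * l * r * (r + 1) * (r ^+ 3 - r ^+ 2 - 4 * r + 2)
    - r ^+ 2 * (r - 1) * (5 * r ^+ 2 + 5 * r - 2).
Proof.
move=> r12 l25.
pose A := (r + 1) ^+ 2 * (r + 2) * (r - 1).
pose B := r * (r + 1) * (r ^+ 3 - r ^+ 2 - 4 * r + 2).
have A0 : 0 <= A by rewrite !mulr_ge0 ?sqr_ge0//; lra.
have B0 : 0 <= B by rewrite !mulr_ge0//; nra.
have h : 25 / 4 * A + 5 * B - r ^+ 2 * (r - 1) * (5 * r ^+ 2 + 5 * r - 2) =
   25/4 * (r ^+ 2 * (r ^+ 2 + 3 * r + 1) - 3 * r - 2) - 18 * r ^+ 3 - 12 * r ^+ 2 + 10 * r.
  by rewrite /A /B; field.
have : 0 <= 25/4 * (r ^+ 2 * (r ^+ 2 + 3 * r + 1) - 3 * r - 2) - 18 * r ^+ 3 - 12 * r ^+ 2 + 10 * r.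
  have : 144 <= r ^+ 2 by nra.
  by nra.
rewrite -h => {}h; apply: (le_trans h); rewrite lerD2r lerD//.
  have -> : l ^+ 2 * (r + 1) ^+ 2 * (r + 2) * (r - 1) = l ^+ 2 * A by rewrite /A; ring.
  by rewrite ler_wpM2r//; nra.
have -> : 2 * l * r * (r + 1) * (r ^+ 3 - r ^+ 2 - 4 * r + 2) = 2 * l * B by rewrite /B; ring.
by rewrite ler_wpM2r//; lra.
Qed.

Lemma ln_13_bounds (R : realType) : 5 / 2 <= ln (13 : R) <= 263 / 100.
Proof.
have /ln1D_near4/andP[] : -1 < (12 : R) by lra.
have -> : (12 + 1 = 13 :> R) by lra.
have -> : (12 - 3) * (5 * 12 + 9) / (2 * 13 * (12 + 9)) = 207 / 182 :> R by field.
have -> : (12 - 3) * (12 + 21) / (16 * (12 + 3)) = 99 / 80 :> R by field.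
by move=> ? ?; apply/andP; split; lra.
Qed.

(* The sign of [threshold2] below, with denominators cleared.  Writing
   [u = k * (1 - r^-1) * l], the claim is a lower bound for
   [u * coth (u / 2)]; for [r <= 12] it comes from the Pade approximant, and for
   larger [r] from [E <= r + 1] alone. *)
Lemma threshold2_num_ge0 (R : realType) (r k l a E : R) : 1 < r -> 1 <= k ->
  l = ln (r + 1) -> a = (r + 1) * l + r * (r - 1) ->
  k * ((1 - r^-1) * l) <= l -> E = expR (k * ((1 - r^-1) * l)) ->
  (E - 1) * (r * (2 * (r + 1) ^+ 2 * l + r * (r - 1) * (r ^+ 2 + 5 * r + 2))) <=
  (r - 1) * k * a ^+ 2 * (E + 1).
Proof.
move=> r1 k1 lE aE kg EE.
have l0 : 0 < l by rewrite lE; apply: ln_gt0; lra.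
have a0 : 0 <= a by rewrite aE addr_ge0// mulr_ge0//; lra.
have r0 : r != 0 by rewrite gt_eqF//; lra.
have rV1 : r^-1 < 1 by rewrite invf_lt1//; lra.
have [g gE] : exists g, g = (1 - r^-1) * l by exists ((1 - r^-1) * l).
rewrite -gE in kg EE.
have g0 : 0 < g by rewrite gE mulr_gt0// subr_gt0.
have E1 : 0 < E - 1 by rewrite EE subr_gt0 expR_gt1 mulr_gt0//; lra.
have rg : r * g = (r - 1) * l by rewrite gE; field.
have /andP[l13 l13'] := ln_13_bounds R.
have [r12|r12] := leP r 12.
(* From [g <= 11/12 * ln 13]. This bounds the factor [60 + g^2] by the constant 66 of
   [threshold_ineq_le12]. *)
- have g6 : g ^+ 2 <= 6.
    have ll : l <= 263 / 100.
      by apply: le_trans l13'; rewrite lE ler_ln ?posrE; lra.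
    have rV : r^-1 >= 12^-1 by rewrite lef_pV2 ?posrE//; lra.
    have : g <= 11 / 12 * (263 / 100) by rewrite gE; nra.
    by nra.
  have u0 : 0 <= k * g by rewrite mulr_ge0// ?ltW//; lra.
  have := pade_expR u0; rewrite -EE => pade.
  (* For [u = k g] the Pade bound reads [u coth (u / 2) >= (120 + 12 u^2) / (60 + u^2)]. The
     right-hand side increases with [u], and [u >= g], so [u] may be replaced there by [g], which is
     free of [k]. *)
  have h1 : (E - 1) * (120 + 12 * g ^+ 2) <= k * (E + 1) * g * (60 + g ^+ 2).
    have h : (E - 1) * (120 + 12 * (k * g) ^+ 2) <= (E + 1) * (k * g) * (60 + (k * g) ^+ 2).
      by lra.
    have kg2 : g ^+ 2 <= (k * g) ^+ 2 by rewrite exprMn ler_peMl ?sqr_ge0// exprn_ege1.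
    have p1 : 0 < 60 + (k * g) ^+ 2 by rewrite ltr_wpDr ?sqr_ge0//; lra.
    rewrite -(ler_pM2r p1).
    apply: (@le_trans _ _ ((E - 1) * (120 + 12 * (k * g) ^+ 2) * (60 + g ^+ 2))).
      rewrite -!mulrA ler_pM2l//; nra.
    apply: (@le_trans _ _ ((E + 1) * (k * g) * (60 + (k * g) ^+ 2) * (60 + g ^+ 2))).
      by rewrite ler_wpM2r// addr_ge0 ?sqr_ge0//; lra.
    by rewrite le_eqVlt; apply/orP; left; apply/eqP; ring.
  have h2 : r * (2 * (r + 1) ^+ 2 * l + r * (r - 1) * (r ^+ 2 + 5 * r + 2)) *
      (g * (60 + g ^+ 2)) <= (r - 1) * a ^+ 2 * (120 + 12 * g ^+ 2).
    have key : (60 + g ^+ 2) * r ^+ 3 * ((r + 2) * l - 2 * r) <= 10 * (a * l) ^+ 2.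
      have r3 : 0 <= r ^+ 3 by rewrite exprn_ge0//; lra.
      have [s0|s0] := leP 0 ((r + 2) * l - 2 * r).
        apply: le_trans (_ : _ <= 66 * r ^+ 3 * ((r + 2) * l - 2 * r)) _; last first.
          by rewrite aE lE; apply: threshold_ineq_le12; rewrite r1.
        rewrite ler_wpM2r// ler_wpM2r//; lra.
      apply: (@le_trans _ _ 0); last by rewrite mulr_ge0 ?sqr_ge0.
      rewrite mulr_ge0_le0//; last exact: ltW.
      by rewrite mulr_ge0// addr_ge0 ?sqr_ge0.
    rewrite -subr_ge0.
    have -> : (r - 1) * a ^+ 2 * (120 + 12 * g ^+ 2) - r * (2 * (r + 1) ^+ 2 * l + r * (r - 1) * (r ^+ 2 + 5 * r + 2)) * (g * (60 + g ^+ 2)) =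
      (r - 1) ^+ 3 / r ^+ 2 * (10 * (a * l) ^+ 2 - (60 + g ^+ 2) * r ^+ 3 * ((r + 2) * l - 2 * r)).
      have -> : g = (r - 1) * l / r by rewrite -rg mulrC mulKf.
      by rewrite aE; field.
    rewrite mulr_ge0 ?subr_ge0// divr_ge0 ?sqr_ge0// exprn_ge0//; lra.
  have p2 : 0 < g * (60 + g ^+ 2) by rewrite mulr_gt0// ltr_wpDr ?sqr_ge0//; lra.
  rewrite -(ler_pM2r p2).
  apply: (@le_trans _ _ ((E - 1) * ((r - 1) * a ^+ 2 * (120 + 12 * g ^+ 2)))).
    by rewrite -[leLHS]mulrA ler_pM2l.
  have p3 : 0 <= (r - 1) * a ^+ 2 by rewrite mulr_ge0 ?sqr_ge0//; lra.
  have := ler_wpM2l p3 h1; lra.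
- have l25 : 5 / 2 <= l by apply: (le_trans l13); rewrite lE ler_ln ?posrE; lra.
  have := threshold_ineq_ge12 (ltW r12) l25 => q.
  have Er : E <= r + 1.
    have -> : r + 1 = expR l by rewrite lE lnK// posrE; lra.
    by rewrite EE ler_expR.
  (* Since [(E + 1) / (E - 1)] decreases in [E], the bound [E <= r + 1] makes it at least
     [(r + 2) / r]; then [k >= 1]. *)
  have c1 : (r + 2) * (E - 1) <= r * k * (E + 1).
    apply: (@le_trans _ _ (r * (E + 1))); first by lra.
    by rewrite ler_wpM2r//; [lra|nra].
  have h2 : r ^+ 2 * (2 * (r + 1) ^+ 2 * l + r * (r - 1) * (r ^+ 2 + 5 * r + 2)) <= (r - 1) * a ^+ 2 * (r + 2).
    rewrite -subr_ge0; apply: (le_trans q); rewrite le_eqVlt; apply/orP; left.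
    by apply/eqP; rewrite aE; ring.
  have p2 : 0 < r by lra.
  rewrite -(ler_pM2r p2).
  apply: (@le_trans _ _ ((E - 1) * ((r - 1) * a ^+ 2 * (r + 2)))).
    rewrite -[leLHS]mulrA ler_pM2l//.
    by apply: le_trans h2; rewrite le_eqVlt; apply/orP; left; apply/eqP; ring.
  have p3 : 0 <= (r - 1) * a ^+ 2 by rewrite mulr_ge0 ?sqr_ge0//; lra.
  have := ler_wpM2l p3 c1; lra.
Qed.

(** * The threshold function *)

(* [threshold k r] is [delta_rs r s + k^-1] for [k = s / (s - 1)]; the suffixes [1]
   and [2] stand for the first and second derivatives in [r]. *)
Definition log_exponent (R : realType) (r : R) : R := (1 - r^-1) * ln (r + 1).
Definition log_exponent1 (R : realType) (r : R) : R :=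
  ((r + 1) * ln (r + 1) + r * (r - 1)) / (r ^+ 2 * (r + 1)).
Definition log_exponent2 (R : realType) (r : R) : R :=
  - 2 * ln (r + 1) / r ^+ 3 + (- r ^+ 2 + 3 * r + 2) / (r ^+ 2 * (r + 1) ^+ 2).
Definition threshold (R : realType) (k r : R) : R :=
  (r - 1) / (expR (k * log_exponent r) - 1).
Definition threshold1 (R : realType) (k r : R) : R :=
  (expR (k * log_exponent r) - 1)^-1 -
  (r - 1) * k * log_exponent1 r * expR (k * log_exponent r) / (expR (k * log_exponent r) - 1) ^+ 2.
Definition threshold2 (R : realType) (k r : R) : R :=
  k * expR (k * log_exponent r) / (expR (k * log_exponent r) - 1) ^+ 3 *
  ((r - 1) * k * log_exponent1 r ^+ 2 * (expR (k * log_exponent r) + 1) -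
   (expR (k * log_exponent r) - 1) * (2 * log_exponent1 r + (r - 1) * log_exponent2 r)).

Lemma is_derive_ln1D (R : realType) (r : R) : 0 < r ->
  is_derive r 1 (fun x : R => ln (x + 1)) (r + 1)^-1.
Proof.
move=> r0; have r10 : 0 < r + 1 by lra.
have := is_derive1_ln r10 => D.
have D2 : is_derive r 1 (fun x : R => x + 1) 1.
  by apply: is_derive_eq; rewrite addr0.
have := @is_derive1_comp R (@ln R) (fun x : R => x + 1) r _ _ D D2.
by rewrite mulr1.
Qed.

Lemma is_derive_inv (R : realType) (r : R) : r != 0 ->
  is_derive r 1 (fun x : R => x^-1) (- r ^- 2).
Proof.
move=> r0; have := @is_deriveV R id r 1 1 r0 (is_derive_id _ _).
by rewrite /GRing.scale/= mulr1.
Qed.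

Lemma is_derive_log_exponent (R : realType) (r : R) : 0 < r ->
  is_derive r 1 (@log_exponent R) (log_exponent1 r).
Proof.
move=> r0; have r0' : r != 0 by rewrite gt_eqF.
have := is_derive_ln1D r0 => D1; have := is_derive_inv r0' => D2.
rewrite /log_exponent; apply: is_derive_eq.
rewrite /log_exponent1 /GRing.scale/=; field.
by rewrite r0' gt_eqF//; lra.
Qed.

Lemma is_derive_log_exponent1 (R : realType) (r : R) : 0 < r ->
  is_derive r 1 (@log_exponent1 R) (log_exponent2 r).
Proof.
move=> r0; have r0' : r != 0 by rewrite gt_eqF.
have q0 : r ^+ 2 * (r + 1) != 0 by rewrite gt_eqF// mulr_gt0 ?exprn_gt0//; lra.
have := is_derive_ln1D r0 => D1.
have D3 := @is_deriveV R (fun x : R => x ^+ 2 * (x + 1)) r _ 1 q0 _.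
rewrite /log_exponent1; apply: is_derive_eq.
rewrite /log_exponent2 /GRing.scale/=; field.
by rewrite r0' gt_eqF//; lra.
Qed.

Lemma log_exponent_gt0 (R : realType) (r : R) : 1 < r -> 0 < log_exponent r.
Proof.
move=> r1; rewrite mulr_gt0 ?ln_gt0//; [|lra].
by rewrite subr_gt0 invf_lt1//; lra.
Qed.

Lemma is_derive_expR_log_exponent (R : realType) (k r : R) : 0 < r ->
  is_derive r 1 (fun x => expR (k * log_exponent x)) (k * log_exponent1 r * expR (k * log_exponent r)).
Proof.
move=> r0; have D := is_derive_log_exponent r0.
have D2 : is_derive r 1 (fun x => k * log_exponent x) (k * log_exponent1 r).
  by apply: is_derive_eq; rewrite /GRing.scale/=; ring.
have := @is_derive1_comp R (@expR R) (fun x => k * log_exponent x) r _ _ (is_derive_expR _) D2.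
by rewrite mulrC.
Qed.

Lemma expR_log_exponent_gt1 (R : realType) (k r : R) : 0 < k -> 1 < r ->
  0 < expR (k * log_exponent r) - 1.
Proof. by move=> k0 r1; rewrite subr_gt0 expR_gt1 mulr_gt0// log_exponent_gt0. Qed.

Lemma is_derive_threshold (R : realType) (k r : R) : 0 < k -> 1 < r ->
  is_derive r 1 (threshold k) (threshold1 k r).
Proof.
move=> k0 r1; have E0 := expR_log_exponent_gt1 k0 r1; have r0 : 0 < r by lra.
have D := is_derive_expR_log_exponent k r0.
have E0' : expR (k * log_exponent r) - 1 != 0 by rewrite gt_eqF.
have D3 := @is_deriveV R (fun x : R => expR (k * log_exponent x) - 1) r _ 1 E0' _.
rewrite /threshold; apply: is_derive_eq.
by rewrite /threshold1 /GRing.scale/=; field.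
Qed.

Lemma is_derive_threshold1 (R : realType) (k r : R) : 0 < k -> 1 < r ->
  is_derive r 1 (threshold1 k) (threshold2 k r).
Proof.
move=> k0 r1; have E0 := expR_log_exponent_gt1 k0 r1; have r0 : 0 < r by lra.
have D := is_derive_expR_log_exponent k r0.
have D1 := is_derive_log_exponent1 r0.
have E0' : expR (k * log_exponent r) - 1 != 0 by rewrite gt_eqF.
have E2 : (expR (k * log_exponent r) - 1) ^+ 2 != 0 by rewrite sqrf_eq0.
have D3 := @is_deriveV R (fun x : R => expR (k * log_exponent x) - 1) r _ 1 E0' _.
have D4 := @is_deriveV R (fun x : R => (expR (k * log_exponent x) - 1) ^+ 2) r _ 1 E2 _.
rewrite /threshold1; apply: is_derive_eq.
by rewrite /threshold2 /GRing.scale/=; field.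
Qed.

(** The bracket in [threshold2] is the difference of the two sides of [threshold2_num_ge0], divided
    by [r^4 (r + 1)^2]. *)
Lemma threshold2_ge0 (R : realType) (k r : R) : 1 <= k -> 1 < r ->
  k * log_exponent r <= ln (r + 1) -> 0 <= threshold2 k r.
Proof.
move=> k1 r1 kg; have k0 : 0 < k by lra.
have E0 := expR_log_exponent_gt1 k0 r1.
have r0 : 0 < r by lra.
have := threshold2_num_ge0 r1 k1 erefl erefl kg erefl; rewrite -/(log_exponent r) => h.
rewrite /threshold2 mulr_ge0//.
  by rewrite divr_ge0 ?mulr_ge0 ?expR_ge0 ?exprn_ge0// ltW.
move: h; set E := expR _; set l := ln _ => h.
have -> : (r - 1) * k * log_exponent1 r ^+ 2 * (E + 1) - (E - 1) * (2 * log_exponent1 r + (r - 1) * log_exponent2 r) =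
  ((r - 1) * k * ((r + 1) * l + r * (r - 1)) ^+ 2 * (E + 1) -
  (E - 1) * (r * (2 * (r + 1) ^+ 2 * l + r * (r - 1) * (r ^+ 2 + 5 * r + 2)))) / (r ^+ 4 * (r + 1) ^+ 2).
  by rewrite /log_exponent1 /log_exponent2 -/l; field; rewrite !gt_eqF//; lra.
rewrite divr_ge0 ?subr_ge0// mulr_ge0 ?sqr_ge0// exprn_ge0//; lra.
Qed.

Lemma ln_lt_subr1 (R : realType) (y : R) : 0 < y -> y != 1 -> ln y < y - 1.
Proof.
move=> y0 y1; rewrite ltrBrDl -[ltRHS](@lnK R y) ?posrE//.
by apply: expR_gt1Dx; rewrite ln_eq0.
Qed.

Lemma ln_le_subr1 (R : realType) (y : R) : 0 < y -> ln y <= y - 1.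
Proof.
move=> y0; have [->|y1] := eqVneq y 1; first by rewrite ln1 subrr.
by rewrite ltW// ln_lt_subr1.
Qed.

(** Put [w = 1 + e r]. The inequality [ln y <= y - 1] is used at [(r + 1) / w] and at [1 / w] with
    weights [e] and [1 - e]: the weighted mean of these two points is 1, so the bounds add up to 0.
    The first one is strict. *)
Lemma expR_lt_bernoulli (R : realType) (e r : R) : 0 < e < 1 -> 0 < r ->
  expR (e * ln (r + 1)) < 1 + e * r.
Proof.
move=> /andP[e0 e1] r0; pose w := 1 + e * r.
have w1 : 1 < w by rewrite /w ltrDl mulr_gt0.
have w0 : 0 < w by lra.
have wr : w < r + 1 by rewrite /w addrC ltrD2r gtr_pMl.
have -> : 1 + e * r = expR (ln w) by rewrite lnK.
rewrite ltr_expR.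
have h1 : ln ((r + 1) / w) < (r + 1) / w - 1.
  rewrite ln_lt_subr1 ?divr_gt0//; first lra.
  by rewrite gt_eqF// ltr_pdivlMr// mul1r.
have h2 : ln w^-1 <= w^-1 - 1 by rewrite ln_le_subr1// invr_gt0.
rewrite lnV ?posrE// in h2; rewrite ln_div ?posrE// in h1; last by lra.
have h : e * ((r + 1) / w - 1) + (1 - e) * (w^-1 - 1) = 0.
  by rewrite /w; field; rewrite gt_eqF.
nra.
Qed.

(** * Sign, convexity, bounds and limits of delta(r, s) *)

Section delta.
Context {R : realType}.
Implicit Types r s : R.

Let kE s : 1 < s -> 1 < s / (s - 1).
Proof. by move=> s1; rewrite ltr_pdivlMr ?subr_gt0//; lra. Qed.

Lemma delta_rsE r s : 1 < r -> 1 < s ->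
  delta_rs r s = threshold (s / (s - 1)) r - (s / (s - 1))^-1.
Proof.
move=> r1 s1; rewrite /delta_rs /threshold /powR gt_eqF; last by lra.
have -> : s * (r - 1) / (r * (s - 1)) * ln (r + 1) = s / (s - 1) * log_exponent r.
  by rewrite /log_exponent; field; rewrite !gt_eqF//; lra.
have -> : (s / (s - 1))^-1 = 1 - s^-1 by field; rewrite !gt_eqF//; lra.
by rewrite opprB addrA addrAC.
Qed.

Lemma scaled_exponentE r s :
  s / (s - 1) * log_exponent r = s / (s - 1) * (1 - r^-1) * ln (r + 1).
Proof. by rewrite /log_exponent mulrA. Qed.

Let exponent_le1 r s : 1 < r -> r <= s -> s / (s - 1) * (1 - r^-1) <= 1.
Proof.
move=> r1 rs.
have -> : s / (s - 1) * (1 - r^-1) = (s * (r - 1)) / ((s - 1) * r).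
  by field; rewrite !gt_eqF//; lra.
by rewrite ler_pdivrMr ?mulr_gt0; nra.
Qed.

Let exponent_lt1 r s : 1 < r -> r < s -> s / (s - 1) * (1 - r^-1) < 1.
Proof.
move=> r1 rs.
have -> : s / (s - 1) * (1 - r^-1) = (s * (r - 1)) / ((s - 1) * r).
  by field; rewrite !gt_eqF//; lra.
by rewrite ltr_pdivrMr ?mulr_gt0; nra.
Qed.

Lemma delta_rs_ss s : 1 < s -> delta_rs s s = 0.
Proof.
move=> s1; rewrite delta_rsE// /threshold scaled_exponentE.
have -> : s / (s - 1) * (1 - s^-1) = 1 by field; rewrite !gt_eqF//; lra.
by rewrite mul1r lnK ?posrE; [field; rewrite !gt_eqF//; lra|lra].
Qed.

(** With [k = s / (s - 1)] the claim is [E - 1 < k (r - 1)] for [E = (r + 1)^e] and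
    [e = k (1 - 1/r)]. As [e r = k (r - 1)], this is the strict Bernoulli inequality; [r < s] gives
    [e < 1]. *)
Lemma delta_rs_gt0 r s : 1 < r -> r < s -> 0 < delta_rs r s.
Proof.
move=> r1 rs; have s1 : 1 < s by lra.
have k1 := kE s1; have k0 : 0 < s / (s - 1) by lra.
rewrite delta_rsE// subr_gt0 /threshold.
have rV : 0 < 1 - r^-1 by rewrite subr_gt0 invf_lt1//; lra.
have e1 := exponent_lt1 r1 rs.
have := @expR_lt_bernoulli R (s / (s - 1) * (1 - r^-1)) r.
rewrite -scaled_exponentE e1 mulr_gt0// => /(_ isT) h.
have {h} := h ltac:(lra).
have E0 := expR_log_exponent_gt1 k0 r1; move: E0; set E := expR _ => E0 h.
rewrite ltr_pdivlMr// -lter_pdivlMl ?invr_gt0// invrK.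
have -> : s / (s - 1) * (r - 1) = s / (s - 1) * (1 - r^-1) * r.
  by field; rewrite !gt_eqF//; lra.
lra.
Qed.

Lemma threshold_convex k (a b t : R) : 1 <= k -> 1 < a -> a <= b ->
  (forall x, a <= x <= b -> k * log_exponent x <= ln (x + 1)) ->
  0 <= t <= 1 ->
  threshold k (t * a + (1 - t) * b) <= t * threshold k a + (1 - t) * threshold k b.
Proof.
move=> k1 a1 ab kg /andP[t0 t1].
have k0 : 0 < k by lra.
have D (x : R) : 1 < x -> 'D_1 (threshold k) x = threshold1 k x.
  by move=> x1; have [_ ->] := is_derive_threshold k0 x1.
(* The derivative of [threshold k] is known only on [x > 1], an open set, so it agrees with
   [threshold1 k] near each such point and can be differentiated again. *)
have D2 (x : R) : 1 < x -> is_derive x 1 ('D_1 (threshold k)) (threshold2 k x).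
  move=> x1; apply: (near_eq_is_derive (f := threshold1 k)).
  - near=> y; rewrite D//; near: y; exact: lt_nbhsr.
  - exact: is_derive_threshold1.
pose T : {i01 R} := Itv01 t0 t1.
have cD (x : R) : 1 < x -> {for x, continuous (threshold k)}.
  move=> x1; apply: differentiable_continuous; apply/derivable1_diffP.
  by have [] := is_derive_threshold k0 x1.
have := @second_derivative_convex R (threshold k : R -> R^o) a b _ _ _ _ _ T ab.
apply.
- move=> x /andP[ax xb]; have x1 : 1 < x by lra.
  have [_ ->] := D2 _ x1.
  by apply: threshold2_ge0 => //; apply: kg; lra.
- by apply: cvg_at_left_filter; apply: cD; lra.
- by apply: cvg_at_right_filter; apply: cD; lra.
- move=> x /[!in_itv]/= /andP[ax xb]; have x1 : 1 < x by lra.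
  by have [] := is_derive_threshold k0 x1.
- move=> x /[!in_itv]/= /andP[ax xb]; have x1 : 1 < x by lra.
  by have [] := D2 _ x1.
Unshelve. all: by end_near. Qed.

(** The right end [s] is included because [delta_rs_decr] uses a segment ending at the zero
    [delta_rs s s]. The condition [x <= s] is exactly what keeps [k (1 - 1/x)] at most 1. *)
Lemma delta_rs_convex s (a b t : R) : 1 < a <= s -> 1 < b <= s ->
  0 <= t <= 1 ->
  delta_rs (t * a + (1 - t) * b) s <= t * delta_rs a s + (1 - t) * delta_rs b s.
Proof.
move=> /andP[+ +] /andP[+ +] /andP[+ +].
wlog ab : a b t / a <= b.
  move=> h a1 as1 b1 bs t0 t1; have [ab|/ltW ba] := leP a b; first exact: h.
  have := h b a (1 - t) ba b1 bs a1 as1.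
  rewrite subKr [(1 - t) * b + _]addrC [(1 - t) * delta_rs b s + _]addrC.
  by apply; lra.
move=> a1 as1 b1 bs t0 t1.
have s1 : 1 < s by lra.
have c1 : 1 < t * a + (1 - t) * b.
  have : t * 1 + (1 - t) * 1 < t * a + (1 - t) * b.
    have [->|tn0] := eqVneq t 0; first by lra.
    have {tn0} t0' : 0 < t by rewrite lt_neqAle eq_sym tn0.
    by apply: ltr_leD; [rewrite ltr_pM2l|rewrite ler_wpM2l//; lra].
  by lra.
rewrite !delta_rsE//.
have k1 := ltW (kE s1).
have := @threshold_convex (s / (s - 1)) a b t k1 a1 ab; rewrite t0 t1.
have kg x : a <= x <= b -> s / (s - 1) * log_exponent x <= ln (x + 1).
  move=> /andP[ax xb]; rewrite scaled_exponentE.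
  by rewrite ger_pMl; [apply: exponent_le1; lra|apply: ln_gt0; lra].
by move=> /(_ kg isT); lra.
Qed.

Lemma delta_rs_decr s r1 r2 : 1 < r1 -> r1 < r2 -> r2 < s ->
  delta_rs r2 s < delta_rs r1 s.
Proof.
move=> r11 r12 r2s.
rewrite ltNge; apply/negP => le12.
(* The weight for which [r2 = t r1 + (1 - t) s]. Convexity and the assumption to be refuted give
   [delta r2 <= t delta r1 <= t delta r2], impossible for a positive value and [t < 1]. *)
pose t := (s - r2) / (s - r1).
have sr : 0 < s - r1 by lra.
have t0 : 0 <= t by rewrite divr_ge0//; lra.
have t1 : t < 1 by rewrite ltr_pdivrMr//; lra.
have : delta_rs (t * r1 + (1 - t) * s) s <= t * delta_rs r1 s + (1 - t) * delta_rs s s.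
  by apply: delta_rs_convex; apply/andP; split; lra.
have -> : t * r1 + (1 - t) * s = r2 by rewrite /t; field; rewrite gt_eqF.
rewrite delta_rs_ss ?mulr0 ?addr0 => [h|]; last by lra.
have r21 : 1 < r2 by lra.
have := delta_rs_gt0 r21 r2s; nra.
Qed.

(** By monotonicity the value at [r] is below the one at any [r'] closer to 1. There
    [exp u - 1 >= u] bounds the threshold by [k^-1 r' / ln (r' + 1)], which tends to [k^-1 / ln 2]
    as [r'] tends to 1, and [k^-1 <= 1]. *)
Lemma delta_rs_le s r : 1 < r -> r < s -> delta_rs r s <= (ln 2)^-1 - 1.
Proof.
move=> r1 rs; have s1 : 1 < s by lra.
have l2 : 0 < ln (2 : R) by rewrite ln_gt0//; lra.
apply/ler_addgt0Pr => e e0.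
(* The first bound on [r' - 1] keeps [r' / ln 2] within [e] of [1 / ln 2]; the second keeps [r']
   below [r]. *)
pose r' := 1 + Num.min (e * ln 2) ((r - 1) / 2).
have m0 : 0 < Num.min (e * ln 2) ((r - 1) / 2).
  by rewrite lt_min mulr_gt0//=; lra.
have m1 : Num.min (e * ln 2) ((r - 1) / 2) <= e * ln 2 by rewrite ge_min lexx.
have m2 : Num.min (e * ln 2) ((r - 1) / 2) <= (r - 1) / 2.
  by rewrite ge_min lexx orbT.
have r'1 : 1 < r' by rewrite /r'; lra.
have r'r : r' < r by rewrite /r'; lra.
apply: (le_trans (ltW (delta_rs_decr r'1 r'r rs))).
have k1 := kE s1; have k0 : 0 < s / (s - 1) by lra.
have l0 : 0 < ln (r' + 1) by apply: ln_gt0; lra.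
rewrite delta_rsE//.
have h1 : threshold (s / (s - 1)) r' <= (s / (s - 1))^-1 * (r' / ln (r' + 1)).
  rewrite /threshold ler_pdivrMr; last exact: expR_log_exponent_gt1.
  have -> : r' - 1 = (s / (s - 1))^-1 * (r' / ln (r' + 1)) * (s / (s - 1) * log_exponent r').
    by rewrite /log_exponent; field; rewrite !gt_eqF//; lra.
  rewrite ler_pM2l; first by have := expR_ge1Dx (s / (s - 1) * log_exponent r'); lra.
  by rewrite mulr_gt0 ?invr_gt0// divr_gt0//; lra.
have h2 : 1 <= r' / ln (r' + 1).
  rewrite ler_pdivlMr// mul1r; have := @ln_le_subr1 R (r' + 1); lra.
have h3 : r' / ln (r' + 1) <= r' / ln 2.
  rewrite ler_pM2l; [|lra].
  by rewrite lef_pV2 ?posrE// ler_ln ?posrE; lra.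
have h4 : r' / ln 2 <= (ln 2)^-1 + e.
  rewrite ler_pdivrMr// mulrDl mulVf ?gt_eqF// /r'; lra.
have h5 : (s / (s - 1))^-1 <= 1 by rewrite invf_le1// ltW.
have h6 : 0 < (s / (s - 1))^-1 by rewrite invr_gt0.
by nra.
Qed.

(** The tangent inequality at [c (r + 1)] with [c = e / 2] gives
    [ln (r + 1) <= c r + (c - 1 - ln c)]; the other half of the slope absorbs the constant once [r]
    is large. *)
Lemma ln1D_le_lin (e : R) : 0 < e ->
  exists2 M, 1 < M & forall r, M <= r -> ln (r + 1) <= e * r.
Proof.
move=> e0; pose c := e / 2.
have c0 : 0 < c by rewrite /c; lra.
exists (2 + 2 * (`|c - 1 - ln c|) / e) => [|r].
  have : 0 <= 2 * `|c - 1 - ln c| / e by rewrite divr_ge0 ?mulr_ge0// ltW.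
  by move: (2 * _ / e) => x; lra.
rewrite -lerBrDl ler_pdivrMr// => rM.
have r0 : 0 < r.
  have : 0 <= (r - 2) * e by apply: le_trans rM; rewrite mulr_ge0.
  by rewrite pmulr_lge0//; lra.
have := @ln_le_subr1 R (c * (r + 1)).
rewrite mulr_gt0//; [|lra]; move=> /(_ isT).
rewrite lnM ?posrE//; [|lra].
have := ler_norm (c - 1 - ln c).
rewrite {1}/c; move: rM; rewrite /c; nra.
Qed.

(** Uniformity in [s] comes from using only [k >= 1] and [1/k > 1 - 1/r], the latter because
    [r < s]. With [l = ln (r + 1)], the first yields [E - 1 >= (r + 1) exp (- l / r) - 1 >= r - 2
    l], hence [delta <= r / (r - 2 l) - 1 + 1/r]. The constant [c] is chosen so that [l <= c r]
    makes the first quotient at most [1 + e / 2]. *)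
Lemma delta_rs_small (e : R) : 0 < e ->
  exists2 M, 1 < M & forall r s, M <= r -> r < s -> `|delta_rs r s| < e.
Proof.
move=> e0.
pose c := e / (4 * (e + 2)).
have c0 : 0 < c by rewrite divr_gt0// mulr_gt0; lra.
have [M1 M11 HM1] := ln1D_le_lin c0.
exists (Num.max M1 (1 + 2 / e)) => [|r s]; first by rewrite lt_max M11.
rewrite ge_max => /andP[M1r er] rs.
have r1 : 1 < r by lra.
have s1 : 1 < s by lra.
rewrite gtr0_norm ?delta_rs_gt0//.
have := HM1 _ M1r; set l := ln (r + 1) => lr.
have l0 : 0 < l by apply: ln_gt0; lra.
have rV : r^-1 < e / 2.
  rewrite -[ltRHS]invrK ltf_pV2 ?posrE ?invr_gt0 ?divr_gt0//; [|lra].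
  by rewrite invf_div; lra.
have k1 := kE s1; have k0 : 0 < s / (s - 1) by lra.
rewrite delta_rsE//.
have kV : 1 - r^-1 < (s / (s - 1))^-1.
  have -> : (s / (s - 1))^-1 = 1 - s^-1 by field; rewrite !gt_eqF//; lra.
  by rewrite ltrD2l ltrN2 ltf_pV2 ?posrE//; lra.
have rl : 0 < r - 2 * l.
  have : c < 1 / 4 by rewrite /c ltr_pdivrMr ?mulr_gt0; lra.
  by nra.
have D1 : threshold (s / (s - 1)) r <= r / (r - 2 * l).
  have Eb : r - 2 * l <= expR (s / (s - 1) * log_exponent r) - 1.
    have g0 := log_exponent_gt0 r1.
    have h1 : expR (log_exponent r) <= expR (s / (s - 1) * log_exponent r).
      by rewrite ler_expR ler_peMl ?ltW.
    have h2 : expR (log_exponent r) = (r + 1) * expR (- (l / r)).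
      rewrite /log_exponent mulrBl mul1r expRD lnK ?posrE; last lra.
      by rewrite -/l [r^-1 * _]mulrC.
    have h3 := expR_ge1Dx (- (l / r)).
    have h4 : (r + 1) * (1 - l / r) = r + 1 - l - l / r by field; rewrite gt_eqF//; lra.
    have h5 : l / r <= l by rewrite ler_pdivrMr; nra.
    have : (r + 1) * (1 - l / r) <= (r + 1) * expR (- (l / r)).
      by rewrite ler_pM2l//; lra.
    by lra.
  rewrite /threshold ler_pdivrMr; last by lra.
  rewrite mulrAC ler_pdivlMr//.
  nra.
have D2 : r / (r - 2 * l) <= 1 + e / 2.
  rewrite ler_pdivrMr//.
  have : c * (4 * (e + 2)) = e by rewrite /c; field; rewrite gt_eqF//; lra.
  nra.
lra.
Qed.

Lemma cvg_delta_rs_s r : 1 < r -> delta_rs r s @[s --> +oo] --> delta_r r.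
Proof.
move=> r1.
have inv0 : (s : R)^-1 @[s --> +oo] --> (0 : R).
  apply/(@gtr0_cvgV0 R _ _ _ id); last exact: cvg_id.
  exact: nbhs_pinfty_gt.
have inv1 : (s - 1 : R)^-1 @[s --> +oo] --> (0 : R).
  apply/(@gtr0_cvgV0 R _ _ _ (fun s => s - 1)); last exact: cvg_addrr.
  by near=> x; rewrite subr_gt0; near: x; exact: nbhs_pinfty_gt.
have -> : delta_r r = (r - 1) / (expR ((1 + 0) * log_exponent r) - 1) - 1 + 0.
  rewrite /delta_r /powR gt_eqF; last by lra.
  rewrite !addr0 mul1r; congr (_ / (expR _ - 1) - 1).
  by rewrite /log_exponent; field; rewrite gt_eqF//; lra.
apply: (@cvg_trans _ ((r - 1) / (expR ((1 + (s - 1)^-1) * log_exponent r) - 1) - 1 + s^-1 @[s --> +oo])).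
  apply: near_eq_cvg; near=> s.
  have s1 : 1 < s by near: s; exact: nbhs_pinfty_gt.
  rewrite delta_rsE// /threshold.
  have -> : 1 + (s - 1)^-1 = s / (s - 1) by field; rewrite gt_eqF//; lra.
  have -> : (s / (s - 1))^-1 = 1 - s^-1 by field; rewrite !gt_eqF//; lra.
  by rewrite opprB addrA addrAC.
apply: cvgD => //; apply: cvgB; last exact: cvg_cst.
apply: cvgM; first exact: cvg_cst.
apply: cvgV.
  by rewrite addr0 gt_eqF// expR_log_exponent_gt1.
apply: cvgB; last exact: cvg_cst.
apply: continuous_cvg; first exact: continuous_expR.
apply: cvgM; last exact: cvg_cst.
by apply: cvgD => //; exact: cvg_cst.
Unshelve. all: by end_near. Qed.

End delta.

(** * Orthogonal projections *)

Section projections.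
Context {R : realType}.

Definition qform n (A : 'M[R]_n) (y : 'cV[R]_n) : R := (y^T *m A *m y) 0 0.

Lemma qformE n (A : 'M[R]_n) y : qform A y = \sum_i \sum_j A i j * (y i 0 * y j 0).
Proof.
rewrite /qform mxE exchange_big/=; apply: eq_bigr => j _.
by rewrite mxE mulr_suml; apply: eq_bigr => i _; rewrite !mxE; ring.
Qed.

Lemma qformD n (A B : 'M[R]_n) y : qform (A + B) y = qform A y + qform B y.
Proof. by rewrite /qform mulmxDr mulmxDl mxE. Qed.

Lemma qform_proj n (A : 'M[R]_n) y : A^T = A -> A *m A = A ->
  qform A y = \sum_i (A *m y) i 0 ^+ 2.
Proof.
move=> AT AA; rewrite /qform -{1}AA mulmxA -mulmxA -{1}AT -trmx_mul mxE.
by apply: eq_bigr => i _; rewrite mxE expr2.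
Qed.

Lemma qform_proj_ge0 n (A : 'M[R]_n) y : A^T = A -> A *m A = A -> 0 <= qform A y.
Proof. by move=> AT AA; rewrite qform_proj// sumr_ge0// => i _; exact: sqr_ge0. Qed.

Lemma qform_proj_eq0 n (A : 'M[R]_n) y : A *m y = 0 -> qform A y = 0.
Proof. by move=> Ay; rewrite /qform -mulmxA Ay mulmx0 mxE. Qed.

(** The squared Frobenius norm is the trace of [A^T A], which is [A] itself for a projection.
    Through it the variance of a quadratic form is controlled by the rank alone. *)
Lemma frobenius_proj n (A : 'M[R]_n) : A^T = A -> A *m A = A ->
  \sum_i \sum_j A i j ^+ 2 = \tr A.
Proof.
move=> AT AA; rewrite -[in RHS]AA /mxtrace; apply: eq_bigr => i _.
rewrite mxE; apply: eq_bigr => j _.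
by rewrite expr2; congr (_ * _); rewrite -[in LHS]AT mxE.
Qed.

(** Because [v^T X^T X v] is the squared norm of [X v]. *)
Lemma gram_mulmx_eq0 n k (X : 'M[R]_(n, k)) (v : 'cV[R]_k) :
  X^T *m X *m v = 0 -> X *m v = 0.
Proof.
move=> h; have h2 : \sum_i (X *m v) i 0 ^+ 2 = 0.
  transitivity ((v^T *m (X^T *m X *m v)) 0 0); last by rewrite h mulmx0 mxE.
  rewrite -mulmxA mulmxA -trmx_mul mxE; apply: eq_bigr => i _.
  by rewrite [in RHS]mxE expr2.
apply/matrixP => i j; rewrite ord1 [RHS]mxE; apply/eqP; rewrite -sqrf_eq0.
have /psumr_eq0P h3 : forall i, true -> 0 <= (X *m v) i 0 ^+ 2 by move=> *; exact: sqr_ge0.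
by rewrite h3.
Qed.

Lemma unitmx_ker n (M : 'M[R]_n) : (forall v : 'cV[R]_n, M *m v = 0 -> v = 0) ->
  M \in unitmx.
Proof.
move=> h; rewrite -unitmx_tr -row_free_unit -kermx_eq0; apply/eqP/row_matrixP => i.
rewrite row0; apply: trmx_inj; rewrite trmx0; apply: h.
apply: trmx_inj; rewrite trmx_mul trmxK trmx0 -row_mul mulmx_ker row0//.
Qed.

Section hat.
Variables (n p : nat) (X : 'M[R]_(n, p)).
Hypothesis uX : X^T *m X \in unitmx.

Lemma hat_sym : (hat_mx X)^T = hat_mx X.
Proof. by rewrite /hat_mx !trmx_mul trmx_inv trmx_mul trmxK mulmxA. Qed.

Lemma hat_mulX : hat_mx X *m X = X.
Proof. by rewrite /hat_mx -!mulmxA [_ *m (X^T *m X)]mulVmx// mulmx1. Qed.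

Lemma hat_idem : hat_mx X *m hat_mx X = hat_mx X.
Proof. by rewrite {2}/hat_mx !mulmxA hat_mulX. Qed.

Lemma hat_tr : \tr (hat_mx X) = p%:R.
Proof. by rewrite /hat_mx -mulmxA mxtrace_mulC -mulmxA mulVmx// mxtrace1. Qed.

Variables (i : nat) (sel : 'I_i -> 'I_p).
Hypothesis sel_inj : injective sel.
Let Z := colsub sel X.

Lemma colsub_mulmx : Z = X *m colsub sel 1%:M.
Proof. by rewrite mulmx_colsub mulmx1. Qed.

(** Full rank passes from [X] to its selected columns: [Z = X S], where [S] consists of distinct
    columns of the identity and therefore has trivial kernel. *)
Lemma colsub_unit : Z^T *m Z \in unitmx.
Proof.
apply: unitmx_ker => v /gram_mulmx_eq0; rewrite colsub_mulmx -mulmxA => h.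
have h2 : colsub sel 1%:M *m v = 0.
  by rewrite -[LHS](mulKmx uX) -[X in invmx _ *m X]mulmxA h !mulmx0.
apply/matrixP => j k; rewrite ord1 [RHS]mxE.
have /matrixP/(_ (sel j) 0) := h2; rewrite !mxE (bigD1 j)//= !mxE eqxx mul1r big1 ?addr0//.
by move=> l lj; rewrite !mxE (inj_eq sel_inj) eq_sym (negbTE lj) mul0r.
Qed.

Lemma hat_nested : hat_mx X *m hat_mx Z = hat_mx Z.
Proof. by rewrite {2 3}/hat_mx colsub_mulmx !mulmxA hat_mulX. Qed.

End hat.

Lemma hat_nestedC n p i (X : 'M[R]_(n, p)) (sel : 'I_i -> 'I_p) :
  X^T *m X \in unitmx ->
  hat_mx (colsub sel X) *m hat_mx X = hat_mx (colsub sel X).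
Proof. by move=> uX; apply: trmx_inj; rewrite trmx_mul !hat_sym hat_nested. Qed.

Section residual_projections.
Variables (n p i : nat) (X : 'M[R]_(n, p)) (sel : 'I_i -> 'I_p).
Hypothesis uX : X^T *m X \in unitmx.
Hypothesis sel_inj : injective sel.
Local Notation Z := (colsub sel X).

Definition resid_mx : 'M[R]_n := 1%:M - hat_mx X.
Definition gain_mx : 'M[R]_n := hat_mx X - hat_mx Z.

Let uZ : Z^T *m Z \in unitmx. Proof. exact: colsub_unit. Qed.

Lemma resid_sym : resid_mx^T = resid_mx.
Proof. by rewrite /resid_mx linearB/= trmx1 hat_sym. Qed.

Lemma resid_idem : resid_mx *m resid_mx = resid_mx.
Proof.
by rewrite /resid_mx mulmxBr mulmx1 mulmxBl mul1mx hat_idem// subrr subr0.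
Qed.

Lemma resid_tr : \tr resid_mx = n%:R - p%:R.
Proof. by rewrite /resid_mx linearB/= mxtrace1 hat_tr. Qed.

Lemma gain_sym : gain_mx^T = gain_mx.
Proof. by rewrite /gain_mx linearB/= !hat_sym. Qed.

Lemma gain_idem : gain_mx *m gain_mx = gain_mx.
Proof.
rewrite /gain_mx mulmxBr !mulmxBl !hat_idem// hat_nested// hat_nestedC//.
by rewrite subrr subr0.
Qed.

Lemma gain_tr : \tr gain_mx = p%:R - i%:R.
Proof. by rewrite /gain_mx linearB/= !hat_tr. Qed.

Lemma rss_full y : rss X y = qform resid_mx y.
Proof. by []. Qed.

Lemma rss_reduced y : rss Z y = qform resid_mx y + qform gain_mx y.
Proof.
rewrite -qformD /rss /qform /resid_mx /gain_mx.
by rewrite addrA subrK.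
Qed.

Lemma resid_full_mean (beta : 'cV[R]_p) : resid_mx *m (X *m beta) = 0.
Proof. by rewrite mulmxA /resid_mx mulmxBl mul1mx hat_mulX// subrr mul0mx. Qed.

Lemma resid_reduced_mean (alpha : 'cV[R]_i) : resid_mx *m (Z *m alpha) = 0.
Proof. by rewrite colsub_mulmx -mulmxA resid_full_mean. Qed.

Lemma gain_reduced_mean (alpha : 'cV[R]_i) : gain_mx *m (Z *m alpha) = 0.
Proof.
rewrite /gain_mx mulmxBl mulmxA [in X in _ - X]mulmxA (hat_mulX uZ).
by rewrite [hat_mx X *m Z](_ : _ = Z) ?subrr// colsub_mulmx mulmxA hat_mulX.
Qed.

(** The hat matrix of [X] fixes [X beta], so on this mean the gain projection acts as the residual
    projection of the reduced design. This identifies the noncentrality of W. *)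
Lemma gain_full_mean (beta : 'cV[R]_p) (sigma : R) : (0 < n)%N -> 0 < sigma ->
  qform gain_mx (X *m beta) / sigma ^+ 2 = n%:R * model_distance Z X beta sigma.
Proof.
move=> n0 s0; rewrite /model_distance -scalemxAr -scalemxAl [in RHS]mxE.
have -> : qform gain_mx (X *m beta) =
    (beta^T *m (X^T *m (1%:M - hat_mx Z) *m X) *m beta) 0 0.
  rewrite /qform trmx_mul !mulmxA; congr ((_ *m _) 0 0).
  rewrite -!mulmxA; congr (_ *m (_ *m _)).
  by rewrite /gain_mx !mulmxBl mul1mx hat_mulX.
have n0' : n%:R != 0 :> R by rewrite pnatr_eq0 -lt0n.
by field; rewrite n0' gt_eqF.
Qed.

End residual_projections.
End projections.

(** * Products of independent variables *)

Section weighted_integral.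
Context {R : realType} {d : measure_display} {T : measurableType d}.
Variable P : {measure set T -> \bar R}.
Variable X : T -> R.
Hypothesis mX : measurable_fun setT X.
Import HBNNSimple.

Lemma integral_nnsfun_weight (h : {nnsfun R >-> R}) (G : T -> R) :
  measurable_fun setT G -> (forall w, 0 <= G w) ->
  (\int[P]_w (h (X w) * G w)%:E =
   \sum_(y \in range h) y%:E * \int[P]_w (\1_(h @^-1` [set y]) (X w) * G w)%:E)%E.
Proof.
move=> mG G0.
have mi (y : R) : measurable_fun setT (fun w => \1_(h @^-1` [set y]) (X w) * G w : R).
  apply: measurable_funM => //.
  by apply: (measurableT_comp (f := \1_(h @^-1` [set y]) : R -> R)).
transitivity (\int[P]_w (\sum_(y \in range h) (y%:E * (\1_(h @^-1` [set y]) (X w) * G w)%:E)))%E.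
  apply: eq_integral => w _.
  rewrite {1}(fimfunE h (X w)).
  transitivity (\sum_(y \in range h) (y * \1_(h @^-1` [set y]) (X w) * G w)%:E)%E.
    rewrite fsumEFin//; congr EFin.
    by rewrite [RHS](_ : _ = (\sum_(y \in range h) y * \1_(h @^-1` [set y]) (X w)) * G w)// mulr_fsuml.
  by apply: eq_fsbigr => y _; rewrite -EFinM mulrA.
have ge0 y w : range h y -> (0 <= (\1_(h @^-1` [set y]) (X w) * G w)%:E)%E.
  by move=> _; rewrite lee_fin mulr_ge0// indicE.
rewrite ge0_integral_fsum//.
- apply: eq_fsbigr => y /[!inE] -[x _ <-].
  rewrite ge0_integralZl//.
  + exact/measurable_EFinP.
  + by move=> w _; apply: ge0; exists x.
  + by rewrite lee_fin.
- by move=> y; apply/measurable_EFinP; apply: measurable_funM.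
- move=> y w _; rewrite indicE -EFinM lee_fin.
  have [/set_mem/= <-|_] := boolP (X w \in h @^-1` [set y]).
    by rewrite !mulr_ge0.
  by rewrite mul0r mulr0.
Qed.

Lemma integral_weight_approx (g : R -> R) (G : T -> R)
    (mg : measurable_fun setT (EFin \o g)) : (forall x, 0 <= g x) ->
  measurable_fun setT G -> (forall w, 0 <= G w) ->
  (\int[P]_w (g (X w) * G w)%:E =
   limn (fun n => \int[P]_w (nnsfun_approx measurableT mg n (X w) * G w)%:E))%E.
Proof.
move=> g0 mG G0; set h := nnsfun_approx measurableT mg.
rewrite -monotone_convergence//.
- apply: eq_integral => w _; apply/esym/cvg_lim => //.
  have hg : (h n (X w))%:E @[n --> \oo] --> (g (X w))%:E.
    by apply: cvg_nnsfun_approx => // x _; rewrite lee_fin.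
  have Gw : (G w)%:E \is a fin_num by [].
  rewrite EFinM; exact: (cvgeZr Gw hg).
- move=> n; apply/measurable_EFinP; apply: measurable_funM => //.
  exact: measurableT_comp.
- by move=> n w _; rewrite lee_fin mulr_ge0.
- move=> w _ m n mn; rewrite lee_fin ler_wpM2r//.
  exact/lefP/nd_nnsfun_approx.
Qed.

End weighted_integral.

Section eq_integral_weight.
Import HBNNSimple.

(** Agreement on indicators passes to simple functions by linearity and to nonnegative functions by
    monotone convergence. The weights make one statement serve two purposes: a density against a
    law, and the remaining factors of a product of independent variables against their mean. *)
Lemma eq_integral_weight (R : realType) (d1 d2 : measure_display)
    (T1 : measurableType d1) (T2 : measurableType d2)
    (P1 : {measure set T1 -> \bar R}) (P2 : {measure set T2 -> \bar R})
    (X1 G1 : T1 -> R) (X2 G2 : T2 -> R) :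
  measurable_fun setT X1 -> measurable_fun setT X2 ->
  measurable_fun setT G1 -> (forall w, 0 <= G1 w) ->
  measurable_fun setT G2 -> (forall w, 0 <= G2 w) ->
  (forall A, measurable A -> \int[P1]_w (\1_A (X1 w) * G1 w)%:E =
                             \int[P2]_w (\1_A (X2 w) * G2 w)%:E)%E ->
  forall g : R -> R, measurable_fun setT g -> (forall x, 0 <= g x) ->
  (\int[P1]_w (g (X1 w) * G1 w)%:E = \int[P2]_w (g (X2 w) * G2 w)%:E)%E.
Proof.
move=> mX1 mX2 mG1 G10 mG2 G20 H g mg g0.
have mEg : measurable_fun setT (EFin \o g) by exact/measurable_EFinP.
rewrite (integral_weight_approx _ mX1 mEg)// (integral_weight_approx _ mX2 mEg)//.
congr (limn _); apply/funext => n.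
rewrite !integral_nnsfun_weight//; apply: eq_fsbigr => y _.
by rewrite H.
Qed.

End eq_integral_weight.

Lemma measurable_fun_prodr (R : realType) (d : measure_display)
    (T : measurableType d) (I : Type) (s : seq I) (Q : pred I) (f : I -> T -> R) :
  (forall j, measurable_fun setT (f j)) ->
  measurable_fun setT (fun w => \prod_(j <- s | Q j) f j w).
Proof.
move=> mf; elim: s => [|j s IH].
  by under eq_fun do rewrite big_nil; exact: measurable_cst.
have [Qj|Qj] := boolP (Q j).
  by under eq_fun do rewrite big_cons Qj; exact: measurable_funM.
by under eq_fun do rewrite big_cons (negbTE Qj).
Qed.

Section product_rule.
Context {R : realType} {d : measure_display} {T : measurableType d}.
Variables (P : probability T R) (n : nat) (Y : 'I_n -> {RV P >-> R}).
Hypothesis indY : mutually_independent Y.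

Let mY j : measurable_fun setT (Y j).
Proof. exact: measurable_funPT. Qed.

Let mfY (f : 'I_n -> R -> R) : (forall j, measurable_fun setT (f j)) ->
  forall j, measurable_fun setT (fun w => f j (Y j w)).
Proof. by move=> mf j; exact: measurableT_comp. Qed.

Lemma indep_prod_indic (A : 'I_n -> set R) (m : 'I_n -> R) :
  (forall j, measurable (A j)) ->
  (forall j, \int[P]_w (\1_(A j) (Y j w))%:E = (m j)%:E)%E ->
  (\int[P]_w (\prod_(j < n) (\1_(A j) (Y j w)))%:E = (\prod_(j < n) m j)%:E)%E.
Proof.
move=> mA mE.
have mB : measurable (\bigcap_j (Y j @^-1` A j)).
  apply: fin_bigcap_measurable; first exact: finite_finset.
  by move=> j _; rewrite -[_ @^-1` _]setTI; exact: mY.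
transitivity (P (\bigcap_j (Y j @^-1` A j))).
  rewrite -[in RHS](setIT (\bigcap_j _)) -integral_indic//.
  apply: eq_integral => w _; congr EFin.
  rewrite indicE; have [/set_mem wA|wA] := boolP (w \in _).
    rewrite big1// => j _; rewrite indicE mem_set//.
    exact: wA.
  have [j wj] : exists j, ~ (A j) (Y j w).
    apply: contrapT => /forallNP h; move/negP: wA; apply.
    by rewrite inE => j _; apply: contrapT; exact: h.
  by rewrite (bigD1 j)//= indicE memNset// mul0r.
rewrite indY// -prodEFin; apply: eq_bigr => j _.
rewrite -mE -[in LHS](setIT (Y j @^-1` A j)) -integral_indic//.
by rewrite -[_ @^-1` _]setTI; exact: mY.
Qed.

(* Induction on the number of indices whose function is not yet an indicator:
   for one index at a time, indicators are replaced by an arbitrary function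
   through [eq_integral_weight]. *)
Lemma indep_prod_ge0 (f : 'I_n -> R -> R) (m : 'I_n -> R) :
  (forall j, measurable_fun setT (f j)) -> (forall j x, 0 <= f j x) ->
  (forall j, \int[P]_w (f j (Y j w))%:E = (m j)%:E)%E ->
  (\int[P]_w (\prod_(j < n) f j (Y j w))%:E = (\prod_(j < n) m j)%:E)%E.
Proof.
move=> mf f0 fE.
suff H k : forall (f : 'I_n -> R -> R) (m : 'I_n -> R),
  (forall j, measurable_fun setT (f j)) -> (forall j x, 0 <= f j x) ->
  (forall j, \int[P]_w (f j (Y j w))%:E = (m j)%:E)%E ->
  (forall j : 'I_n, (k <= j)%N -> exists2 A, measurable A & f j = \1_A) ->
  (\int[P]_w (\prod_(j < n) f j (Y j w))%:E = (\prod_(j < n) m j)%:E)%E.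
  by apply: (H n) => // j; rewrite leqNgt ltn_ord.
elim: k {f m mf f0 fE} => [|k IH] f m mf f0 fE find.
  have [A HA] : {A : 'I_n -> set R & forall j, measurable (A j) /\ f j = \1_(A j)}.
    apply: (@choice _ _ (fun j A => measurable A /\ f j = \1_A)) => j.
    by have [A mA fA] := find j (leq0n _); exists A.
  under eq_integral do under eq_bigr do rewrite (HA _).2.
  apply: indep_prod_indic => j; first by have [] := HA j.
  by rewrite -fE; apply: eq_integral => w _; rewrite (HA j).2.
have [kn|nk] := ltnP k n; last first.
  apply: IH => // j kj; have := leq_ltn_trans kj (ltn_ord j).
  by rewrite ltnNge nk.
pose j0 := Ordinal kn.
pose c := \prod_(j < n | j != j0) m j.
pose G1 w := \prod_(j < n | j != j0) f j (Y j w).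
have m0 j : 0 <= m j.
  by rewrite -lee_fin -fE; apply: integral_ge0 => w _; rewrite lee_fin.
have c0 : 0 <= c by apply: prodr_ge0.
have mG1 : measurable_fun setT G1 by apply: measurable_fun_prodr; exact: mfY.
have G10 w : 0 <= G1 w by apply: prodr_ge0.
(* Independence in weighted form: integrated against an indicator in [Y j0], the product [G1] of the
   other factors may be replaced by the constant [c]. The induction hypothesis applies since [j0]
   now carries an indicator. *)
have H A : measurable A -> (\int[P]_w (\1_A (Y j0 w) * G1 w)%:E =
    \int[P]_w (\1_A (Y j0 w) * c)%:E)%E.
  move=> mA.
  have mYA : measurable (Y j0 @^-1` A) by rewrite -[_ @^-1` _]setTI; exact: mY.
  pose f' j := if j == j0 then \1_A else f j.
  pose m' j := if j == j0 then fine (P (Y j0 @^-1` A)) else m j.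
  have iA : (\int[P]_w (\1_A (Y j0 w))%:E = (fine (P (Y j0 @^-1` A)))%:E)%E.
    rewrite fineK ?fin_num_measure//.
    by rewrite -[in RHS](setIT (Y j0 @^-1` A)) -integral_indic.
  have := IH f' m'; have -> : (fun w => (\prod_(j < n) f' j (Y j w))%:E) =
      (fun w => (\1_A (Y j0 w) * G1 w)%:E).
    apply/funext => w; rewrite (bigD1 j0)//= /f' eqxx; congr (_ * _)%:E.
    by apply: eq_bigr => j /negbTE ->.
  move=> ->.
  - rewrite (bigD1 j0)//= {1}/m' eqxx (eq_bigr m); last first.
      by move=> j /negbTE; rewrite /m' => ->.
    rewrite -/c EFinM -iA.
    under [RHS]eq_integral do rewrite EFinM.
    rewrite ge0_integralZr ?lee_fin//.
    by apply/measurable_EFinP; apply: (measurableT_comp (f := \1_A : R -> R)).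
  - by move=> j; rewrite /f'; case: ifP.
  - by move=> j x; rewrite /f'; case: ifP => // _; rewrite indicE.
  - by move=> j; rewrite /f' /m'; case: ifP => [/eqP ->|].
  - move=> j kj; rewrite /f'; case: ifP => [_|/negbT jj0]; first by exists A.
    apply: find; rewrite ltn_neqAle kj andbT; apply: contra jj0 => /eqP e.
    by apply/eqP/val_inj.
transitivity (\int[P]_w (f j0 (Y j0 w) * G1 w)%:E)%E.
  by apply: eq_integral => w _; rewrite (bigD1 j0).
rewrite (eq_integral_weight (mY j0) (mY j0) mG1 G10 (measurable_cst c) (fun=> c0) H)//.
transitivity (\int[P]_w ((f j0 (Y j0 w))%:E * c%:E))%E => [//|].
rewrite ge0_integralZr ?lee_fin//; [|exact/measurable_EFinP/mfY|by move=> w _ /=; rewrite lee_fin].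
by rewrite fE -EFinM (bigD1 j0 (P := xpredT)).
Qed.

Lemma indep_prod_integrable (f : 'I_n -> R -> R) :
  (forall j, measurable_fun setT (f j)) ->
  (forall j, P.-integrable setT (fun w => (f j (Y j w))%:E)) ->
  P.-integrable setT (fun w => (\prod_(j < n) f j (Y j w))%:E).
Proof.
move=> mf fi.
have mg : measurable_fun setT (fun w => \prod_(j < n) f j (Y j w)).
  by apply: measurable_fun_prodr; exact: mfY.
apply/integrableP; split; first exact/measurable_EFinP.
pose m j := fine (\int[P]_w (`|f j (Y j w)|)%:E).
rewrite (eq_integral (fun w => (\prod_(j < n) `|f j (Y j w)|)%:E)); last first.
  by move=> w _ /=; rewrite normr_prod.
rewrite (@indep_prod_ge0 (fun j x => `|f j x|) m) ?ltry//.
  by move=> j; exact: measurableT_comp.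
move=> j; rewrite fineK// ge0_fin_numE; last by apply: integral_ge0.
by have /integrableP[_] := fi j; under eq_integral do rewrite abse_EFin.
Qed.

Lemma indep_prod_integral (f : 'I_n -> R -> R) (m : 'I_n -> R) :
  (forall j, measurable_fun setT (f j)) ->
  (forall j, P.-integrable setT (fun w => (f j (Y j w))%:E)) ->
  (forall j, \int[P]_w (f j (Y j w))%:E = (m j)%:E)%E ->
  (\int[P]_w (\prod_(j < n) f j (Y j w))%:E = (\prod_(j < n) m j)%:E)%E.
Proof.
suff H k : forall (f : 'I_n -> R -> R) (m : 'I_n -> R),
  (forall j, measurable_fun setT (f j)) ->
  (forall j, P.-integrable setT (fun w => (f j (Y j w))%:E)) ->
  (forall j, \int[P]_w (f j (Y j w))%:E = (m j)%:E)%E ->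
  (forall j : 'I_n, (k <= j)%N -> forall x, 0 <= f j x) ->
  (\int[P]_w (\prod_(j < n) f j (Y j w))%:E = (\prod_(j < n) m j)%:E)%E.
  by move=> *; apply: (H n) => // j; rewrite leqNgt ltn_ord.
elim: k {f m} => [|k IH] f m mf fi fE f0.
  by apply: indep_prod_ge0 => // j; exact: f0.
have [kn|nk] := ltnP k n; last first.
  apply: IH => // j kj; have := leq_ltn_trans kj (ltn_ord j).
  by rewrite ltnNge nk.
pose j0 := Ordinal kn.
pose rep (g : R -> R) j := if j == j0 then g else f j.
have repE (g : R -> R) w : \prod_(j < n) rep g j (Y j w) =
    g (Y j0 w) * \prod_(j < n | j != j0) f j (Y j w).
  rewrite (bigD1 j0)//= /rep eqxx; congr (_ * _).
  by apply: eq_bigr => j /negbTE ->.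
have step (g : R -> R) : measurable_fun setT g -> (forall x, 0 <= g x) ->
    P.-integrable setT (fun w => (g (Y j0 w))%:E) ->
    P.-integrable setT (fun w => (\prod_(j < n) rep g j (Y j w))%:E) /\
    (\int[P]_w (\prod_(j < n) rep g j (Y j w))%:E =
     \int[P]_w (g (Y j0 w))%:E * (\prod_(j < n | j != j0) m j)%:E)%E.
  move=> mg g0 gi.
  have mr j : measurable_fun setT (rep g j) by rewrite /rep; case: ifP.
  have ri j : P.-integrable setT (fun w => (rep g j (Y j w))%:E).
    by rewrite /rep; case: ifP => [/eqP ->|].
  split; first exact: indep_prod_integrable.
  pose m' j := if j == j0 then fine (\int[P]_w (g (Y j0 w))%:E) else m j.
  rewrite (IH (rep g) m')//.
  - rewrite (bigD1 j0)//= {1}/m' eqxx (eq_bigr m); last first.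
      by move=> j /negbTE; rewrite /m' => ->.
    rewrite EFinM fineK//; exact: integrable_fin_num.
  - move=> j; rewrite /rep /m'; case: ifP => [/eqP ->|_]; last exact: fE.
    by rewrite fineK//; exact: integrable_fin_num.
  - move=> j kj x; rewrite /rep; case: ifP => // /negbT jj0.
    apply: f0; rewrite ltn_neqAle kj andbT; apply: contra jj0 => /eqP e.
    by apply/eqP/val_inj.
have mj0 := mf j0.
have [ip Ep] : P.-integrable setT (fun w => (\prod_(j < n) rep (f j0)^\+ j (Y j w))%:E) /\
    (\int[P]_w (\prod_(j < n) rep (f j0)^\+ j (Y j w))%:E =
     \int[P]_w ((f j0)^\+ (Y j0 w))%:E * (\prod_(j < n | j != j0) m j)%:E)%E.
  apply: step; [exact: measurable_funrpos|by move=> x; exact: funrpos_ge0|].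
  exact: (integrable_funrpos (f := fun w => f j0 (Y j0 w)) measurableT (fi j0)).
have [im Em] : P.-integrable setT (fun w => (\prod_(j < n) rep (f j0)^\- j (Y j w))%:E) /\
    (\int[P]_w (\prod_(j < n) rep (f j0)^\- j (Y j w))%:E =
     \int[P]_w ((f j0)^\- (Y j0 w))%:E * (\prod_(j < n | j != j0) m j)%:E)%E.
  apply: step; [exact: measurable_funrneg|by move=> x; exact: funrneg_ge0|].
  exact: (integrable_funrneg (f := fun w => f j0 (Y j0 w)) measurableT (fi j0)).
have fB x : f j0 x = (f j0)^\+ x - (f j0)^\- x.
  by rewrite -{1}(funrposBneg (f j0)).
transitivity (\int[P]_w ((\prod_(j < n) rep (f j0)^\+ j (Y j w))%:E -
                        (\prod_(j < n) rep (f j0)^\- j (Y j w))%:E))%E.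
  apply: eq_integral => w _; rewrite -EFinB; congr EFin.
  by rewrite !repE -mulrBl -fB (bigD1 j0).
have ifp := integrable_funrpos (f := fun w => f j0 (Y j0 w)) measurableT (fi j0).
have ifn := integrable_funrneg (f := fun w => f j0 (Y j0 w)) measurableT (fi j0).
have := fE j0; rewrite (eq_integral (fun w => ((f j0)^\+ (Y j0 w))%:E - ((f j0)^\- (Y j0 w))%:E)%E); last first.
  by move=> w _; rewrite -EFinB -fB.
rewrite !integralB_EFin// Ep Em.
have fp := integrable_fin_num measurableT ifp; have fn := integrable_fin_num measurableT ifn.
rewrite -(fineK fp) -(fineK fn) -EFinB => -[e].
by rewrite -!EFinM -EFinB -mulrBl e (bigD1 j0 (P := xpredT)).
Qed.

End product_rule.

(** * Gaussian moments *)

Section standard_normal.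
Context {R : realType}.
Notation mu := (@lebesgue_measure R).
Local Notation phi := (normal_pdf (0 : R) 1).

Lemma std_pdfE y : phi y = normal_peak 1 * expR (- (y ^+ 2 / 2)).
Proof.
rewrite normal_pdfE ?oner_eq0// /normal_fun subr0 expr1n; congr (_ * expR _).
by rewrite mulNr.
Qed.

Lemma std_pdf_symm y : phi (- y) = phi y.
Proof. by rewrite !std_pdfE sqrrN. Qed.

Lemma std_pdf_cont : continuous phi.
Proof. by apply: continuous_normal_pdf; rewrite oner_eq0. Qed.

Lemma normal_pdf_std (m s x : R) : 0 < s ->
  normal_pdf m s x = phi ((x - m) / s) / s.
Proof.
move=> s0; rewrite normal_pdfE ?gt_eqF// std_pdfE /normal_fun mulrAC; congr (_ * expR _).
  rewrite /normal_peak expr1n mul1r -invfM; congr (_^-1).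
  by rewrite -mulrnAr sqrtrM ?sqr_ge0// sqrtr_sqr gtr0_norm// mulrC.
rewrite mulNr; congr (- _); rewrite -mulr_natr; field.
by rewrite gt_eqF.
Qed.

Lemma integral_normal_std (m s : R) (g : R -> R) : 0 < s ->
  continuous g -> (forall x, 0 <= g x) ->
  (\int[mu]_x (g ((x - m) / s) * normal_pdf m s x)%:E =
   \int[mu]_y (g y * phi y)%:E)%E.
Proof.
move=> s0 cg g0; pose F (x : R) := (x - m) / s.
have dF (x : R) : is_derive x 1 F s^-1.
  by rewrite /F; apply: is_derive_eq; rewrite /GRing.scale/=; ring.
have F'E : F^`()%classic = cst s^-1.
  by apply/funext => x; rewrite derive1E; have [_ ->] := dF x.
rewrite [RHS](@increasing_ge0_integration_by_substitutionT _ F).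
- apply: eq_integral => x _; congr EFin.
  by rewrite /= F'E/= !fctE /F normal_pdf_std// mulrA.
- by move=> x y xy; rewrite /F ltr_pM2r ?invr_gt0// ltrD2r.
- by rewrite F'E => ?; exact: cvg_cst.
- by rewrite F'E; exact: is_cvg_cst.
- by rewrite F'E; exact: is_cvg_cst.
- by move=> x; have [] := dF x.
- apply/gt0_cvgMlNy; last exact: cvg_addrr_Ny.
  by rewrite invr_gt0.
- apply/gt0_cvgMly; last exact: cvg_addrr.
  by rewrite invr_gt0.
- by move=> x; apply: cvgM; [exact: cg|exact: std_pdf_cont].
- by move=> x; rewrite mulr_ge0// normal_pdf_ge0.
Qed.

(** Domination by a multiple of the normal density with standard deviation 2. The ratio of the two
    Gaussian factors is [exp (3 y^2 / 8)], and [exp (y^2 / 4) >= 1 + y^4 / 32] yields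
    [y^4 <= 32 exp (3 y^2 / 8)]; hence the 32 in [c]. *)
Lemma std_moment4_lty : (\int[mu]_y (y ^+ 4 * phi y)%:E < +oo)%E.
Proof.
pose c : R := 32 * (normal_peak 1 / normal_peak 2).
have p1 : 0 < normal_peak (1 : R) by rewrite normal_peak_gt0// oner_eq0.
have p2 : 0 < normal_peak (2 : R) by rewrite normal_peak_gt0// pnatr_eq0.
have c0 : 0 <= c by rewrite mulr_ge0// ltW// divr_gt0.
apply: (@le_lt_trans _ _ (\int[mu]_y (c * normal_pdf 0 2 y)%:E)%E).
  apply: ge0_le_integral => //.
  - by move=> y _; rewrite lee_fin mulr_ge0 ?normal_pdf_ge0// exprn_even_ge0.
  - apply/measurable_EFinP; apply: measurable_funM => //.
    exact: measurable_normal_pdf.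
  - apply/measurable_EFinP; apply: measurable_funM => //.
    exact: measurable_normal_pdf.
  - move=> y _; rewrite lee_fin std_pdfE normal_pdfE ?pnatr_eq0// /normal_fun subr0.
    have -> : c * (normal_peak 2 * expR (- y ^+ 2 / (2 ^+ 2 *+ 2))) =
      normal_peak 1 * (32 * expR (- (y ^+ 2 / 8))).
      rewrite /c -(mulr_natr (2 ^+ 2) 2).
      have -> : - y ^+ 2 / (2 ^+ 2 * 2) = - (y ^+ 2 / 8) by field.
      by field; rewrite gt_eqF.
    rewrite mulrCA ler_pM2l//.
    have -> : - (y ^+ 2 / 2) = - (y ^+ 2 / 8) + - (3 * y ^+ 2 / 8) by field.
    rewrite expRD mulrCA [leRHS]mulrC ler_wpM2l ?expR_ge0// expRN ler_pdivrMr ?expR_gt0//.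
    have h : 1 + (y ^+ 2 / 4) ^+ 2 / 2 <= expR (y ^+ 2 / 4).
      have := @expR_ge1Dxn R (y ^+ 2 / 4) 1.
      by apply; rewrite divr_ge0 ?sqr_ge0.
    have h2 : expR (y ^+ 2 / 4) <= expR (3 * y ^+ 2 / 8).
      by rewrite ler_expR; have := sqr_ge0 y; lra.
    have -> : y ^+ 4 = y ^+ 2 * y ^+ 2 by ring.
    have := sqr_ge0 y; move: h h2; set E := expR _; set E' := expR _.
    by nra.
under eq_integral do rewrite EFinM.
rewrite integralZl//; last exact: integrable_normal_pdf.
by rewrite integral_normal_pdf mule1 ltry.
Qed.

Lemma std_pdf_integrable (g : R -> R) : measurable_fun setT g ->
  (forall y, `|g y| <= 1 + y ^+ 4) ->
  mu.-integrable setT (fun y => (g y * phi y)%:E).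
Proof.
move=> mg gb.
have mp : measurable_fun setT phi by exact: measurable_normal_pdf.
have h : mu.-integrable setT (fun y => ((1 + y ^+ 4) * phi y)%:E).
  have -> : (fun y => ((1 + y ^+ 4) * phi y)%:E) =
      ((fun y => (phi y)%:E) \+ (fun y => (y ^+ 4 * phi y)%:E))%E.
    by apply/funext => y; rewrite mulrDl mul1r EFinD.
  apply: integrableD => //; first exact: integrable_normal_pdf.
  apply/integrableP; split.
    by apply/measurable_EFinP; apply: measurable_funM.
  have y4 (y : R) : `|y ^+ 4 * phi y| = y ^+ 4 * phi y.
    by rewrite ger0_norm// mulr_ge0 ?normal_pdf_ge0// exprn_even_ge0.
  under eq_integral do rewrite abse_EFin y4.
  exact: std_moment4_lty.
apply: (le_integrable measurableT _ _ h).
- by apply/measurable_EFinP; apply: measurable_funM.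
- move=> y _; rewrite !abse_EFin lee_fin !normrM ler_wpM2r//.
  by rewrite (le_trans (gb y))// ler_norm.
Qed.

Lemma std_pdf_derive (y : R) : is_derive y 1 (fun x => - (x * phi x)) ((y ^+ 2 - 1) * phi y).
Proof.
have -> : (fun x => - (x * phi x)) =
  (fun x : R => - (x * (normal_peak 1 * expR (- (x ^+ 2 / 2))))).
  by apply/funext => x; rewrite std_pdfE.
have D : is_derive y 1 (fun x : R => - (x ^+ 2 / 2)) (- y).
  by apply: is_derive_eq; rewrite /GRing.scale/=; field.
have D2 := @is_derive1_comp R (@expR R) (fun x => - (x ^+ 2 / 2)) y _ _ (is_derive_expR _) D.
apply: is_derive_eq; rewrite std_pdfE /GRing.scale/=; ring.
Qed.

Lemma cvg_mul_std_pdf : - (y * phi y) @[y --> +oo] --> (0 : R).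
Proof.
(* From [exp (y^2 / 2) >= y^2 / 2] one gets [y * phi y <= c / y]. *)
pose c : R := 2 * normal_peak 1.
have p1 : 0 < normal_peak (1 : R) by rewrite normal_peak_gt0// oner_eq0.
have inv0 : c * (y : R)^-1 @[y --> +oo] --> (0 : R).
  rewrite -[X in _ --> X](mulr0 c); apply: cvgM; first exact: cvg_cst.
  apply/(@gtr0_cvgV0 R _ _ _ id); last exact: cvg_id.
  exact: nbhs_pinfty_gt.
apply: (@squeeze_cvgr _ _ _ _ (fun y => - (c * y^-1)) (fun y => 0)).
- near=> y.
  have y0 : 0 < y by near: y; exact: nbhs_pinfty_gt.
  apply/andP; split; last by rewrite oppr_le0 mulr_ge0 ?normal_pdf_ge0 ?ltW.
  rewrite lerN2 std_pdfE.
  rewrite -ler_pdivlMl// expRN /c.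
  have := @expR_ge1Dx R (y ^+ 2 / 2); set E := expR _ => hE.
  have E0 : 0 < E by exact: expR_gt0.
  have -> : y^-1 * (2 * normal_peak 1 * y^-1) = normal_peak 1 * (2 * y ^- 2) by field; rewrite gt_eqF.
  rewrite ler_pM2l//.
  rewrite -[leRHS]invrK lef_pV2 ?posrE ?invr_gt0 ?mulr_gt0 ?invr_gt0 ?exprn_gt0//.
  by rewrite invfM invrK; have := sqr_ge0 y; lra.
- by rewrite -oppr0; exact: cvgN.
- exact: cvg_cst.
Unshelve. all: by end_near. Qed.

(* [- y * phi y] is a primitive vanishing at both ends; the half line is cut at [1],
   where the integrand changes sign, because the improper fundamental theorem is
   stated for nonnegative functions. *)
Lemma std_half_moment2 :
  (\int[mu]_(y in `[0%R, +oo[) ((y ^+ 2 - 1) * phi y)%:E = 0)%E.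
Proof.
pose f (y : R) : R := (y ^+ 2 - 1) * phi y.
pose F (y : R) : R := - (y * phi y).
have cf : continuous f.
  move=> y; apply: cvgM; last exact: std_pdf_cont.
  by apply: cvgB; [exact: exprn_continuous|exact: cvg_cst].
have mf : measurable_fun setT f by exact: continuous_measurable_fun.
have dF (y : R) : derivable F y 1 by have [] := std_pdf_derive y.
have F' (y : R) : (F^`())%classic y = f y by rewrite derive1E; have [_ ->] := std_pdf_derive y.
have cF : continuous F.
  by move=> y; apply: differentiable_continuous; apply/derivable1_diffP.
rewrite (_ : `[0%R, +oo[%classic = `[0%R, 1%R[ `|` `[1%R, +oo[); last first.
  apply/seteqP; split => y /=; rewrite !in_itv/= !andbT.
    by move=> y0; have [y1|y1] := ltP y 1; [left; rewrite y0|right].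
  by move=> [/andP[]//|]; apply: le_trans.
rewrite integral_setU//=; last 2 first.
- by apply: measurable_funTS; exact/measurable_EFinP.
- apply/disj_setPS => y [] /=; rewrite !in_itv/= andbT => /andP[_].
  by rewrite ltNge => /negbTE ->.
rewrite integral_itv_bndo_bndc; last first.
  by apply: measurable_funTS; exact/measurable_EFinP.
rewrite (@continuous_FTC2 _ f F)//; last 2 first.
- exact: continuous_subspaceT.
- split => //.
  + exact/cvg_at_right_filter/cF.
  + exact/cvg_at_left_filter/cF.
rewrite (@ge0_continuous_FTC2y _ f F 1 0)//.
- by rewrite {2}/F mul0r oppr0 sube0 sub0e subee.
- move=> y y1; rewrite mulr_ge0 ?normal_pdf_ge0// subr_ge0.
  by rewrite exprn_ege1.
- exact: continuous_subspaceT.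
- exact: cvg_mul_std_pdf.
- exact/cvg_at_right_filter/cF.
Qed.

(** By symmetry this integral and the total mass 1 are both twice an integral over the half line,
    and those two differ by [std_half_moment2], which is 0. *)
Lemma std_moment2 : (\int[mu]_y (y ^+ 2 * phi y)%:E = 1)%E.
Proof.
have c2 : continuous (fun y : R => y ^+ 2 * phi y).
  by move=> y; apply: cvgM; [exact: exprn_continuous|exact: std_pdf_cont].
rewrite ge0_symfun_integralT//; last 2 first.
- by move=> y; rewrite mulr_ge0 ?sqr_ge0// normal_pdf_ge0.
- by move=> y /=; rewrite sqrrN std_pdf_symm.
rewrite -(@integral_normal_pdf R 0 1) ge0_symfun_integralT//; last 3 first.
- by move=> y; rewrite normal_pdf_ge0.
- exact: std_pdf_cont.
- by move=> y /=; rewrite std_pdf_symm.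
congr (_ * _)%E; rewrite -set_itvcy.
have mi : measurable (`[0%R, +oo[%classic : set R) by [].
have i1 : mu.-integrable `[0%R, +oo[ (fun y => (phi y)%:E).
  by apply: (integrableS measurableT) => //; exact: integrable_normal_pdf.
have i2 : mu.-integrable `[0%R, +oo[ (fun y => ((y ^+ 2 - 1) * phi y)%:E).
  apply: (integrableS measurableT) => //; apply: std_pdf_integrable => [|y].
    by apply: measurable_funB => //; exact: exprn_measurable.
  rewrite ler_norml; have := sqr_ge0 (y ^+ 2 - 1); have := sqr_ge0 (y ^+ 2).
  have -> : y ^+ 4 = y ^+ 2 * y ^+ 2 by ring.
  have := sqr_ge0 y.
  by move=> *; apply/andP; split; nra.
transitivity (\int[mu]_(y in `[0%R, +oo[) ((phi y)%:E + ((y ^+ 2 - 1) * phi y)%:E))%E.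
  by apply: eq_integral => y _; rewrite -EFinD; congr EFin; ring.
by rewrite integralD// std_half_moment2 adde0.
Qed.

End standard_normal.

Definition gauss_moment4 (R : realType) : R :=
  fine (\int[@lebesgue_measure R]_y (y ^+ 4 * normal_pdf 0 1 y)%:E)%E.

Section sample_moments.
Context {R : realType} {d : measure_display} {T : measurableType d}.
Variables (P : probability T R) (n : nat) (Y : 'I_n -> {RV P >-> R}).
Variables (mu : 'cV[R]_n) (sigma : R).
Hypothesis sY : normal_sample Y mu sigma.
Hypothesis sigma0 : 0 < sigma.
Notation leb := (@lebesgue_measure R).
Local Notation phi := (normal_pdf (0 : R) 1).

Definition std_resid (j : 'I_n) (w : T) : R := (Y j w - mu j 0) / sigma.
Local Notation U := std_resid.

Let mY j : measurable_fun setT (Y j).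
Proof. exact: measurable_funPT. Qed.

Lemma measurable_std_resid j : measurable_fun setT (U j).
Proof.
apply: measurable_funM; last exact: measurable_cst.
by apply: measurable_funB; [exact: mY|exact: measurable_cst].
Qed.

(** [normal_sample] describes the law of [Y j] on sets. [eq_integral_weight], with weight 1 under
    [P] and the density under Lebesgue measure, carries it over to functions; an affine substitution
    then standardises. *)
Lemma integral_std_resid j (g : R -> R) : continuous g -> (forall x, 0 <= g x) ->
  (\int[P]_w (g (U j w))%:E = \int[leb]_y (g y * phi y)%:E)%E.
Proof.
move=> cg g0; rewrite -(integral_normal_std (mu j 0) sigma0)//.
transitivity (\int[P]_w (g ((Y j w - mu j 0) / sigma) * 1)%:E)%E.
  by under [RHS]eq_integral do rewrite mulr1.
pose h x := g ((x - mu j 0) / sigma).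
have mg : measurable_fun setT g by exact: continuous_measurable_fun.
have mh : measurable_fun setT h.
  apply: (measurableT_comp mg); apply: measurable_funM => //.
  exact: measurable_funB.
rewrite -/(h _) (_ : (fun w => _) = (fun w => (h (Y j w) * cst 1 w)%:E))//.
rewrite (eq_integral_weight (P2 := leb) (X1 := Y j) (X2 := id) (G2 := normal_pdf (mu j 0) sigma))//.
- exact: measurable_normal_pdf.
- by move=> x; exact: normal_pdf_ge0.
- move=> A mA.
  transitivity (P (Y j @^-1` A)).
    rewrite -[in RHS](setIT (Y j @^-1` A)) -integral_indic//.
      by apply: eq_integral => w _; rewrite mulr1.
    by rewrite -[_ @^-1` _]setTI; exact: mY.
  have [_ h'] := sY; rewrite [LHS](h' j A mA).
  rewrite /normal_prob [LHS]integral_mkcond; apply: eq_integral => x _.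
  by rewrite patchE indicE; case: ifPn => _; rewrite ?mul1r ?mul0r.
- by move=> x; exact: g0.
Qed.

Lemma std_resid_integrable j c : (c <= 4)%N ->
  P.-integrable setT (fun w => (U j w ^+ c)%:E).
Proof.
move=> c4.
have mU := measurable_std_resid j.
apply/integrableP; split.
  by apply/measurable_EFinP; exact: measurable_funX.
have cg : continuous (fun x : R => `|x ^+ c|).
  move=> x; apply: cvg_norm; exact: exprn_continuous.
under eq_integral do rewrite abse_EFin.
rewrite (integral_std_resid j cg)//.
have /integrableP[_] : leb.-integrable setT (fun y => (y ^+ c * phi y)%:E).
  apply: std_pdf_integrable => [|y]; first exact: exprn_measurable.
  rewrite normrX -[y ^+ 4]ger0_norm ?exprn_even_ge0// normrX.
  have [y1|/ltW y1] := leP `|y| 1.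
    apply: (@le_trans _ _ 1); first exact: exprn_ile1.
    by rewrite lerDl exprn_ge0.
  by rewrite (le_trans (ler_weXn2l y1 c4))// lerDr.
apply: le_lt_trans; rewrite le_eqVlt; apply/orP; left; apply/eqP.
by apply: eq_integral => y _; rewrite abse_EFin normrM [`|phi y|]ger0_norm// normal_pdf_ge0.
Qed.

(** [integral_std_resid] handles nonnegative functions, so the residual is split into its positive
    and negative parts [gp] and [gn]. The integral of [|y|] is the sum of theirs, and by evenness
    also twice that of [gp]; hence the two parts have the same mean. *)
Lemma std_resid_moment1 j : (\int[P]_w (U j w)%:E = 0)%E.
Proof.
have Ui := @std_resid_integrable j 1 isT.
pose gp (x : R) := (`|x| + x) / 2; pose gn (x : R) := (`|x| - x) / 2.
have cgp : continuous gp.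
  move=> x; apply: cvgM; last exact: cvg_cst.
  by apply: cvgD; [exact: cvg_norm|exact: cvg_id].
have cgn : continuous gn.
  move=> x; apply: cvgM; last exact: cvg_cst.
  by apply: cvgB; [exact: cvg_norm|exact: cvg_id].
have gp0 x : 0 <= gp x by rewrite /gp; have := ler_norm (- x); rewrite normrN; lra.
have gn0 x : 0 <= gn x by rewrite /gn; have := ler_norm x; lra.
have mp : measurable_fun setT phi by exact: measurable_normal_pdf.
have mgp : measurable_fun setT gp by exact: continuous_measurable_fun.
have mgn : measurable_fun setT gn by exact: continuous_measurable_fun.
have gpn x : gp x + gn x = `|x| by rewrite /gp /gn; lra.
have gpBn x : x = gp x - gn x by rewrite /gp /gn; lra.
have abs_le (g : R -> R) : (forall x, `|g x| <= `|x|) -> forall x, `|g x| <= 1 + x ^+ 4.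
  move=> gx x; apply: (le_trans (gx x)).
  have : x ^+ 4 = `|x| ^+ 2 * `|x| ^+ 2 by rewrite !real_normK ?num_real// -exprD.
  by move=> ->; have := normr_ge0 x; move: `|x| => t t0; have := sqr_ge0 (t ^+ 2 - 1 / 2); have := sqr_ge0 (t - 1 / 2); nra.
have gp_le x : `|gp x| <= `|x| by rewrite -gpn ger0_norm// lerDl.
have gn_le x : `|gn x| <= `|x| by rewrite -gpn ger0_norm// lerDr.
have ip := std_pdf_integrable mgp (abs_le _ gp_le).
have in_ := std_pdf_integrable mgn (abs_le _ gn_le).
have Iabs : (\int[leb]_y (`|y| * phi y)%:E =
    \int[leb]_y (gp y * phi y)%:E + \int[leb]_y (gn y * phi y)%:E)%E.
  rewrite -integralD//; apply: eq_integral => y _.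
  by rewrite -EFinD -mulrDl gpn.
have Iabs2 : (\int[leb]_y (`|y| * phi y)%:E = 2 * \int[leb]_y (gp y * phi y)%:E)%E.
  rewrite ge0_symfun_integralT.
  - congr (_ * _)%E; rewrite integral_mkcond; apply: eq_integral => y _.
    rewrite patchE; case: ifPn => [/set_mem/= y0|/negP y0].
      by rewrite /gp ger0_norm//; congr (_ * _)%:E; lra.
    rewrite /gp ltr0_norm ?addNr ?mul0r// ltNge; apply/negP => y1; apply: y0.
    by rewrite inE.
  - by move=> y; rewrite mulr_ge0// normal_pdf_ge0.
  - by move=> y; apply: cvgM; [exact: cvg_norm|exact: std_pdf_cont].
  - by move=> y /=; rewrite normrN std_pdf_symm.
have fp := integrable_fin_num measurableT ip.
have fn := integrable_fin_num measurableT in_.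
have Epn : (\int[leb]_y (gp y * phi y)%:E = \int[leb]_y (gn y * phi y)%:E)%E.
  move: Iabs; rewrite Iabs2 -(fineK fp) -(fineK fn) -EFinM -EFinD => -[h].
  by congr EFin; lra.
have Ui' (g : R -> R) : continuous g -> (forall x, 0 <= g x) ->
    leb.-integrable setT (fun y => (g y * phi y)%:E) ->
    P.-integrable setT (fun w => (g (U j w))%:E).
  move=> cg g0 gi; apply/integrableP; split.
    apply/measurable_EFinP; apply: measurableT_comp; last exact: measurable_std_resid.
    exact: continuous_measurable_fun.
  have gE w : `|g (U j w)| = g (U j w) by rewrite ger0_norm.
  under eq_integral do rewrite abse_EFin gE.
  rewrite integral_std_resid//.
  by have := integrable_fin_num measurableT gi; rewrite ge0_fin_numE// integral_ge0// => y _; rewrite lee_fin mulr_ge0// normal_pdf_ge0.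
transitivity (\int[P]_w ((gp (U j w))%:E - (gn (U j w))%:E))%E.
  by apply: eq_integral => w _; rewrite -EFinB -gpBn.
rewrite integralB_EFin//; [|exact: Ui'|exact: Ui'].
by rewrite !integral_std_resid// Epn subee.
Qed.

Lemma std_resid_moment2 j : (\int[P]_w (U j w ^+ 2)%:E = 1)%E.
Proof.
rewrite (@integral_std_resid j (fun x => x ^+ 2)) ?std_moment2//.
  exact: exprn_continuous.
by move=> x; exact: sqr_ge0.
Qed.

Lemma std_resid_moment4 j : (\int[P]_w (U j w ^+ 4)%:E = (gauss_moment4 R)%:E)%E.
Proof.
rewrite (@integral_std_resid j (fun x => x ^+ 4)); last 2 first.
- exact: exprn_continuous.
- by move=> x; exact: exprn_even_ge0.
rewrite /gauss_moment4 fineK// ge0_fin_numE ?std_moment4_lty//.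
by apply: integral_ge0 => y _; rewrite lee_fin mulr_ge0 ?normal_pdf_ge0// exprn_even_ge0.
Qed.

Lemma std_resid_monomial (e : 'I_n -> nat) (m : 'I_n -> R) :
  (forall q, (e q <= 4)%N) ->
  (forall q, \int[P]_w (U q w ^+ e q)%:E = (m q)%:E)%E ->
  P.-integrable setT (fun w => (\prod_(q < n) U q w ^+ e q)%:E) /\
  (\int[P]_w (\prod_(q < n) U q w ^+ e q)%:E = (\prod_(q < n) m q)%:E)%E.
Proof.
move=> e4 mE; pose f q x := ((x - mu q 0) / sigma) ^+ e q.
have mf q : measurable_fun setT (f q).
  by apply: measurable_funX; apply: measurable_funM => //; exact: measurable_funB.
have fi q : P.-integrable setT (fun w => (f q (Y q w))%:E).
  exact: std_resid_integrable.
split; first exact: (indep_prod_integrable sY.1 mf fi).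
exact: (indep_prod_integral sY.1 mf fi).
Qed.

End sample_moments.

Lemma gauss_moment4_ge0 (R : realType) : 0 <= gauss_moment4 R.
Proof.
apply: fine_ge0; apply: integral_ge0 => y _.
by rewrite lee_fin mulr_ge0 ?normal_pdf_ge0// exprn_even_ge0.
Qed.

(** * Second moments of linear and quadratic forms in the standardised sample *)

Section quadratic_forms.
Context {R : realType} {d : measure_display} {T : measurableType d}.
Variables (P : probability T R) (n : nat) (Y : 'I_n -> {RV P >-> R}).
Variables (mu : 'cV[R]_n) (sigma : R).
Hypothesis sY : normal_sample Y mu sigma.
Hypothesis sigma0 : 0 < sigma.
Local Notation U := (std_resid Y mu sigma).
Local Notation kappa := (gauss_moment4 R).

Let mom (q : 'I_n) (k : nat) : R := fine (\int[P]_w (U q w ^+ k)%:E)%E.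

Let momE q k : (k <= 4)%N -> (\int[P]_w (U q w ^+ k)%:E = (mom q k)%:E)%E.
Proof.
move=> k4; rewrite fineK//.
exact: (integrable_fin_num measurableT (std_resid_integrable sY sigma0 q k4)).
Qed.

Let mom0 q : mom q 0 = 1.
Proof.
rewrite /mom; under eq_integral do rewrite expr0.
by rewrite integral_cst//= probability_setT mule1.
Qed.
Let mom1 q : mom q 1 = 0.
Proof. by rewrite /mom (std_resid_moment1 sY sigma0 q). Qed.
Let mom2 q : mom q 2 = 1.
Proof. by rewrite /mom (std_resid_moment2 sY sigma0 q). Qed.
Let mom4 q : mom q 4 = kappa.
Proof. by rewrite /mom (std_resid_moment4 sY sigma0 q). Qed.

Let prod_mom0 (e : 'I_n -> nat) q : e q = 1%N -> \prod_(q < n) mom q (e q) = 0.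
Proof. by move=> e1; rewrite (bigD1 q)//= e1 mom1 mul0r. Qed.

Let prod_mom22 (e : 'I_n -> nat) x y : x != y ->
  (forall q, e q = 2 * (q == x) + 2 * (q == y))%N ->
  \prod_(q < n) mom q (e q) = 1.
Proof.
move=> xy eE; rewrite (bigD1 x)//= (bigD1 y) 1?eq_sym//= big1 => [|q /andP[qx qy]].
  by rewrite !eE !eqxx (negbTE xy) eq_sym (negbTE xy) !mom2 !mulr1.
by rewrite eE (negbTE qx) (negbTE qy) mom0.
Qed.

Let prod_mom4 (e : 'I_n -> nat) x :
  (forall q, e q = 4 * (q == x))%N -> \prod_(q < n) mom q (e q) = kappa.
Proof.
move=> eE; rewrite (bigD1 x)//= big1 => [|q qx].
  by rewrite eE eqxx mom4 mulr1.
by rewrite eE (negbTE qx) mom0.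
Qed.

(* Isserlis' formula, with the fourth moment left as [kappa]: its value [3] is not
   needed. *)
Lemma std_resid_prod4 (a b c e : 'I_n) :
  P.-integrable setT (fun w => (U a w * U b w * U c w * U e w)%:E) /\
  (\int[P]_w (U a w * U b w * U c w * U e w)%:E =
   (((a == b) && (c == e))%:R + ((a == c) && (b == e))%:R +
    ((a == e) && (b == c))%:R + (kappa - 3) * [&& a == b, a == c & a == e]%:R)%:E)%E.
Proof.
(* [k q] counts the occurrences of [q] among the four indices, which turns the product into a
   monomial whose mean factors over [q]. An index occurring exactly once makes that mean 0; the
   remaining cases are two distinct pairs and a single index repeated four times. *)
pose k (q : 'I_n) := ((q == a) + (q == b) + (q == c) + (q == e))%N.
have k4 q : (k q <= 4)%N by rewrite /k; do 4 case: eqP.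
have UE w : \prod_(q < n) U q w ^+ k q = U a w * U b w * U c w * U e w.
  have U1 x : \prod_(q < n) U q w ^+ (q == x) = U x w.
    rewrite (bigD1 x)//= eqxx expr1 big1 ?mulr1// => q /negbTE ->.
    by rewrite expr0.
  by under eq_bigr do rewrite /k !exprD; rewrite !big_split/= !U1.
have [ki kE] := std_resid_monomial sY sigma0 k4 (fun q => momE q (k4 q)).
rewrite (_ : (fun w => (U a w * _ * _ * _)%:E) = (fun w => (\prod_(q < n) U q w ^+ k q)%:E)); last first.
  by apply/funext => w; rewrite UE.
split => //; rewrite kE; congr EFin.
have kx x : k x = ((x == a) + (x == b) + (x == c) + (x == e))%N by [].
case: (eqVneq a b) => [ab|ab].
  subst b; case: (eqVneq c e) => [ce|ce].
    subst e; case: (eqVneq a c) => [ac|ac] /=.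
      subst c; rewrite (@prod_mom4 _ a); last by move=> q; rewrite kx; case: eqP.
      by lra.
    rewrite (@prod_mom22 _ a c)//; last by move=> q; rewrite kx; do 2 case: eqP.
    by rewrite !mulr0 !addr0.
  case: (eqVneq a c) => [ac|ac] /=.
    subst c; rewrite (@prod_mom0 _ e); first by rewrite (negbTE ce) !mulr0 !addr0.
    by rewrite kx eqxx eq_sym (negbTE ce).
  rewrite (@prod_mom0 _ c); first by rewrite andbF !mulr0 !addr0.
  by rewrite kx eqxx (negbTE ce) eq_sym (negbTE ac).
case: (eqVneq a c) => [ac|ac] /=.
  subst c; case: (eqVneq b e) => [be|be].
    subst e; rewrite (@prod_mom22 _ a b)//.
      by rewrite (negbTE ab) /=; lra.
    by move=> q; rewrite kx; do 2 case: eqP.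
  rewrite (@prod_mom0 _ b).
    by rewrite [b == a]eq_sym (negbTE ab) andbF /=; lra.
  by rewrite kx eqxx (negbTE be) eq_sym (negbTE ab).
case: (eqVneq a e) => [ae|ae] /=.
  subst e; case: (eqVneq b c) => [bc|bc].
    subst c; rewrite (@prod_mom22 _ a b)//; first by rewrite ?eqxx ?(negbTE ab) /=; lra.
    by move=> q; rewrite kx; do 2 case: eqP.
  rewrite (@prod_mom0 _ b); first by rewrite ?eqxx ?andbF ?(negbTE ab) /=; lra.
  by rewrite kx eqxx (negbTE bc) eq_sym (negbTE ab).
rewrite (@prod_mom0 _ a); first by rewrite ?eqxx ?andbF ?(negbTE ab) /=; lra.
by rewrite kx eqxx (negbTE ab) (negbTE ac) (negbTE ae).
Qed.

Lemma std_resid_prod2 (a b : 'I_n) :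
  P.-integrable setT (fun w => (U a w * U b w)%:E) /\
  (\int[P]_w (U a w * U b w)%:E = ((a == b)%:R : R)%:E)%E.
Proof.
pose k (q : 'I_n) := ((q == a) + (q == b))%N.
have k4 q : (k q <= 4)%N by rewrite /k; do 2 case: eqP.
have UE w : \prod_(q < n) U q w ^+ k q = U a w * U b w.
  have U1 x : \prod_(q < n) U q w ^+ (q == x) = U x w.
    rewrite (bigD1 x)//= eqxx expr1 big1 ?mulr1// => q /negbTE ->.
    by rewrite expr0.
  by under eq_bigr do rewrite /k !exprD; rewrite !big_split/= !U1.
have [ki kE] := std_resid_monomial sY sigma0 k4 (fun q => momE q (k4 q)).
rewrite (_ : (fun w => (U a w * _)%:E) = (fun w => (\prod_(q < n) U q w ^+ k q)%:E)); last first.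
  by apply/funext => w; rewrite UE.
split => //; rewrite kE; congr EFin.
have kx x : k x = ((x == a) + (x == b))%N by [].
case: (eqVneq a b) => [ab|ab].
  subst b; rewrite (bigD1 a)//= big1 => [|q qa].
    by rewrite kx eqxx mom2 mulr1.
  by rewrite kx (negbTE qa) mom0.
by rewrite (@prod_mom0 _ a)// kx eqxx (negbTE ab).
Qed.

Lemma sqr_linear_form (b : 'I_n -> R) :
  P.-integrable setT (fun w => ((\sum_j b j * U j w) ^+ 2)%:E) /\
  (\int[P]_w ((\sum_j b j * U j w) ^+ 2)%:E = (\sum_j b j ^+ 2)%:E)%E.
Proof.
have sqE w : (((\sum_j b j * U j w) ^+ 2)%:E = \sum_(t : 'I_n * 'I_n)
    (b t.1 * b t.2)%:E * (U t.1 w * U t.2 w)%:E)%E.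
  rewrite expr2 big_distrlr/= pair_bigA/= -sumEFin; apply: eq_bigr => t _.
  by rewrite -EFinM; congr EFin; ring.
have ti (t : 'I_n * 'I_n) : P.-integrable setT
    (fun w => (b t.1 * b t.2)%:E * (U t.1 w * U t.2 w)%:E)%E.
  by apply: integrableZl => //; exact: (std_resid_prod2 _ _).1.
rewrite (_ : (fun w => _) = (fun w => \sum_(t : 'I_n * 'I_n)
    (b t.1 * b t.2)%:E * (U t.1 w * U t.2 w)%:E)%E); last by apply/funext.
split; first exact: integrable_sum.
rewrite integral_sum// -sumEFin.
rewrite (eq_bigr (fun t : 'I_n * 'I_n => (b t.1 * b t.2 * (t.1 == t.2)%:R)%:E)); last first.
  move=> t _; rewrite integralZl//; last exact: (std_resid_prod2 _ _).1.
  by rewrite (std_resid_prod2 _ _).2.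
rewrite !sumEFin -(pair_bigA _ (fun i j => b i * b j * (i == j)%:R))/=; congr EFin.
apply: eq_bigr => i _; rewrite (bigD1 i)//= eqxx mulr1 big1 ?addr0// => j ji.
by rewrite eq_sym (negbTE ji) mulr0.
Qed.

Lemma sqr_quadratic_form (A : 'M[R]_n) : A^T = A ->
  let Q w := \sum_i \sum_j A i j * (U i w * U j w) - \tr A in
  P.-integrable setT (fun w => (Q w ^+ 2)%:E) /\
  (\int[P]_w (Q w ^+ 2)%:E <= ((2 + kappa) * \sum_i \sum_j A i j ^+ 2)%:E)%E.
Proof.
move=> AT Q.
pose V (t : 'I_n * 'I_n) w := U t.1 w * U t.2 w - (t.1 == t.2)%:R.
pose B (t : 'I_n * 'I_n) := A t.1 t.2.
have QE w : Q w = \sum_t B t * V t w.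
  rewrite /Q /B /V -(pair_bigA _ (fun i j => A i j * (U i w * U j w - (i == j)%:R)))/=.
  rewrite /mxtrace -sumrB; apply: eq_bigr => i _.
  have -> : A i i = \sum_j A i j * (i == j)%:R.
    rewrite (bigD1 i)//= eqxx mulr1 big1 ?addr0// => j ji.
    by rewrite eq_sym (negbTE ji) mulr0.
  by rewrite -sumrB; apply: eq_bigr => j _; rewrite mulrBr.
have QE2 w : ((Q w ^+ 2)%:E = \sum_(t : ('I_n * 'I_n) * ('I_n * 'I_n))
    (B t.1 * B t.2)%:E * (V t.1 w * V t.2 w)%:E)%E.
  rewrite QE expr2 big_distrlr/= pair_bigA/= -sumEFin; apply: eq_bigr => t _.
  by rewrite -EFinM; congr EFin; ring.
(* The covariance of the products indexed by [s] and [t]: centring removes from [std_resid_prod4]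
   the pairing inside [s] and inside [t]. *)
pose v (s t : 'I_n * 'I_n) : R := ((s.1 == t.1) && (s.2 == t.2))%:R +
    ((s.1 == t.2) && (s.2 == t.1))%:R + (kappa - 3) * [&& s.1 == s.2, s.1 == t.1 & s.1 == t.2]%:R.
have Vi s t : P.-integrable setT (fun w => (V s w * V t w)%:E) /\
    (\int[P]_w (V s w * V t w)%:E = (v s t)%:E)%E.
  case: s => a b; case: t => c e.
  have [i4 E4] := std_resid_prod4 a b c e.
  have [iab Eab] := std_resid_prod2 a b.
  have [ice Ece] := std_resid_prod2 c e.
  pose p : R := (a == b)%:R; pose q : R := (c == e)%:R.
  have VE w : ((V (a, b) w * V (c, e) w)%:E = (U a w * U b w * U c w * U e w)%:E +
      ((- p)%:E * (U c w * U e w)%:E + ((- q)%:E * (U a w * U b w)%:E + (p * q)%:E)))%E.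
    by rewrite /V/= -/p -/q -!EFinM -!EFinD; congr EFin; ring.
  have i1 := integrableZl measurableT (- p) ice.
  have i2 := integrableZl measurableT (- q) iab.
  have i3 : P.-integrable setT (fun w => (p * q)%:E).
    by apply: finite_measure_integrable_cst.
  have i23 := integrableD measurableT i2 i3.
  have i123 := integrableD measurableT i1 i23.
  rewrite (_ : (fun w => _) = (fun w => (U a w * U b w * U c w * U e w)%:E +
      ((- p)%:E * (U c w * U e w)%:E + ((- q)%:E * (U a w * U b w)%:E + (p * q)%:E)))%E);
    last by apply/funext.
  split; first exact: (integrableD measurableT i4 i123).
  rewrite (integralD measurableT i4 i123) (integralD measurableT i1 i23) (integralD measurableT i2 i3).
  rewrite !integralZl// E4 Eab Ece integral_cst//= probability_setT mule1.
  rewrite -!EFinM -!EFinD; congr EFin; rewrite /v/= -/p -/q.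
  have -> : (((a == b) && (c == e))%:R : R) = p * q by rewrite -natrM mulnb.
  by ring.
have ti (t : ('I_n * 'I_n) * ('I_n * 'I_n)) : P.-integrable setT
    (fun w => (B t.1 * B t.2)%:E * (V t.1 w * V t.2 w)%:E)%E.
  by apply: integrableZl => //; exact: (Vi _ _).1.
rewrite (_ : (fun w => _) = (fun w => \sum_(t : ('I_n * 'I_n) * ('I_n * 'I_n))
    (B t.1 * B t.2)%:E * (V t.1 w * V t.2 w)%:E)%E); last by apply/funext.
split; first exact: integrable_sum.
rewrite integral_sum//.
rewrite (eq_bigr (fun t : ('I_n * 'I_n) * ('I_n * 'I_n) => (B t.1 * B t.2 * v t.1 t.2)%:E)); last first.
  move=> t _; rewrite integralZl//; last exact: (Vi _ _).1.
  by rewrite (Vi _ _).2.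
rewrite sumEFin lee_fin -(pair_bigA _ (fun s t => B s * B t * v s t))/=.
have Asym i j : A i j = A j i by rewrite -[in LHS]AT mxE.
have -> : \sum_i \sum_j A i j ^+ 2 = \sum_s B s ^+ 2.
  by rewrite -(pair_bigA _ (fun i j => A i j ^+ 2)).
rewrite mulr_sumr; apply: ler_sum => -[a b] _.
have sE : \sum_t B (a, b) * B t * v (a, b) t =
    B (a, b) ^+ 2 * (2 + (kappa - 3) * (a == b)%:R).
  pose f1 (t : 'I_n * 'I_n) := B (a, b) * B t * ((a == t.1) && (b == t.2))%:R.
  pose f2 (t : 'I_n * 'I_n) := B (a, b) * B t * ((a == t.2) && (b == t.1))%:R.
  pose f3 (t : 'I_n * 'I_n) := B (a, b) * B t * ((kappa - 3) * [&& a == b, a == t.1 & a == t.2]%:R).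
  transitivity (\sum_t f1 t + \sum_t f2 t + \sum_t f3 t).
    by rewrite -!big_split/=; apply: eq_bigr => t _; rewrite /f1 /f2 /f3 /v/=; ring.
  have -> : \sum_t f1 t = B (a, b) ^+ 2.
    rewrite (bigD1 (a, b))//= big1 => [|[c e]].
      by rewrite /f1/= !eqxx/=; ring.
    rewrite xpair_eqE /f1/= [a == c]eq_sym [b == e]eq_sym => /negbTE ->.
    by rewrite mulr0.
  have -> : \sum_t f2 t = B (a, b) ^+ 2.
    rewrite (bigD1 (b, a))//= big1 => [|[c e]].
      by rewrite /f2/= !eqxx/= /B/= (Asym b a); ring.
    rewrite xpair_eqE /f2/= [a == e]eq_sym [b == c]eq_sym andbC => /negbTE ->.
    by rewrite mulr0.
  have -> : \sum_t f3 t = B (a, b) ^+ 2 * ((kappa - 3) * (a == b)%:R).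
    rewrite (bigD1 (a, a))//= big1 => [|[c e]].
      by rewrite /f3/= !eqxx !andbT /B/=; case: eqP => [->|_] /=; ring.
    rewrite xpair_eqE /f3/= [a == c]eq_sym [a == e]eq_sym => /negbTE ->.
    by rewrite andbF !mulr0.
  by ring.
rewrite sE mulrC ler_wpM2r ?sqr_ge0//.
have := gauss_moment4_ge0 R; case: eqP => _ /=; lra.
Qed.

End quadratic_forms.

(** * Concentration of quadratic forms of the sample *)

Lemma measurable_fun_sumr (R : realType) (d : measure_display)
    (T : measurableType d) (I : Type) (s : seq I) (f : I -> T -> R) :
  (forall j, measurable_fun setT (f j)) ->
  measurable_fun setT (fun w => \sum_(j <- s) f j w).
Proof.
move=> mf; elim: s => [|j s IH].
  by under eq_fun do rewrite big_nil; exact: measurable_cst.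
by under eq_fun do rewrite big_cons; exact: measurable_funD.
Qed.

Section concentration.
Context {R : realType} {d : measure_display} {T : measurableType d}.
Variables (P : probability T R) (n : nat) (Y : 'I_n -> {RV P >-> R}).

Lemma measurable_qform (A : 'M[R]_n) :
  measurable_fun setT (fun w => qform A (sample_vector Y w)).
Proof.
under eq_fun do rewrite qformE.
apply: measurable_fun_sumr => i; apply: measurable_fun_sumr => j.
apply: measurable_funM => //; under eq_fun do rewrite !mxE.
by apply: measurable_funM; exact: measurable_funPT.
Qed.

Variables (mu : 'cV[R]_n) (sigma : R).
Hypothesis sY : normal_sample Y mu sigma.
Hypothesis sigma0 : 0 < sigma.
Local Notation U := (std_resid Y mu sigma).
Local Notation kappa := (gauss_moment4 R).

(** Expansion of [y = mu + sigma U]; symmetry of [A] merges the two cross terms. *)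
Lemma qform_sample (A : 'M[R]_n) w : A^T = A ->
  qform A (sample_vector Y w) / sigma ^+ 2 =
  \sum_i \sum_j A i j * (U i w * U j w) +
  2 * (\sum_j ((A *m mu) j 0 / sigma) * U j w) + qform A mu / sigma ^+ 2.
Proof.
move=> AT; have s0 : sigma != 0 by rewrite gt_eqF.
have yE i : sample_vector Y w i 0 = mu i 0 + sigma * U i w.
  by rewrite mxE /std_resid; field.
have Asym i j : A i j = A j i by rewrite -[in LHS]AT mxE.
rewrite !qformE.
have -> : \sum_j (A *m mu) j 0 / sigma * U j w =
    \sum_i \sum_j A i j * (U i w * mu j 0) / sigma.
  by apply: eq_bigr => i _; rewrite mxE !mulr_suml; apply: eq_bigr => j _; ring.
have E2 : \sum_i \sum_j A i j * (U i w * mu j 0) / sigma = \sum_i \sum_j A i j * (mu i 0 * U j w) / sigma.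
  rewrite exchange_big/=; apply: eq_bigr => i _; apply: eq_bigr => j _.
  by rewrite Asym; ring.
rewrite mulr2n mulrDl mul1r {2}E2 !mulr_suml -!big_split/=; apply: eq_bigr => i _.
rewrite !mulr_suml -!big_split/=; apply: eq_bigr => j _.
by rewrite !yE; field.
Qed.

Lemma measurable_qform_event (A : 'M[R]_n) (t c1 c2 : R) :
  measurable [set w | t <= `|qform A (sample_vector Y w) / sigma ^+ 2 - c1 - c2| ].
Proof.
set Z := fun w => qform A (sample_vector Y w) / sigma ^+ 2 - c1 - c2.
have mZ : measurable_fun setT Z.
  apply: measurable_funB; last exact: measurable_cst.
  apply: measurable_funB; last exact: measurable_cst.
  by apply: measurable_funM => //; exact: measurable_qform.
rewrite -[X in measurable X]setTI.
have mnZ : measurable_fun setT (fun w => `|Z w|) by exact: measurableT_comp.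
have -> : [set w | t <= `|qform A (sample_vector Y w) / sigma ^+ 2 - c1 - c2| ] = (fun w => `|Z w|) @^-1` `[t, +oo[%classic.
  by apply/seteqP; split => w /=; rewrite in_itv/= andbT.
exact: mnZ.
Qed.

(** The centred form is [Q + 2 L], with [Q] quadratic and [L] linear in the residuals. From
    [(Q + 2 L)^2 <= 2 Q^2 + 8 L^2] no mixed third moment enters. For a projection, [Q^2] has mean at
    most [(2 + kappa) tr A], and the mean of [L^2] is the squared norm of [A mu / sigma], the
    noncentrality itself. *)
Lemma quad_form_concentration (A : 'M[R]_n) (t : R) :
  A^T = A -> A *m A = A -> 0 < t ->
  (P [set w | t <= `|qform A (sample_vector Y w) / sigma ^+ 2 - \tr A
                     - qform A mu / sigma ^+ 2| ]%R
   <= (((4 + 2 * kappa) * \tr A + 8 * (qform A mu / sigma ^+ 2)) / t ^+ 2)%:E)%E.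
Proof.
move=> AT AA t0.
pose Z w := qform A (sample_vector Y w) / sigma ^+ 2 - \tr A - qform A mu / sigma ^+ 2.
pose b j := (A *m mu) j 0 / sigma.
have [iQ EQ] := sqr_quadratic_form sY sigma0 AT.
have [iL EL] := sqr_linear_form sY sigma0 b.
set Q := fun w => \sum_i \sum_j A i j * (U i w * U j w) - \tr A in iQ EQ.
set L := fun w => \sum_j b j * U j w in iL EL.
have ZE w : Z w = Q w + 2 * L w.
  by rewrite /Z qform_sample// /Q /L; ring.
have mE : measurable [set w | t <= `|Z w|] := measurable_qform_event A t _ _.
have i2 := integrableZl measurableT (2 / t ^+ 2) iQ.
have i8 := integrableZl measurableT (8 / t ^+ 2) iL.
rewrite -/(Z _) -[X in (P X <= _)%E]setIT -integral_indic//.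
apply: (@le_trans _ _ (\int[P]_w ((2 / t ^+ 2)%:E * (Q w ^+ 2)%:E +
                                 (8 / t ^+ 2)%:E * (L w ^+ 2)%:E))%E).
  apply: ge0_le_integral => //.
  - by apply/measurable_EFinP.
  - exact: (measurable_int _ (integrableD measurableT i2 i8)).
  - move=> w _; rewrite -!EFinM -EFinD lee_fin indicE.
    have h : 0 <= 2 / t ^+ 2 * Q w ^+ 2 + 8 / t ^+ 2 * L w ^+ 2.
      by rewrite addr_ge0// mulr_ge0 ?sqr_ge0// divr_ge0 ?sqr_ge0.
    have [/set_mem/= tZ|_] := boolP (w \in _); last exact: h.
    have -> : 2 / t ^+ 2 * Q w ^+ 2 + 8 / t ^+ 2 * L w ^+ 2 = (2 * Q w ^+ 2 + 8 * L w ^+ 2) / t ^+ 2.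
      by ring.
    rewrite ler_pdivlMr ?exprn_gt0// mul1r.
    apply: (@le_trans _ _ (`|Z w| ^+ 2)).
      by rewrite ler_sqr ?nnegrE// ltW.
    rewrite real_normK ?num_real// ZE.
    have := sqr_ge0 (Q w - 2 * L w); nra.
rewrite (integralD measurableT i2 i8) !integralZl// EL.
have t2 : 0 < t ^+ 2 by rewrite exprn_gt0.
apply: (@le_trans _ _ ((2 / t ^+ 2)%:E * ((2 + kappa) * \tr A)%:E + (8 / t ^+ 2)%:E * (\sum_j b j ^+ 2)%:E)%E).
  rewrite (frobenius_proj AT AA) in EQ.
  apply: leeD2r; apply: lee_wpmul2l EQ.
  by rewrite lee_fin divr_ge0// ltW.
rewrite -!EFinM -EFinD lee_fin le_eqVlt; apply/orP; left; apply/eqP.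
have -> : \sum_j b j ^+ 2 = qform A mu / sigma ^+ 2.
  rewrite qform_proj// mulr_suml; apply: eq_bigr => j _.
  by rewrite /b expr_div_n.
by field; rewrite !gt_eqF.
Qed.

End concentration.

(** * Bounds on the Bayes factor *)

Definition bf_integrand (R : realType) (n i p : nat) (x phi : R) : R :=
  sin phi ^+ (p - i) *
  (n%:R + p.+1%:R * sin phi ^+ 2) `^ ((n%:R - p%:R) / 2) /
  (n%:R * x + p.+1%:R * sin phi ^+ 2) `^ ((n%:R - i%:R) / 2).

Definition bf (R : realType) (n i p : nat) (x : R) : R :=
  2 / pi * p.+1%:R `^ ((p%:R - i%:R) / 2) *
  \int[@lebesgue_measure R]_(phi in `[0, pi / 2]) bf_integrand n i p x phi.

(** The logarithm of the integrand together with its prefactor, where [q] stands for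
    [(p + 1) sin^2 phi]. The exponent of the overview is its value at [q = p + 1], that is at
    [phi = pi / 2]. *)
Definition log_rate (R : realType) (n i p : nat) (q x : R) : R :=
  (n%:R - p%:R) / 2 * ln (1 + n%:R / q) - (n%:R - i%:R) / 2 * ln (1 + n%:R * x / q).

Section pointwise.
Context {R : realType}.

Lemma expR_le_bernoulli (e y : R) : 0 <= e <= 1 -> 0 < y ->
  expR (e * ln y) <= 1 + e * (y - 1).
Proof.
move=> /andP[e0 e1] y0.
have := @convex_expR R (Itv01 e0 e1) (ln y) 0.
by rewrite !convRE/= mulr0 addr0 expR0 lnK ?posrE//; set e' := (X in _ + X * 1); have -> : e' = 1 - e by []; lra.
Qed.

(** Concavity of the power [e] at the mean [G = x (1 + b) + (1 - x)] of the points [1 + b] and 1. It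
    follows from Bernoulli's inequality at [(1 + b) / G] and [1 / G], whose weighted mean is 1. *)
Lemma expR_concave_weighted (x b e : R) : 0 < x <= 1 -> 0 <= b -> 0 <= e <= 1 ->
  x * expR (e * ln (1 + b)) + (1 - x) <= expR (e * ln (1 + x * b)).
Proof.
move=> /andP[x0 x1] b0 e01; pose G := 1 + x * b.
have G0 : 0 < G by rewrite /G ltr_wpDr ?mulr_ge0// ltW.
have b1 : 0 < 1 + b by lra.
have h1 := @expR_le_bernoulli e ((1 + b) / G) e01 (divr_gt0 b1 G0).
have h2 := @expR_le_bernoulli e G^-1 e01; rewrite invr_gt0 in h2.
have {}h2 := h2 G0.
rewrite ln_div ?posrE// mulrBr expRB ler_pdivrMr ?expR_gt0// in h1.
rewrite lnV ?posrE// mulrN expRN in h2.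
have h3 : 1 <= (1 + e * (G^-1 - 1)) * expR (e * ln G).
  by rewrite -ler_pdivrMr ?expR_gt0// div1r.
rewrite -/G; set E := expR (e * ln G) in h1 h3 *.
apply: (@le_trans _ _ (x * ((1 + e * ((1 + b) / G - 1)) * E) + (1 - x) * ((1 + e * (G^-1 - 1)) * E))).
  by apply: lerD; [rewrite ler_wpM2l// ltW|rewrite -{1}[1 - x]mulr1 ler_wpM2l//; lra].
rewrite le_eqVlt; apply/orP; left; apply/eqP.
by rewrite /G; field; rewrite -/G gt_eqF.
Qed.

(** Let [e <= 1] be the factor by which the second logarithm shrinks when [q t] is replaced by [q].
    By concavity of the power [e], the first logarithm shrinks by no more than that, so [e] times
    the rate at [q t] is at most the rate at [q]; as the latter is nonpositive, division by [e] can
    only lower it. *)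
Lemma log_rate_scale (n i p : nat) (q x t : R) : (p < n)%N -> 0 < q ->
  0 < x <= 1 -> 0 < t <= 1 -> log_rate n i p q x <= 0 ->
  log_rate n i p (q * t) x <= log_rate n i p q x.
Proof.
move=> pn q0 /andP[x0 x1] /andP[t0 t1] r0.
have n0 : 0 < n%:R :> R by rewrite ltr0n (leq_ltn_trans _ pn).
pose b := n%:R / (q * t).
have b0 : 0 < b by rewrite divr_gt0 ?mulr_gt0.
have xb : n%:R * x / (q * t) = x * b by rewrite /b mulrAC mulrC.
pose z0 := ln (1 + n%:R * x / q); pose z := ln (1 + x * b).
have xq0 : 0 < n%:R * x / q by rewrite divr_gt0 ?mulr_gt0.
have z00 : 0 < z0 by rewrite ln_gt0// ltrDl.
have z0z : z0 <= z.
  have p1 : 0 < 1 + n%:R * x / q by rewrite addr_gt0.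
  have p2 : 0 < 1 + x * b by rewrite addr_gt0// mulr_gt0.
  rewrite /z0 /z ler_ln ?posrE// lerD2l -xb.
  by rewrite ler_pM2l ?mulr_gt0// lef_pV2 ?posrE ?mulr_gt0// ger_pMr.
have zp : 0 < z by apply: lt_le_trans z0z.
pose e := z0 / z.
have e0 : 0 < e by rewrite divr_gt0.
have e1 : e <= 1 by rewrite ler_pdivrMr// mul1r.
have ez : e * z = z0 by rewrite /e divfK// gt_eqF.
have claim : e * ln (1 + b) <= ln (1 + n%:R / q).
  have nq0 : 0 < n%:R / q by rewrite divr_gt0.
  rewrite -ler_expR [leRHS]lnK ?posrE ?addr_gt0//.
  have := @expR_concave_weighted x b e; rewrite x0 x1 ltW// e1 ltW// => /(_ isT isT isT).
  rewrite -/z ez lnK ?posrE ?addr_gt0// => h.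
  have : x * expR (e * ln (1 + b)) <= x * (1 + n%:R / q).
    have -> : x * (1 + n%:R / q) = x + n%:R * x / q by ring.
    lra.
  by rewrite ler_pM2l.
have N0 : 0 <= (n%:R - p%:R) / 2 :> R by rewrite divr_ge0// subr_ge0 ler_nat ltnW.
have : e * log_rate n i p (q * t) x <= log_rate n i p q x.
  rewrite /log_rate xb -/b -/z -/z0 -ez.
  have := ler_wpM2l N0 claim; lra.
move: r0; set r1 := log_rate _ _ _ q x; set r2 := log_rate _ _ _ _ x => r10 h.
have : r2 <= r1 / e by rewrite ler_pdivlMr// mulrC.
move=> /le_trans; apply.
rewrite -subr_ge0; have -> : r1 - r1 / e = (- r1) * (e^-1 - 1) by ring.
by rewrite mulr_ge0 ?oppr_ge0// subr_ge0 invf_ge1.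
Qed.

(** Taking [(p + 1) sin^2 phi] out of both bases leaves it with the exponent [- (p - i) / 2], which
    cancels the prefactor and the power of the sine. *)
Lemma bf_integrandE (n i p : nat) (x phi : R) : (i <= p)%N -> (0 < n)%N ->
  0 <= x -> 0 < sin phi ->
  p.+1%:R `^ ((p%:R - i%:R) / 2) * bf_integrand n i p x phi =
  expR (log_rate n i p (p.+1%:R * sin phi ^+ 2) x).
Proof.
move=> ip n0 x0 s0; rewrite /bf_integrand /log_rate.
move: (sin phi) s0 => s s0.
have n0' : 0 < n%:R :> R by rewrite ltr0n.
set q : R := p.+1%:R; have q0 : 0 < q by rewrite ltr0n.
have t0 : 0 < q * s ^+ 2 by rewrite mulr_gt0 ?exprn_gt0.
have a0 : 0 < n%:R + q * s ^+ 2 by rewrite addr_gt0.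
have b0 : 0 < n%:R * x + q * s ^+ 2 by rewrite ltr_wpDl ?mulr_ge0// ltW.
have -> : s ^+ (p - i) = expR ((p%:R - i%:R) * ln s).
  by rewrite -natrB// expRM_natl lnK.
rewrite /powR (gt_eqF q0) (gt_eqF a0) (gt_eqF b0) -!expRD -expRN -!expRD; congr expR.
have -> : 1 + n%:R / (q * s ^+ 2) = (n%:R + q * s ^+ 2) / (q * s ^+ 2).
  by rewrite mulrDl divff ?gt_eqF// addrC.
have -> : 1 + n%:R * x / (q * s ^+ 2) = (n%:R * x + q * s ^+ 2) / (q * s ^+ 2).
  by rewrite mulrDl divff ?gt_eqF// addrC.
rewrite !ln_div ?posrE// lnM ?posrE ?exprn_gt0// lnXn// -mulr_natr.
by field.
Qed.

Lemma bf_integrand_ge0 (n i p : nat) (x phi : R) : 0 <= sin phi ->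
  0 <= bf_integrand n i p x phi.
Proof. by move=> s0; rewrite /bf_integrand divr_ge0 ?mulr_ge0 ?powR_ge0// exprn_ge0. Qed.

Lemma measurable_bf_integrand (n i p : nat) (x : R) D :
  measurable_fun D (bf_integrand n i p x).
Proof.
apply: measurable_funTS.
have ms : measurable_fun setT (@sin R) by exact: continuous_measurable_fun (@continuous_sin R).
have mb (c : R) : measurable_fun setT (fun phi => c + p.+1%:R * sin phi ^+ 2).
  by apply: measurable_funD => //; apply: measurable_funM => //; exact: measurable_funX.
apply: measurable_funM; first apply: measurable_funM.
- exact: measurable_funX.
- by apply: (measurableT_comp (measurable_powR _)).
- under eq_fun do rewrite -powRN.
  by apply: (measurableT_comp (measurable_powR _)).
Qed.

Let sin_pihalf_ge0 (phi : R) : phi \in `[0, pi / 2] -> 0 <= sin phi.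
Proof.
rewrite in_itv/= => /andP[p0 p1]; apply: sin_ge0_pi; rewrite p0/=.
by have := pi_gt0 R; lra.
Qed.

Lemma bf_ge0 (n i p : nat) (x : R) : 0 <= bf n i p x.
Proof.
rewrite /bf mulr_ge0//.
  by rewrite mulr_ge0 ?powR_ge0// divr_ge0// pi_ge0.
apply: fine_ge0; apply: integral_ge0 => phi /= h.
by rewrite lee_fin bf_integrand_ge0// sin_pihalf_ge0.
Qed.

Let integral_pihalf_cst (c : R) :
  (\int[@lebesgue_measure R]_(phi in `[0%R, (pi / 2)%R]) c%:E = (c * (pi / 2))%:E)%E.
Proof.
rewrite integral_cst//= lebesgue_measure_itv/= lte_fin divr_gt0 ?pi_gt0//.
by rewrite oppr0 adde0 EFinM.
Qed.

(** By [log_rate_scale] the integrand is bounded by its value at [phi = pi / 2], and the length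
    [pi / 2] of the interval cancels the factor [2 / pi]. *)
Lemma bf_le (n i p : nat) (x : R) : (i < p)%N -> (p < n)%N -> 0 < x <= 1 ->
  log_rate n i p p.+1%:R x <= 0 ->
  bf n i p x <= expR (log_rate n i p p.+1%:R x).
Proof.
move=> ip pn x01 r0; have /andP[x0 x1] := x01.
set r := log_rate _ _ _ _ _ in r0 *.
set w := p.+1%:R `^ ((p%:R - i%:R) / 2) : R.
have w0 : 0 < w by rewrite powR_gt0// ltr0n.
have pi0 := pi_gt0 R.
have ub phi : phi \in `[0, pi / 2] -> bf_integrand n i p x phi <= expR r / w.
  move=> hphi; rewrite ler_pdivlMr// mulrC.
  have := sin_pihalf_ge0 hphi; rewrite le_eqVlt => /predU1P[s0|s0].
    rewrite /bf_integrand -s0 expr0n subn_eq0 leqNgt ip/= !mul0r mulr0.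
    exact: expR_ge0.
  rewrite bf_integrandE//; [|exact: ltnW|exact: leq_ltn_trans pn|exact: ltW].
  rewrite ler_expR; apply: log_rate_scale => //.
  by rewrite exprn_gt0//= exprn_ile1 ?sin_le1// ltW.
have le1 : (\int[@lebesgue_measure R]_(phi in `[0%R, (pi / 2)%R]) (bf_integrand n i p x phi)%:E
    <= (expR r / w * (pi / 2))%:E)%E.
  rewrite -integral_pihalf_cst; apply: ge0_le_integral => //.
  - by move=> phi h; rewrite lee_fin bf_integrand_ge0// sin_pihalf_ge0.
  - by apply/measurable_EFinP; exact: measurable_bf_integrand.
have ge1 : (0 <= \int[@lebesgue_measure R]_(phi in `[0%R, (pi / 2)%R]) (bf_integrand n i p x phi)%:E)%E.
  by apply: integral_ge0 => phi h; rewrite lee_fin bf_integrand_ge0// sin_pihalf_ge0.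
have le2 : \int[@lebesgue_measure R]_(phi in `[0, pi / 2]) bf_integrand n i p x phi <= expR r / w * (pi / 2).
  rewrite -[leRHS]/(fine (_%:E)); apply: fine_le => //.
  by rewrite ge0_fin_numE//; apply: le_lt_trans le1 _; rewrite ltry.
rewrite /bf -/w.
apply: (@le_trans _ _ (2 / pi * w * (expR r / w * (pi / 2)))).
  by rewrite ler_wpM2l// mulr_ge0 ?powR_ge0// divr_ge0// ltW.
rewrite le_eqVlt; apply/orP; left; apply/eqP.
  move: (@pi R) pi0 => a a0; field.
  by rewrite (gt_eqF w0) (gt_eqF a0).
Qed.

(** Only the last stretch of length [eta] of the interval is kept. There [sin^2 phi <= 1] bounds the
    first logarithm from below and [t <= sin^2 phi] bounds the second from above. *)
Lemma bf_ge (n i p : nat) (x t eta : R) : (i < p)%N -> (p < n)%N -> 0 < x ->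
  0 < t -> 0 < eta <= pi / 2 ->
  (forall phi, pi / 2 - eta <= phi <= pi / 2 -> 0 < sin phi /\ t <= sin phi ^+ 2) ->
  2 / pi * eta * expR ((n%:R - p%:R) / 2 * ln (1 + n%:R / p.+1%:R) -
     (n%:R - i%:R) / 2 * ln (1 + n%:R * x / (p.+1%:R * t))) <= bf n i p x.
Proof.
move=> ip pn x0 t0 /andP[eta0 eta1] heta.
set r := _ - _ * ln _.
set w := p.+1%:R `^ ((p%:R - i%:R) / 2) : R.
have w0 : 0 < w by rewrite powR_gt0// ltr0n.
have pi0 := pi_gt0 R.
have n0 : (0 < n)%N by exact: leq_ltn_trans pn.
have n0' : 0 < n%:R :> R by rewrite ltr0n.
have q0 : 0 < p.+1%:R :> R by rewrite ltr0n.
have N0 : 0 <= (n%:R - p%:R) / 2 :> R by rewrite divr_ge0// subr_ge0 ler_nat ltnW.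
have M0 : 0 <= (n%:R - i%:R) / 2 :> R.
  by rewrite divr_ge0// subr_ge0 ler_nat ltnW// (ltn_trans ip pn).
have lb phi : phi \in `[pi / 2 - eta, pi / 2] -> expR r / w <= bf_integrand n i p x phi.
  rewrite in_itv/= => /heta[s0 ts].
  rewrite ler_pdivrMr// [leRHS]mulrC (bf_integrandE (ltnW ip) n0 (ltW x0) s0).
  rewrite ler_expR /r /log_rate.
  have s20 : 0 < sin phi ^+ 2 by rewrite exprn_gt0.
  apply: lerB.
    rewrite ler_wpM2l// ler_ln ?posrE ?addr_gt0 ?divr_gt0 ?mulr_gt0//.
    rewrite lerD2l ler_pM2l// lef_pV2 ?posrE ?mulr_gt0// ger_pMr//.
  rewrite ler_wpM2l// ler_ln ?posrE ?addr_gt0 ?divr_gt0 ?mulr_gt0//.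
  rewrite lerD2l ler_pM2l ?mulr_gt0// lef_pV2 ?posrE ?mulr_gt0//.
  by rewrite ler_pM2l.
pose I := (\int[@lebesgue_measure R]_(phi in `[0%R, (pi / 2)%R]) (bf_integrand n i p x phi)%:E)%E.
have mI D : measurable_fun D (fun phi => (bf_integrand n i p x phi)%:E).
  by apply/measurable_EFinP; exact: measurable_bf_integrand.
have ge1 : (((expR r / w) * eta)%:E <= I)%E.
  apply: (@le_trans _ _ (\int[@lebesgue_measure R]_(phi in `[(pi / 2 - eta)%R, (pi / 2)%R]) (expR r / w)%:E)%E).
    rewrite integral_cst//= lebesgue_measure_itv/= lte_fin ltrBlDr ltrDl eta0.
    rewrite -EFinD -EFinM lee_fin le_eqVlt; apply/orP; left; apply/eqP.
    by ring.
  apply: (@le_trans _ _ (\int[@lebesgue_measure R]_(phi in `[(pi / 2 - eta)%R, (pi / 2)%R]) (bf_integrand n i p x phi)%:E)%E).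
    apply: ge0_le_integral => //.
    - by move=> phi _; rewrite lee_fin divr_ge0 ?expR_ge0// ltW.
    - exact: mI.
  apply: ge0_subset_integral => //.
  - exact: mI.
  - by move=> phi h; rewrite lee_fin bf_integrand_ge0// sin_pihalf_ge0.
  - by apply: subset_itv => //; rewrite bnd_simp; lra.
(* A crude bound showing that the integral is finite: the real-valued integral is [fine] of the
   extended one, and [fine] would send an infinite value to 0. *)
pose c := (n%:R + p.+1%:R) `^ ((n%:R - p%:R) / 2) / (n%:R * x) `^ ((n%:R - i%:R) / 2) : R.
have lty : (I < +oo)%E.
  apply: (@le_lt_trans _ _ (c * (pi / 2))%:E); last by rewrite ltry.
  rewrite -integral_pihalf_cst; apply: ge0_le_integral => //.
  - by move=> phi h; rewrite lee_fin bf_integrand_ge0// sin_pihalf_ge0.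
  - exact: mI.
  - move=> phi h; rewrite lee_fin /bf_integrand /c.
    have s0 := sin_pihalf_ge0 h; have s1 := sin_le1 phi.
    have s21 : sin phi ^+ 2 <= 1 by rewrite exprn_ile1.
    have s20 : 0 <= sin phi ^+ 2 by rewrite exprn_ge0.
    apply: ler_pM.
    + by rewrite mulr_ge0 ?powR_ge0// exprn_ge0.
    + by rewrite invr_ge0 powR_ge0.
    + rewrite -[leRHS]mul1r ler_pM ?powR_ge0 ?exprn_ge0 ?exprn_ile1//.
      apply: ge0_ler_powR => //; rewrite ?nnegrE ?addr_ge0 ?mulr_ge0//.
      by rewrite lerD2l ger_pMr.
    + rewrite lef_pV2 ?posrE ?powR_gt0 ?mulr_gt0//; last first.
        by rewrite ltr_wpDr ?mulr_gt0 ?mulr_ge0.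
      have x0' := ltW x0.
      apply: ge0_ler_powR => //; rewrite ?nnegrE ?addr_ge0 ?mulr_ge0//.
      by rewrite lerDl mulr_ge0.
have Ifin : I \is a fin_num.
  rewrite ge0_fin_numE//; apply: le_trans ge1.
  by rewrite lee_fin mulr_ge0 ?divr_ge0 ?expR_ge0// ltW.
have ge2 : expR r / w * eta <= fine I by rewrite -lee_fin fineK.
rewrite /bf -/w.
apply: (@le_trans _ _ (2 / pi * w * (expR r / w * eta))).
  rewrite le_eqVlt; apply/orP; left; apply/eqP.
  move: (@pi R) pi0 => a a0; field.
  by rewrite (gt_eqF w0) (gt_eqF a0).
by rewrite ler_wpM2l// mulr_ge0 ?powR_ge0// divr_ge0// ltW.
Qed.

(* AM-GM gives [ln (1 - b) <= - b - b^2/4], whose quadratic term is what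
   survives when [rho] tends to [1]. *)
Lemma log_rate_le (n i p : nat) (q x b rho : R) : (i < p)%N -> (p < n)%N ->
  0 < q -> 0 < x <= 1 -> b = n%:R * x / (n%:R * x + q) ->
  rho = (n%:R - p%:R) * (1 - x) / ((p%:R - i%:R) * x) ->
  log_rate n i p q x <= (p%:R - i%:R) / 2 * ((rho - 1) * b - b ^+ 2 / 4).
Proof.
move=> ip pn q0 /andP[x0 x1] bE rhoE.
have n0 : 0 < n%:R :> R by rewrite ltr0n (leq_ltn_trans _ pn).
have N0 : 0 < n%:R - p%:R :> R by rewrite subr_gt0 ltr_nat.
have m0 : 0 < p%:R - i%:R :> R by rewrite subr_gt0 ltr_nat.
have D0 : 0 < n%:R * x + q by rewrite addr_gt0// mulr_gt0.
have b0 : 0 < b by rewrite bE divr_gt0// mulr_gt0.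
have b1 : b < 1 by rewrite bE ltr_pdivrMr// mul1r ltrDl.
have b1E : (1 - b)^-1 = (n%:R * x + q) / q.
  have -> : 1 - b = q / (n%:R * x + q) by rewrite bE; field; rewrite gt_eqF.
  by rewrite invf_div.
have e1 : 1 + n%:R * x / q = (1 - b)^-1.
  by rewrite b1E; field; rewrite gt_eqF.
(* With this factorisation [ln (1 - b)] collects the coefficient [(p - i) / 2]. The remaining
   logarithm is bounded by its argument minus 1, and [rho] rewrites that bound as a multiple of
   [p - i] as well. *)
have e2 : 1 + n%:R / q = (1 + n%:R * (1 - x) / (n%:R * x + q)) * (1 - b)^-1.
  by rewrite b1E; field; rewrite !gt_eqF.
have l1 : ln (1 - b) <= - b - b ^+ 2 / 4.
  have y0 : 0 < 1 - b / 2 - b ^+ 2 / 8 by nra.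
  have h : 1 - b <= (1 - b / 2 - b ^+ 2 / 8) ^+ 2.
    have -> : (1 - b / 2 - b ^+ 2 / 8) ^+ 2 = 1 - b + b ^+ 3 / 8 + b ^+ 4 / 64 by field.
    have := exprn_gt0 3 b0; have := exprn_gt0 4 b0; lra.
  apply: (@le_trans _ _ (ln ((1 - b / 2 - b ^+ 2 / 8) ^+ 2))).
    by rewrite ler_ln ?posrE ?exprn_gt0//; lra.
  rewrite lnXn// [ln _ *+ 2]mulr2n; have := ln_le_subr1 y0; lra.
have c0 : 0 < 1 + n%:R * (1 - x) / (n%:R * x + q).
  have -> : 1 + n%:R * (1 - x) / (n%:R * x + q) = (n%:R + q) / (n%:R * x + q).
    by field; rewrite gt_eqF.
  by rewrite divr_gt0// addr_gt0.
have l2 : ln (1 + n%:R * (1 - x) / (n%:R * x + q)) <= n%:R * (1 - x) / (n%:R * x + q).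
  by have := ln_le_subr1 c0; lra.
have b10 : 0 < 1 - b by lra.
rewrite /log_rate e2 e1 lnM ?posrE ?invr_gt0// lnV ?posrE//.
have -> : (rho - 1) * b - b ^+ 2 / 4 = rho * b + (- b - b ^+ 2 / 4) by ring.
have e3 : (p%:R - i%:R) * (rho * b) = (n%:R - p%:R) * (n%:R * (1 - x) / (n%:R * x + q)).
  by rewrite rhoE bE; field; rewrite !gt_eqF.
have h1 := ler_wpM2l (ltW N0) l2.
have h2 := ler_wpM2l (ltW m0) l1.
move: h1 h2 e3; set A := ln (1 + _); set B := ln (1 - b).
by set C := n%:R * (1 - x) / _; lra.
Qed.

End pointwise.

(** * Measurability of the Bayes factor and its exceptional events *)

Lemma measurable_bf (R : realType) (n i p : nat) :
  measurable_fun setT (bf n i p : R -> R).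
Proof.
apply: measurable_funM; first exact: measurable_cst.
pose I : set R := `[0, pi / 2]%classic.
(* The indicator keeps [f] nonnegative on the whole plane, where the sine changes sign, so that
   Tonelli's theorem gives measurability of the partial integral in [x]. *)
pose f (z : R * R) := (bf_integrand n i p z.1 z.2 * \1_I z.2)%:E.
have f0 z : (0 <= f z)%E.
  rewrite /f lee_fin indicE; have [/set_mem zI|_] := boolP (z.2 \in I); last by rewrite mulr0.
  rewrite mulr1 bf_integrand_ge0//; move: zI; rewrite /I/= in_itv/= => /andP[z0 z1].
  by apply: sin_ge0_pi; rewrite z0/=; have := pi_gt0 R; lra.
have mf : measurable_fun setT f.
  apply/measurable_EFinP.
  have ms : measurable_fun setT (fun z : R * R => sin z.2).
    apply: (measurableT_comp (f := @sin R)) => //.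
    exact: continuous_measurable_fun (@continuous_sin R).
  have mq : measurable_fun setT (fun z : R * R => p.+1%:R * sin z.2 ^+ 2).
    by apply: measurable_funM => //; exact: measurable_funX.
  apply: measurable_funM; last first.
    apply: (measurableT_comp (f := \1_I : R -> R)) => //.
    by apply: measurable_indic; exact: measurable_itv.
  apply: measurable_funM; first apply: measurable_funM.
  - exact: measurable_funX.
  - apply: (measurableT_comp (measurable_powR _)).
    exact: measurable_funD.
  - under eq_fun do rewrite -powRN.
    apply: (measurableT_comp (measurable_powR _)).
    by apply: measurable_funD => //; apply: measurable_funM.
have := @measurable_fun_fubini_tonelli_F _ _ _ _ _ (@lebesgue_measure R) f mf f0.
move=> mF.
have -> : (fun x => \int[@lebesgue_measure R]_(phi in `[0, pi / 2]) bf_integrand n i p x phi) =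
    fine \o fubini_F (@lebesgue_measure R) f.
  apply/funext => x; rewrite /= /Rintegral /fubini_F; congr fine.
  rewrite integral_mkcond; apply: eq_integral => phi _.
  by rewrite epatch_indic /f/= EFinM.
exact: measurableT_comp.
Qed.

Section measurability.
Context {R : realType} {d : measure_display} {T : measurableType d}.
Variables (P : probability T R) (n i p : nat) (Y : 'I_n -> {RV P >-> R}).
Variables (X : 'M[R]_(n, p)) (sel : 'I_i -> 'I_p).
Hypothesis uX : X^T *m X \in unitmx.
Hypothesis sel_inj : injective sel.

Lemma measurable_bayes_factor :
  measurable_fun setT (fun w => bayes_factor (colsub sel X) X (sample_vector Y w)).
Proof.
apply: (measurableT_comp (@measurable_bf R n i p)).
apply: measurable_funM; first exact: measurable_qform.
(* Inversion is treated as the power -1, whose measurability is at hand. The two agree on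
   nonnegative bases, and a residual sum of squares is one because it comes from a projection. *)
have rss_powR w : (rss (colsub sel X) (sample_vector Y w))^-1 =
    (rss (colsub sel X) (sample_vector Y w)) `^ (- 1).
  rewrite powR_inv1// qform_proj_ge0//.
    by apply: resid_sym.
  by apply: resid_idem; exact: colsub_unit.
under eq_fun do rewrite rss_powR.
apply: (measurableT_comp (measurable_powR _)); exact: measurable_qform.
Qed.

Lemma measurable_bayes_factor_le M :
  measurable [set w | bayes_factor (colsub sel X) X (sample_vector Y w) <= M].
Proof.
rewrite -[X in measurable X]setTI.
have -> : [set w | bayes_factor (colsub sel X) X (sample_vector Y w) <= M] =
    (fun w => bayes_factor (colsub sel X) X (sample_vector Y w)) @^-1` `]-oo, M]%classic.
  by apply/seteqP; split => w /=; rewrite in_itv.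
exact: measurable_bayes_factor.
Qed.

Lemma measurable_bayes_factor_ge M :
  measurable [set w | M <= `|bayes_factor (colsub sel X) X (sample_vector Y w) - 0| ].
Proof.
rewrite -[X in measurable X]setTI.
have -> : [set w | M <= `|bayes_factor (colsub sel X) X (sample_vector Y w) - 0| ] =
    (fun w => `|bayes_factor (colsub sel X) X (sample_vector Y w)|) @^-1` `[M, +oo[%classic.
  by apply/seteqP; split => w /=; rewrite in_itv/= subr0 andbT.
have mb : measurable_fun setT (fun w => `|bayes_factor (colsub sel X) X (sample_vector Y w)|).
  by apply: measurableT_comp => //; exact: measurable_bayes_factor.
exact: mb.
Qed.

Variables (mu : 'cV[R]_n) (sigma : R).
Hypothesis sY : normal_sample Y mu sigma.
Hypothesis sigma0 : 0 < sigma.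
Hypothesis resid_mu : resid_mx X *m mu = 0.

(* Outside two events of small probability the Bayes factor is
   [bf n i p (V / (V + W))] with [V] and [W] close to their expectations. *)
Lemma bayes_factor_event (E : set T) (t1 t2 : R) :
  measurable E -> 0 < t1 -> 0 < t2 ->
  (forall w V W, 0 <= V -> 0 <= W ->
     bayes_factor (colsub sel X) X (sample_vector Y w) = bf n i p (V / (V + W)) ->
     `|V - (n%:R - p%:R)| < t1 ->
     `|W - (p%:R - i%:R) - qform (gain_mx X sel) mu / sigma ^+ 2| < t2 -> ~ E w) ->
  (P E <= (((4 + 2 * gauss_moment4 R) * (n%:R - p%:R)) / t1 ^+ 2 +
           ((4 + 2 * gauss_moment4 R) * (p%:R - i%:R)
            + 8 * (qform (gain_mx X sel) mu / sigma ^+ 2)) / t2 ^+ 2)%:E)%E.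
Proof.
move=> mE t10 t20 HE.
have rs := resid_sym X; have ri := resid_idem uX.
have gs := gain_sym X sel; have gi := gain_idem uX sel_inj.
have c1 := quad_form_concentration sY sigma0 rs ri t10.
have c2 := quad_form_concentration sY sigma0 gs gi t20.
rewrite (qform_proj_eq0 resid_mu) mul0r mulr0 addr0 (resid_tr uX) in c1.
rewrite (gain_tr uX sel_inj) in c2.
rewrite EFinD; apply: le_trans (leeD c1 c2).
set E1 := [set w | t1 <= _]; set E2 := [set w | t2 <= _].
have m1 : measurable E1 by exact: measurable_qform_event.
have m2 : measurable E2 by exact: measurable_qform_event.
apply: (@le_trans _ _ (P (E1 `|` E2))); last exact: measureU2.
apply: le_measure; rewrite ?inE//; first exact: measurableU.
move=> w Ew; apply: contrapT => /not_orP[n1 n2].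
have s20 : 0 < sigma ^+ 2 by rewrite exprn_gt0.
have V0 : 0 <= qform (resid_mx X) (sample_vector Y w) / sigma ^+ 2.
  by apply: divr_ge0; [exact: qform_proj_ge0|exact: ltW].
have W0 : 0 <= qform (gain_mx X sel) (sample_vector Y w) / sigma ^+ 2.
  by apply: divr_ge0; [exact: qform_proj_ge0|exact: ltW].
apply: (HE w _ _ V0 W0 _ _ _ Ew).
(* The scaling by [sigma ^+ 2] cancels in the ratio, leaving [Bstat]. *)
- rewrite /bayes_factor -/(bf n i p _) /Bstat rss_full (rss_reduced X sel); congr bf.
  by rewrite -mulrDl invf_div mulrA divfK// gt_eqF.
- by rewrite ltNge; apply/negP; move: n1; rewrite /E1/= subr0.
- by rewrite ltNge; apply/negP.
Qed.

End measurability.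

Lemma cvgn_invr (R : realType) : (n%:R : R)^-1 @[n --> \oo] --> (0 : R).
Proof.
apply/(@gtr0_cvgV0 R _ _ _ (fun n : nat => n%:R : R)); last exact: cvgr_idn.
by near=> n; rewrite ltr0n; near: n; exact: nbhs_infty_gt.
Unshelve. all: by end_near. Qed.

Lemma cvge0_bound (R : realType) (u : nat -> \bar R) (c : nat -> R) :
  (forall n, (0 <= u n)%E) -> (\forall n \near \oo, (u n <= (c n)%:E)%E) ->
  c n @[n --> \oo] --> (0 : R) -> u n @[n --> \oo] --> 0%E.
Proof.
move=> u0 uc c0; apply: (@squeeze_cvge _ _ _ _ (fun=> 0%E) _ (fun n => (c n)%:E)).
- by near=> n; rewrite u0/=; near: n.
- exact: cvg_cst.
- by apply: cvg_EFin => //; near=> n.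
Unshelve. all: by end_near. Qed.

(** * Asymptotics *)

Section regime.
Context {R : realType}.
Variables (i p : nat -> nat) (sel : forall n, 'I_(i n) -> 'I_(p n)).
Variables (X : forall n, 'M[R]_(n, p n)) (r s : R).
Hypothesis reg : growth_regime sel X r s.

Lemma regime_cvg_p : (p n)%:R / n%:R @[n --> \oo] --> r^-1.
Proof.
have r0 : r != 0 by rewrite gt_eqF// (lt_trans _ (regime_r_gt1 reg)).
have -> : (fun n => (p n)%:R / n%:R) = (fun n => (n%:R / (p n)%:R)^-1 : R).
  by apply/funext => n; rewrite invf_div.
exact: cvgV r0 (regime_r reg).
Qed.

Lemma regime_cvg_i : (i n)%:R / n%:R @[n --> \oo] --> s^-1.
Proof.
have s0 : s != 0 by rewrite gt_eqF// (lt_le_trans _ (regime_s_ge1 reg)).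
have -> : (fun n => (i n)%:R / n%:R) = (fun n => (n%:R / (i n)%:R)^-1 : R).
  by apply/funext => n; rewrite invf_div.
exact: cvgV s0 (regime_s reg).
Qed.

(** The inequality [p n < n] is derived: it holds eventually because [n / p n] has a limit above
    1. *)
Lemma regime_near : \forall n \near \oo,
  [/\ (0 < n)%N, (i n < p n)%N, (p n < n)%N, injective (@sel n)
    & (X n)^T *m X n \in unitmx].
Proof.
near=> n.
have [ip inj] : (i n < p n)%N /\ injective (@sel n).
  by near: n; exact: regime_nested reg.
have u : (X n)^T *m X n \in unitmx by near: n; exact: regime_full_rank reg.
have n0 : (0 < n)%N by near: n; exact: nbhs_infty_gt.
have h : (1 : R) < n%:R / (p n)%:R.
  by near: n; apply: (cvgr_gt _ (regime_r reg)); exact: regime_r_gt1 reg.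
have p0 : (0 < p n)%N by exact: leq_ltn_trans ip.
by split => //; move: h; rewrite ltr_pdivlMr ?ltr0n// mul1r ltr_nat.
Unshelve. all: by end_near. Qed.

Lemma regime_le : r <= s.
Proof.
have r0 : 0 < r by rewrite (lt_trans _ (regime_r_gt1 reg)).
have s0 : 0 < s by rewrite (lt_le_trans _ (regime_s_ge1 reg)).
rewrite -lef_pV2 ?posrE//.
apply: ler_cvg_to regime_cvg_i regime_cvg_p _.
near=> n; have [n0 ip _ _ _] : [/\ (0 < n)%N, (i n < p n)%N, (p n < n)%N, injective (@sel n)
    & (X n)^T *m X n \in unitmx] by near: n; exact: regime_near.
by rewrite ler_pM2r ?invr_gt0 ?ltr0n// ler_nat ltnW.
Unshelve. all: by end_near. Qed.

Definition scaled_rate (x : R) (n : nat) : R :=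
  (1 - (p n)%:R / n%:R) * ln (1 + n%:R / (p n).+1%:R) -
  (1 - (i n)%:R / n%:R) * ln (1 + n%:R / (p n).+1%:R * x).

Lemma log_rateE x n : (0 < n)%N ->
  log_rate n (i n) (p n) (p n).+1%:R x = n%:R / 2 * scaled_rate x n.
Proof.
move=> n0; rewrite /log_rate /scaled_rate [n%:R * x / _]mulrAC.
by field; rewrite pnatr_eq0 -lt0n.
Qed.

Lemma cvg_scaled_rate x : 0 <= x ->
  scaled_rate x n @[n --> \oo] -->
  (1 - r^-1) * ln (1 + r) - (1 - s^-1) * ln (1 + r * x).
Proof.
move=> x0; have r1 := regime_r_gt1 reg.
have r0 : 0 < r by rewrite (lt_trans _ r1).
have cq : n%:R / (p n).+1%:R @[n --> \oo] --> r.
  have h : (p n).+1%:R / n%:R @[n --> \oo] --> r^-1 + 0.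
    have -> : (fun n => (p n).+1%:R / n%:R : R) = (fun n => (p n)%:R / n%:R + n%:R^-1).
      by apply/funext => n; rewrite -natr1 mulrDl mul1r.
    by apply: cvgD; [exact: regime_cvg_p|exact: cvgn_invr].
  rewrite addr0 in h.
  have -> : (fun n => n%:R / (p n).+1%:R) = (fun n => ((p n).+1%:R / n%:R)^-1 : R).
    by apply/funext => n; rewrite invf_div.
  by rewrite -[X in _ --> X]invrK; apply: cvgV => //; rewrite invr_eq0 gt_eqF.
apply: cvgB; apply: cvgM.
- by apply: cvgB; [exact: cvg_cst|exact: regime_cvg_p].
- apply: continuous_cvg; first by apply: continuous_ln; lra.
  by apply: cvgD; [exact: cvg_cst|].
- by apply: cvgB; [exact: cvg_cst|exact: regime_cvg_i].
- apply: continuous_cvg.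
    by apply: continuous_ln; have := mulr_ge0 (ltW r0) x0; lra.
  by apply: cvgD; [exact: cvg_cst|apply: cvgM => //; exact: cvg_cst].
Qed.

End regime.

Section critical_ratio.
Context {R : realType}.

(* The limit of [Bstat] at which the limiting exponent vanishes. *)
Definition critical_ratio (r s : R) : R :=
  (expR ((1 - r^-1) / (1 - s^-1) * ln (1 + r)) - 1) / r.

Lemma critical_ratio_gt0 (r s : R) : 1 < r -> r <= s -> 0 < critical_ratio r s.
Proof.
move=> r1 rs; have s1 : 1 < s by lra.
have rV : r^-1 < 1 by rewrite invf_lt1//; lra.
have sV : s^-1 < 1 by rewrite invf_lt1//; lra.
rewrite divr_gt0//; last by lra.
rewrite subr_gt0 expR_gt1 mulr_gt0//; first by rewrite divr_gt0; lra.
by rewrite ln_gt0//; lra.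
Qed.

Lemma critical_ratio_le1 (r s : R) : 1 < r -> r <= s -> critical_ratio r s <= 1.
Proof.
move=> r1 rs; have s1 : 1 < s by lra.
have sV : s^-1 < 1 by rewrite invf_lt1//; lra.
have rsV : s^-1 <= r^-1 by rewrite lef_pV2 ?posrE; lra.
rewrite ler_pdivrMr ?mul1r; last by lra.
rewrite lerBlDl -[leRHS]lnK ?posrE; last by lra.
rewrite ler_expR ger_pMl; first by rewrite ler_pdivrMr; lra.
by rewrite ln_gt0//; lra.
Qed.

(** The right-hand side is the solution [L] of [(1 - 1/r) / (1 - 1/s + L) = critical_ratio r s], so
    comparing [L] with delta amounts to comparing the limit of [Bstat] with the critical ratio. *)
Lemma delta_rs_critical_ratio (r s : R) : 1 < r -> r <= s ->
  delta_rs r s = (1 - r^-1) / critical_ratio r s - (1 - s^-1).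
Proof.
move=> r1 rs; have s1 : 1 < s by lra.
have x0 := critical_ratio_gt0 r1 rs.
rewrite /delta_rs opprB addrA addrAC; congr (_ - 1 + _).
have -> : (r + 1) `^ (s * (r - 1) / (r * (s - 1))) - 1 = r * critical_ratio r s.
  rewrite /critical_ratio mulrCA divff ?mulr1; last by rewrite gt_eqF//; lra.
  rewrite /powR gt_eqF; last by lra.
  have -> : s * (r - 1) / (r * (s - 1)) = (1 - r^-1) / (1 - s^-1).
    by field; rewrite !gt_eqF//; lra.
  by rewrite [r + 1]addrC.
move: (critical_ratio r s) x0 => x x0.
by field; rewrite !gt_eqF//; lra.
Qed.

Lemma critical_ratio_rate (r s : R) : 1 < r -> r <= s ->
  (1 - s^-1) * ln (1 + r * critical_ratio r s) = (1 - r^-1) * ln (1 + r).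
Proof.
move=> r1 rs; have s1 : 1 < s by lra.
have sV : s^-1 < 1 by rewrite invf_lt1//; lra.
have -> : 1 + r * critical_ratio r s = expR ((1 - r^-1) / (1 - s^-1) * ln (1 + r)).
  by rewrite /critical_ratio; field; rewrite gt_eqF//; lra.
rewrite expRK mulrA mulrCA divff ?mulr1// gt_eqF//; lra.
Qed.

Lemma rate_lt (r s x y : R) : 1 < r -> r <= s -> 0 <= x -> x < y ->
  (1 - s^-1) * ln (1 + r * x) < (1 - s^-1) * ln (1 + r * y).
Proof.
move=> r1 rs x0 xy; have s1 : 1 < s by lra.
have sV : s^-1 < 1 by rewrite invf_lt1//; lra.
rewrite ltr_pM2l; last by lra.
by rewrite ltr_ln ?posrE; nra.
Qed.

Lemma sin_sqr_near_pihalf (t : R) : t < 1 ->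
  exists2 eta : R, 0 < eta <= pi / 2 &
  forall phi, pi / 2 - eta <= phi <= pi / 2 -> 0 < sin phi /\ t <= sin phi ^+ 2.
Proof.
move=> t1.
have cs : {for pi / 2, continuous (fun x : R => sin x ^+ 2)}.
  apply: (@continuous_comp _ _ _ (@sin R) (fun y => y ^+ 2)).
    exact: continuous_sin.
  exact: exprn_continuous.
have h1 : \forall x \near (pi / 2 : R), t < sin x ^+ 2.
  by apply: (cvgr_gt _ cs); rewrite sin_pihalf expr1n.
have h2 : \forall x \near (pi / 2 : R), 0 < sin x.
  by apply: (cvgr_gt _ (@continuous_sin R (pi / 2))); rewrite sin_pihalf.
have [e e0 he] : exists2 e : R, 0 < e & ball (pi / 2 : R) e `<=` [set x | t < sin x ^+ 2 /\ 0 < sin x].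
  have : nbhs (pi / 2 : R) [set x | t < sin x ^+ 2 /\ 0 < sin x].
    by near=> x; split; near: x.
  by move=> /nbhs_ballP[e /= e0 he]; exists e.
have pi0 := pi_gt0 R.
exists (Num.min (e / 2) (pi / 2)).
  by rewrite lt_min !divr_gt0//= ge_min lexx orbT.
move=> phi /andP[h3 h4].
have m1 : Num.min (e / 2) (pi / 2) <= e / 2 by rewrite ge_min lexx.
have [] : t < sin phi ^+ 2 /\ 0 < sin phi.
  apply: he; rewrite /ball/= ger0_norm ?subr_ge0//; lra.
by move=> /ltW.
Unshelve. all: by end_near. Qed.

End critical_ratio.

(** * The reduced model *)

Lemma log_rate_reduced (R : realType) (n i p : nat) (a eta V W : R) :
  (i < p)%N -> (p < n)%N -> 0 < a < 1 -> eta = a / 192 ->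
  a / 2 * n%:R <= n%:R - p%:R ->
  `|V - (n%:R - p%:R)| < eta * (n%:R - p%:R) ->
  `|W - (p%:R - i%:R)| < eta * (p%:R - i%:R) ->
  0 < V / (V + W) <= 1 /\
  log_rate n i p p.+1%:R (V / (V + W)) <= - ((p%:R - i%:R) * (a ^+ 2 / 1024)).
Proof.
move=> ip pn /andP[a0 a1] etaE aN.
have n0 : 0 < n%:R :> R by rewrite ltr0n (leq_ltn_trans _ pn).
have N0 : 0 < n%:R - p%:R :> R by rewrite subr_gt0 ltr_nat.
have m0 : 0 < p%:R - i%:R :> R by rewrite subr_gt0 ltr_nat.
have mn : p%:R - i%:R <= n%:R :> R.
  have : (p%:R : R) <= n%:R by rewrite ler_nat ltnW.
  have : (0 : R) <= i%:R by [].
  by lra.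
have q0 : 0 < p.+1%:R :> R by rewrite ltr0n.
have qn : p.+1%:R <= n%:R :> R by rewrite ler_nat.
move: N0 m0 mn aN q0 qn (@log_rate_le R n i p p.+1%:R).
set N : R := _ - _; set m : R := p%:R - _; set q : R := p.+1%:R; set nn : R := n%:R in n0 *.
move=> N0 m0 mn aN q0 qn rate; rewrite !ltr_norml => /andP[V1 V2] /andP[W1 W2].
have V0 : 0 < V by nra.
have W0 : 0 < W by nra.
have VW : 0 < V + W by lra.
pose x := V / (V + W); rewrite -/x.
have x0 : 0 < x by rewrite divr_gt0.
have x1 : x <= 1 by rewrite ler_pdivrMr// mul1r; lra.
split; first by rewrite x0.
(* From [V >= (1 - eta) (a / 2) n] and [W <= (1 + eta) n]. Keeping [x] away from 0 keeps [b] away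
   from 0, and so the quadratic gain. *)
have xa : a / 4 <= x.
  rewrite ler_pdivlMr//.
  have h1 : (1 - eta) * (a / 2 * nn) <= V by nra.
  have h2 : W <= (1 + eta) * nn by nra.
  have e0 : 0 < eta by lra.
  have e1 : eta <= 1 / 192 by lra.
  have h3 : a / 4 * W <= a / 4 * ((1 + eta) * nn) by rewrite ler_wpM2l//; lra.
  have h4 : (1 - a / 4) * ((1 - eta) * (a / 2 * nn)) <= (1 - a / 4) * V by rewrite ler_wpM2l//; lra.
  have h5 : a / 4 * ((1 + eta) * nn) <= (1 - a / 4) * ((1 - eta) * (a / 2 * nn)).
    have an : 0 < a * nn by rewrite mulr_gt0.
    have -> : a / 4 * ((1 + eta) * nn) = (a * nn) * ((1 + eta) / 4) by field.
    have -> : (1 - a / 4) * ((1 - eta) * (a / 2 * nn)) = (a * nn) * ((1 - a / 4) * (1 - eta) / 2) by field.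
    rewrite ler_pM2l//; nra.
  lra.
pose b := nn * x / (nn * x + q).
have D0 : 0 < nn * x + q by rewrite addr_gt0// mulr_gt0.
have ba : a / 8 <= b.
  rewrite ler_pdivlMr//.
  have : nn * (a / 4) <= nn * x by rewrite ler_pM2l.
  have : nn * x <= nn by rewrite ger_pMr.
  nra.
(* [rho] is [W / V] divided by its expected value [m / N]. It is close to 1 by the relative
   tolerances, so the first-order term of [log_rate_le] nearly cancels whatever the size of [m]. *)
pose rho := N * (1 - x) / (m * x).
have rhoE : rho = N * W / (m * V).
  by rewrite /rho /x; field; rewrite !gt_eqF.
have rho1 : rho - 1 <= 3 * eta.
  rewrite rhoE lerBlDr ler_pdivrMr ?mulr_gt0//.
  have e0 : 0 < eta by lra.
  have e1 : eta <= 1 / 192 by lra.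
  have h1 : N * W <= (1 + eta) * (N * m) by nra.
  have h2 : (1 - eta) * (N * m) <= m * V by nra.
  have Nm : 0 < N * m by rewrite mulr_gt0.
  have h3 : 1 + eta <= (3 * eta + 1) * (1 - eta) by nra.
  have h4 := ler_wpM2r (ltW Nm) h3.
  have e3 : 0 <= 3 * eta + 1 by lra.
  have h5 := ler_wpM2l e3 h2.
  lra.
have := rate x b rho ip pn q0; rewrite x0 x1 => /(_ isT erefl erefl) h.
apply: (le_trans h).
(* With [eta = a / 192] the first term is at most [a b / 64], while [b >= a / 8] gives
   [b^2 / 4 >= a b / 32]. The sum is at most [- a b / 64], hence at most [- a^2 / 512]. *)
have : (rho - 1) * b - b ^+ 2 / 4 <= - (a ^+ 2 / 512).
  have b0 : 0 < b by lra.
  have : (rho - 1) * b <= 3 * eta * b by rewrite ler_wpM2r// ltW.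
  rewrite etaE; nra.
move=> h2; have := ler_wpM2l (ltW m0) h2; lra.
Qed.

(** Hides the numerical constants, of which only the positivity matters from here on. *)
Lemma log_rate_reduced_exists (R : realType) (a : R) : 0 < a < 1 ->
  exists eta k : R, [/\ 0 < eta, 0 < k &
    forall (n i p : nat) (V W : R), (i < p)%N -> (p < n)%N ->
    a / 2 * n%:R <= n%:R - p%:R ->
    `|V - (n%:R - p%:R)| < eta * (n%:R - p%:R) ->
    `|W - (p%:R - i%:R)| < eta * (p%:R - i%:R) ->
    0 < V / (V + W) <= 1 /\
    log_rate n i p p.+1%:R (V / (V + W)) <= - ((p%:R - i%:R) * k)].
Proof.
move=> a01; have /andP[a0 a1] := a01.
exists (a / 192), (a ^+ 2 / 1024); split; [lra|by have := exprn_gt0 2 a0; lra|].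
by move=> n i p V W ip pn; apply: log_rate_reduced.
Qed.

(** With the relative tolerances [eta (n - p)] and [eta (p - i)] the Chebyshev bounds become
    multiples of [1 / (n - p)] and [1 / (p - i)]. They vanish as soon as [p - i] diverges, even if
    it is of smaller order than [n]. *)
Lemma bayes_factor_prob_reduced (R : realType) (d : measure_display)
    (T : measurableType d) (P : probability T R) (n i p : nat)
    (Y : 'I_n -> {RV P >-> R}) (X : 'M[R]_(n, p)) (sel : 'I_i -> 'I_p)
    (mu : 'cV[R]_n) (sigma eta k eps : R) :
  X^T *m X \in unitmx -> injective sel -> (i < p)%N -> (p < n)%N ->
  normal_sample Y mu sigma -> 0 < sigma ->
  resid_mx X *m mu = 0 -> gain_mx X sel *m mu = 0 -> 0 < eps -> 0 < eta ->
  (forall V W : R,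
    `|V - (n%:R - p%:R)| < eta * (n%:R - p%:R) ->
    `|W - (p%:R - i%:R)| < eta * (p%:R - i%:R) ->
    0 < V / (V + W) <= 1 /\
    log_rate n i p p.+1%:R (V / (V + W)) <= - ((p%:R - i%:R) * k)) ->
  0 < k -> (p%:R - i%:R)^-1 * - ln eps < k ->
  (P [set w | (eps <= `|bayes_factor (colsub sel X) X (sample_vector Y w) - 0|)%R] <=
   ((4 + 2 * gauss_moment4 R) / eta ^+ 2 * ((n%:R - p%:R)^-1 + (p%:R - i%:R)^-1))%:E)%E.
Proof.
move=> u inj ip pn sY sigma0 re0 ga0 eps0 eta0 ratek k0 small.
have N0 : 0 < n%:R - p%:R :> R by rewrite subr_gt0 ltr_nat.
have m0 : 0 < p%:R - i%:R :> R by rewrite subr_gt0 ltr_nat.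
have g0 : qform (gain_mx X sel) mu / sigma ^+ 2 = 0.
  by rewrite (qform_proj_eq0 ga0) mul0r.
have e1 : 0 < eta * (n%:R - p%:R) by rewrite mulr_gt0.
have e2 : 0 < eta * (p%:R - i%:R) by rewrite mulr_gt0.
have mE := measurable_bayes_factor_ge Y u inj eps.
have := bayes_factor_event u inj sY sigma0 re0 mE e1 e2.
rewrite g0 mulr0 addr0.
have -> : (4 + 2 * gauss_moment4 R) * (n%:R - p%:R) / (eta * (n%:R - p%:R)) ^+ 2 +
    (4 + 2 * gauss_moment4 R) * (p%:R - i%:R) / (eta * (p%:R - i%:R)) ^+ 2 =
    (4 + 2 * gauss_moment4 R) / eta ^+ 2 * ((n%:R - p%:R)^-1 + (p%:R - i%:R)^-1).
  by move: (gauss_moment4 R) => kappa; field; rewrite !gt_eqF.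
apply=> w V W V0 W0 bE hV; rewrite subr0 => hW Ew.
have [x01 rate] := ratek _ _ hV hW.
have {Ew} : eps <= `|bayes_factor (colsub sel X) X (sample_vector Y w) - 0| := Ew.
rewrite bE; move: (V / (V + W)) x01 rate => x x01 rate.
rewrite subr0 (ger0_norm (bf_ge0 n i p x)); apply/negP; rewrite -ltNge.
have r0 : log_rate n i p p.+1%:R x <= 0.
  by apply: (le_trans rate); rewrite oppr_le0; apply: mulr_ge0; exact: ltW.
apply: le_lt_trans (bf_le ip pn x01 r0) _.
have <- : expR (ln eps) = eps by rewrite lnK.
rewrite ltr_expR; apply: (le_lt_trans rate).
by rewrite ltrNl -ltr_pdivrMl.
Qed.

Lemma bayes_factor_cvg0_reduced (R : realType) (i p : nat -> nat)
    (sel : forall n, 'I_(i n) -> 'I_(p n)) (X : forall n, 'M[R]_(n, p n)) (r s : R)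
    (d : nat -> measure_display) (T : forall n, measurableType (d n))
    (P : forall n, probability (T n) R)
    (Y : forall n, 'I_n -> {RV (P n) >-> R})
    (alpha : forall n, 'cV[R]_(i n)) (sigma : nat -> R) :
  growth_regime sel X r s ->
  (p n - i n)%N @[n --> \oo] --> \oo ->
  (forall n, 0 < sigma n) ->
  (forall n, normal_sample (Y n) (colsub (sel n) (X n) *m alpha n) (sigma n)) ->
  cvg_in_probability P
    (fun n w => bayes_factor (colsub (sel n) (X n)) (X n)
                  (sample_vector (Y n) w)) 0.
Proof.
move=> reg pi_oo sigma0 sY eps eps0.
have r1 := regime_r_gt1 reg.
pose a := 1 - r^-1.
have a01 : 0 < a < 1.
  have : 0 < r^-1 by rewrite invr_gt0; lra.
  have : r^-1 < 1 by rewrite invf_lt1//; lra.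
  by rewrite /a => *; apply/andP; split; lra.
have /andP[a0 a1] := a01.
have [eta [k [eta0 k0 ratek]]] := log_rate_reduced_exists a01.
pose c n := (4 + 2 * gauss_moment4 R) / eta ^+ 2 *
  (n%:R^-1 * (1 - (p n)%:R / n%:R)^-1 + (p n - i n)%:R^-1) : R.
have inv_pi : (p n - i n)%:R^-1 @[n --> \oo] --> (0 : R).
  exact: (cvg_comp _ _ pi_oo (@cvgn_invr R)).
have inv_pi_eps : (p n - i n)%:R^-1 * - ln eps @[n --> \oo] --> (0 : R).
  by rewrite -(mul0r (- ln eps)); apply: cvgM => //; exact: cvg_cst.
have cp : 1 - (p n)%:R / n%:R @[n --> \oo] --> a.
  by apply: cvgB; [exact: cvg_cst|exact: regime_cvg_p reg].
have bound n : [/\ (0 < n)%N, (i n < p n)%N, (p n < n)%N, injective (sel n)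
    & (X n)^T *m X n \in unitmx] -> a / 2 <= 1 - (p n)%:R / n%:R ->
    (p n - i n)%:R^-1 * - ln eps < k ->
    (P n [set w | (eps <= `|bayes_factor (colsub (sel n) (X n)) (X n)
       (sample_vector (Y n) w) - 0|)%R] <= (c n)%:E)%E.
  move=> [n0 ip pn inj u] h small.
  have n0' : 0 < n%:R :> R by rewrite ltr0n.
  have pE : (p n - i n)%:R = (p n)%:R - (i n)%:R :> R by rewrite natrB// ltnW.
  have -> : c n = (4 + 2 * gauss_moment4 R) / eta ^+ 2 *
      ((n%:R - (p n)%:R)^-1 + ((p n)%:R - (i n)%:R)^-1).
    rewrite /c pE -invfM; congr (_ * (_^-1 + _)).
    by rewrite mulrBr mulr1 mulrCA divff ?mulr1// gt_eqF.
  apply: (@bayes_factor_prob_reduced _ _ _ _ _ _ _ _ _ _ _ _ _ k) (sY n) _ _ _ _ _ _ _ _ => //.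
  - exact: resid_reduced_mean.
  - exact: gain_reduced_mean.
  - move=> V W; apply: ratek => //.
    rewrite -ler_pdivlMr//; apply: (le_trans h).
    by rewrite mulrBl divff// gt_eqF.
  - by rewrite -pE.
apply: (@cvge0_bound _ _ c).
- by move=> n; exact: measure_ge0.
- near=> n; apply: bound.
  + by near: n; exact: regime_near reg.
  + by near: n; apply: (cvgr_ge _ cp); lra.
  + by near: n; apply: (cvgr_lt _ inv_pi_eps).
- rewrite -(mulr0 ((4 + 2 * gauss_moment4 R) / eta ^+ 2)); apply: cvgM; first exact: cvg_cst.
  rewrite -(addr0 0); apply: cvgD => //.
  rewrite -(mul0r a^-1); apply: cvgM; first exact: cvgn_invr.
  by apply: cvgV => //; rewrite gt_eqF.
Unshelve. all: by end_near. Qed.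

(** * The full model *)

Section ratio_bounds.
Context {R : realType}.
Variables (n v w eta V W : R).
Hypothesis n0 : 0 < n.
Hypothesis W0 : 0 <= W.
Hypothesis hV : `|V - n * v| < eta * n.
Hypothesis hW : `|W - n * w| < eta * n.
Hypothesis ev : eta < v.

Let V0 : 0 < V.
Proof.
move: hV; rewrite ltr_norml => /andP[V1 _].
have : 0 < n * (v - eta) by rewrite mulr_gt0// subr_gt0.
lra.
Qed.

Lemma ratio_itv : 0 < V / (V + W) <= 1.
Proof. by rewrite divr_gt0 ?ltr_wpDr//= ler_pdivrMr ?ltr_wpDr// mul1r lerDl. Qed.

(** The claim is [x W <= (1 - x) V]; the hypothesis is its worst case, with [W] largest and [V]
    smallest within the tolerance. *)
Lemma ratio_ge x : 0 <= x <= 1 -> x * (w + eta) <= (1 - x) * (v - eta) ->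
  x <= V / (V + W).
Proof.
move=> /andP[x0 x1] h; rewrite ler_pdivlMr ?ltr_wpDr//.
move: hV hW; rewrite !ltr_norml => /andP[V1 _] /andP[_ W1].
have h1 : x * W <= x * (n * (w + eta)) by rewrite ler_wpM2l//; lra.
have h2 : (1 - x) * (n * (v - eta)) <= (1 - x) * V by rewrite ler_wpM2l//; lra.
have h3 := ler_wpM2l (ltW n0) h.
lra.
Qed.

Lemma ratio_le x : 0 <= x <= 1 -> (1 - x) * (v + eta) <= x * (w - eta) ->
  V / (V + W) <= x.
Proof.
move=> /andP[x0 x1] h; rewrite ler_pdivrMr ?ltr_wpDr//.
move: hV hW; rewrite !ltr_norml => /andP[_ V1] /andP[W1 _].
have h1 : x * (n * (w - eta)) <= x * W by rewrite ler_wpM2l//; lra.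
have h2 : (1 - x) * V <= (1 - x) * (n * (v + eta)) by rewrite ler_wpM2l//; lra.
have h3 := ler_wpM2l (ltW n0) h.
lra.
Qed.

End ratio_bounds.

Lemma log_rate_le_anti (R : realType) (n i p : nat) (x y : R) : (i < p)%N -> (p < n)%N ->
  0 < x -> x <= y -> log_rate n i p p.+1%:R y <= log_rate n i p p.+1%:R x.
Proof.
move=> ip pn x0 xy; have y0 : 0 < y by exact: lt_le_trans xy.
have n0 : 0 < n%:R :> R by rewrite ltr0n (leq_ltn_trans _ pn).
have q0 : 0 < p.+1%:R :> R by rewrite ltr0n.
have M0 : 0 <= (n%:R - i%:R) / 2 :> R.
  by rewrite divr_ge0// subr_ge0 ler_nat ltnW// (ltn_trans ip pn).
have px : 0 < n%:R * x / p.+1%:R by rewrite divr_gt0// mulr_gt0.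
have py : 0 < n%:R * y / p.+1%:R by rewrite divr_gt0// mulr_gt0.
apply: lerB => //; rewrite ler_wpM2l// ler_ln ?posrE ?addr_gt0//.
by rewrite lerD2l ler_pM2r ?invr_gt0// ler_pM2l.
Qed.

Lemma bf_lt (R : realType) (n i p : nat) (x x1 c eps : R) : (i < p)%N -> (p < n)%N ->
  0 < x1 -> x1 <= x <= 1 -> 0 < eps ->
  log_rate n i p p.+1%:R x1 <= - (n%:R * c) -> 0 < c -> - ln eps < n%:R * c ->
  bf n i p x < eps.
Proof.
move=> ip pn x10 /andP[x1x xle] eps0 rate c0 nc.
have n0 : 0 < n%:R :> R by rewrite ltr0n (leq_ltn_trans _ pn).
have x0 : 0 < x by exact: lt_le_trans x1x.
have h := le_trans (log_rate_le_anti ip pn x10 x1x) rate.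
have h0 : log_rate n i p p.+1%:R x <= 0.
  by apply: (le_trans h); rewrite oppr_le0 mulr_ge0 ?ltW.
have x01 : 0 < x <= 1 by rewrite x0.
apply: le_lt_trans (bf_le ip pn x01 h0) _.
have <- : expR (ln eps) = eps by rewrite lnK.
by rewrite ltr_expR; apply: (le_lt_trans h); rewrite ltrNl.
Qed.

(** The gap between [x2] and [x3] pays for the angles near [pi / 2]: where [sin^2 phi >= x2 / x3],
    replacing the sine by 1 costs no more than replacing [x2] by [x3]. Bounding the exponential
    below by its argument still gives growth linear in [n], enough to exceed any [M]. *)
Lemma bf_gt (R : realType) (n i p : nat) (x x2 x3 c eta M : R) : (i < p)%N -> (p < n)%N ->
  0 < x <= x2 -> 0 < x3 -> 0 < eta <= pi / 2 ->
  (forall phi, pi / 2 - eta <= phi <= pi / 2 -> 0 < sin phi /\ x2 / x3 <= sin phi ^+ 2) ->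
  n%:R * c <= log_rate n i p p.+1%:R x3 -> M < 2 / pi * eta * (n%:R * c) ->
  M < bf n i p x.
Proof.
move=> ip pn /andP[x0 xx2] x30 eta0 heta rate Mn.
have n0 : 0 < n%:R :> R by rewrite ltr0n (leq_ltn_trans _ pn).
have x20 : 0 < x2 by exact: lt_le_trans xx2.
have t0 : 0 < x2 / x3 by rewrite divr_gt0.
have q0 : 0 < p.+1%:R :> R by rewrite ltr0n.
have M0 : 0 <= (n%:R - i%:R) / 2 :> R.
  by rewrite divr_ge0// subr_ge0 ler_nat ltnW// (ltn_trans ip pn).
apply: lt_le_trans (bf_ge ip pn x0 t0 eta0 heta).
have pi0 := pi_gt0 R.
have k0 : 0 < 2 / pi * eta by rewrite mulr_gt0 ?divr_gt0//; case/andP: eta0.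
apply: (lt_le_trans Mn); rewrite ler_pM2l//.
set z := _ - _ * ln _.
apply: (@le_trans _ _ z); last by have := expR_ge1Dx z; lra.
apply: (le_trans rate); rewrite /z; apply: lerB => //.
rewrite ler_wpM2l//.
have px : 0 < n%:R * x / (p.+1%:R * (x2 / x3)) by apply: divr_gt0; apply: mulr_gt0.
have p3 : 0 < n%:R * x3 / p.+1%:R by apply: divr_gt0 => //; exact: mulr_gt0.
rewrite ler_ln ?posrE ?addr_gt0//.
rewrite lerD2l.
have -> : n%:R * x3 / p.+1%:R = n%:R * x2 / (p.+1%:R * (x2 / x3)).
  by field; rewrite !gt_eqF.
have i0 : 0 < (p.+1%:R * (x2 / x3))^-1 :> R by rewrite invr_gt0 mulr_gt0.
by rewrite ler_pM2r// ler_pM2l.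
Qed.

(** Common to both signs of [L - delta]: [Q] is a range of the ratio that the deviation bounds
    enforce and that excludes the bad event [E]. Tolerances of order [n] against variances of order
    [n] leave a bound of order [1 / n]. *)
Lemma bayes_factor_prob_full (R : realType) (d : measure_display)
    (T : measurableType d) (P : probability T R) (n i p : nat)
    (Y : 'I_n -> {RV P >-> R}) (X : 'M[R]_(n, p)) (sel : 'I_i -> 'I_p)
    (beta : 'cV[R]_p) (sigma eta : R) (E : set T) (Q : R -> Prop) :
  X^T *m X \in unitmx -> injective sel -> (0 < n)%N ->
  normal_sample Y (X *m beta) sigma -> 0 < sigma -> 0 < eta ->
  measurable E ->
  (forall V W : R, 0 <= W ->
    `|V - n%:R * (1 - p%:R / n%:R)| < eta * n%:R ->
    `|W - n%:R * (p%:R / n%:R - i%:R / n%:R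
                  + model_distance (colsub sel X) X beta sigma)| < eta * n%:R ->
    Q (V / (V + W))) ->
  (forall w x, bayes_factor (colsub sel X) X (sample_vector Y w) = bf n i p x ->
     Q x -> ~ E w) ->
  (P E <= (((4 + 2 * gauss_moment4 R) * (1 - i%:R / n%:R)
     + 8 * model_distance (colsub sel X) X beta sigma) / eta ^+ 2 * n%:R^-1)%:E)%E.
Proof.
move=> u inj n0 sY sigma0 eta0 mE HQ HE.
have n0' : 0 < n%:R :> R by rewrite ltr0n.
have en : 0 < eta * n%:R by rewrite mulr_gt0.
have := bayes_factor_event u inj sY sigma0 (resid_full_mean u beta) mE en en.
rewrite (gain_full_mean sel u beta n0 sigma0).
move: (model_distance _ _ _ _) HQ => dl HQ.
have -> : (4 + 2 * gauss_moment4 R) * (n%:R - p%:R) / (eta * n%:R) ^+ 2 +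
    ((4 + 2 * gauss_moment4 R) * (p%:R - i%:R) + 8 * (n%:R * dl)) / (eta * n%:R) ^+ 2 =
    ((4 + 2 * gauss_moment4 R) * (1 - i%:R / n%:R) + 8 * dl) / eta ^+ 2 * n%:R^-1.
  by move: (gauss_moment4 R) => kappa; field; rewrite !gt_eqF.
have eV : n%:R * (1 - p%:R / n%:R) = n%:R - p%:R :> R by field; rewrite gt_eqF.
have eW : n%:R * (p%:R / n%:R - i%:R / n%:R + dl) = p%:R - i%:R + n%:R * dl.
  by field; rewrite gt_eqF.
rewrite eV eW in HQ; apply=> w V W V0 W0 bE hV hW.
by apply: (HE w _ bE); apply: HQ W0 hV _; rewrite opprD addrA.
Qed.

Lemma model_distance_ge0 (R : realType) (n i p : nat) (X : 'M[R]_(n, p))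
    (sel : 'I_i -> 'I_p) (beta : 'cV[R]_p) (sigma : R) :
  X^T *m X \in unitmx -> injective sel -> (0 < n)%N -> 0 < sigma ->
  0 <= model_distance (colsub sel X) X beta sigma.
Proof.
move=> u inj n0 sigma0.
have n0' : 0 < n%:R :> R by rewrite ltr0n.
rewrite -(pmulr_rge0 _ n0') -(gain_full_mean sel u beta n0 sigma0).
rewrite divr_ge0 ?sqr_ge0// qform_proj_ge0//; first exact: gain_sym.
exact: gain_idem.
Qed.

Lemma half_rate_le (R : realFieldType) (n x y : R) : 0 < n -> x < y / 2 ->
  n / 2 * x <= - (n * (- y / 4)).
Proof.
move=> n0 xy; have -> : - (n * (- y / 4)) = n / 2 * (y / 2) by field.
by rewrite ler_pM2l ?ltW// divr_gt0.
Qed.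

Lemma half_rate_ge (R : realFieldType) (n x y : R) : 0 < n -> y / 2 < x ->
  n * (y / 4) <= n / 2 * x.
Proof.
move=> n0 xy; have -> : n * (y / 4) = n / 2 * (y / 2) by field.
by rewrite ler_pM2l ?ltW// divr_gt0.
Qed.

Section full_model.
Context {R : realType}.
Variables (i p : nat -> nat) (sel : forall n, 'I_(i n) -> 'I_(p n)).
Variables (X : forall n, 'M[R]_(n, p n)) (r s : R).
Hypothesis reg : growth_regime sel X r s.
Variables (d : nat -> measure_display) (T : forall n, measurableType (d n)).
Variables (P : forall n, probability (T n) R).
Variables (Y : forall n, 'I_n -> {RV (P n) >-> R}).
Variables (beta : forall n, 'cV[R]_(p n)) (sigma : nat -> R) (L : R).
Hypothesis sigma0 : forall n, 0 < sigma n.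
Hypothesis sY : forall n, normal_sample (@Y n) (X n *m beta n) (sigma n).
Local Notation dist := (fun n => model_distance (colsub (@sel n) (X n)) (X n) (beta n) (sigma n)).
Hypothesis dL : dist n @[n --> \oo] --> L.

Let a := 1 - r^-1.
Let b := 1 - s^-1.
Let D := b + L.

Let r1 : 1 < r := regime_r_gt1 reg.
Let rs : r <= s := regime_le reg.
Let a01 : 0 < a < 1.
Proof.
have r1' : 1 < r := r1.
have : 0 < r^-1 by rewrite invr_gt0; lra.
have : r^-1 < 1 by rewrite invf_lt1//; lra.
by rewrite /a => *; apply/andP; split; lra.
Qed.

Let ab : a <= b.
Proof.
have r1' : 1 < r := r1; have rs' : r <= s := rs.
by rewrite lerD2l lerN2 lef_pV2 ?posrE//; lra.
Qed.

Let L0 : 0 <= L.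
Proof.
apply: ler_cvg_to (cvg_cst 0) dL _; near=> n.
have [n0 ip pn inj u] : [/\ (0 < n)%N, (i n < p n)%N, (p n < n)%N, injective (@sel n)
    & (X n)^T *m X n \in unitmx] by near: n; exact: regime_near reg.
exact: model_distance_ge0.
Unshelve. all: by end_near. Qed.

Let cp : 1 - (p n)%:R / n%:R @[n --> \oo] --> a.
Proof. by apply: cvgB; [exact: cvg_cst|exact: regime_cvg_p reg]. Qed.

Let cw : (p n)%:R / n%:R - (i n)%:R / n%:R + dist n @[n --> \oo] --> D - a.
Proof.
have -> : D - a = r^-1 - s^-1 + L by rewrite /D /a /b; ring.
apply: cvgD => //; apply: cvgB; [exact: regime_cvg_p reg|exact: regime_cvg_i reg].
Qed.

Let bound (eta : R) n : R := ((4 + 2 * gauss_moment4 R) * (1 - (i n)%:R / n%:R)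
     + 8 * dist n) / eta ^+ 2 * n%:R^-1.

Let cvg_bound eta : bound eta n @[n --> \oo] --> (0 : R).
Proof.
rewrite -(mulr0 (((4 + 2 * gauss_moment4 R) * (1 - s^-1) + 8 * L) / eta ^+ 2)).
apply: cvgM; last exact: cvgn_invr.
apply: cvgM; last exact: cvg_cst.
apply: cvgD; apply: cvgM => //; try exact: cvg_cst.
by apply: cvgB; [exact: cvg_cst|exact: regime_cvg_i reg].
Qed.

Lemma bayes_factor_cvg0_full : L < delta_rs r s ->
  cvg_in_probability P
    (fun n w => bayes_factor (colsub (@sel n) (X n)) (X n)
                  (sample_vector (@Y n) w)) 0.
Proof.
move=> Ldelta eps eps0; have /andP[a0 a1] := a01; have ab' : a <= b := ab; have L0' : 0 <= L := L0.
have xs0 := critical_ratio_gt0 r1 rs.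
have D0 : 0 < D by rewrite /D; lra.
have xsD : critical_ratio r s < a / D.
  move: Ldelta; rewrite delta_rs_critical_ratio// -/a -/b => h.
  have {}h : D < a / critical_ratio r s by rewrite /D; lra.
  by rewrite ltr_pdivlMr// mulrC -ltr_pdivlMr.
have aD1 : a / D <= 1 by rewrite ler_pdivrMr// mul1r /D; lra.
(* Strictly between the critical ratio, where the limiting exponent is 0, and the limit [a / D] of
   [Bstat]: the ratio eventually exceeds [x1], and at [x1] the exponent is already negative. *)
pose x1 := (critical_ratio r s + a / D) / 2.
have x1s : critical_ratio r s < x1 by rewrite /x1; lra.
have x1D : x1 < a / D by rewrite /x1; lra.
have x10 : 0 < x1 by lra.
have x1le : x1 <= 1 by lra.
have x1Da : x1 * D < a by rewrite -ltr_pdivlMr.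
(* In the limit the difference required to be positive by [ratio_ge] equals [a - x1 D - eta], so
   half of [a - x1 D] keeps it positive. The bound [a / 2] puts [eta] below the limit of
   [1 - p / n], which makes V positive. *)
pose eta := Num.min ((a - x1 * D) / 2) (a / 2).
have eta0 : 0 < eta by rewrite lt_min !divr_gt0//; lra.
have eta1 : eta <= (a - x1 * D) / 2 by rewrite ge_min lexx.
have eta2 : eta <= a / 2 by rewrite ge_min lexx orbT.
pose lim := a * ln (1 + r) - b * ln (1 + r * x1).
have lim0 : lim < 0.
  have := rate_lt r1 rs (ltW xs0) x1s; rewrite critical_ratio_rate// /lim -/a -/b; lra.
have clim := cvg_scaled_rate reg (ltW x10); rewrite -/a -/b -/lim in clim.
pose c := - lim / 4.
have c0 : 0 < c by rewrite /c; lra.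
have step n : [/\ (0 < n)%N, (i n < p n)%N, (p n < n)%N, injective (@sel n)
    & (X n)^T *m X n \in unitmx] ->
    eta < 1 - (p n)%:R / n%:R ->
    0 < (1 - x1) * (1 - (p n)%:R / n%:R - eta) -
        x1 * ((p n)%:R / n%:R - (i n)%:R / n%:R + dist n + eta) ->
    scaled_rate i p x1 n < lim / 2 -> - ln eps / c < n%:R ->
    (P n [set w | (eps <= `|bayes_factor (colsub (@sel n) (X n)) (X n)
       (sample_vector (@Y n) w) - 0|)%R] <= (bound eta n)%:E)%E.
  move=> [n0 ip pn inj u] h1 h2 h3 h4.
  have n0' : 0 < n%:R :> R by rewrite ltr0n.
  apply: (bayes_factor_prob_full (Q := fun x => x1 <= x <= 1) u inj n0 (sY n) (sigma0 n) eta0).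
  - exact: measurable_bayes_factor_ge.
  - move=> V W W0 hV hW.
    have /andP[_ ->] := ratio_itv n0' W0 hV h1; rewrite andbT.
    apply: (ratio_ge n0' W0 hV hW h1); first by rewrite ltW.
    by lra.
  - move=> w x bE x1x Ew.
    have {Ew} : eps <= `|bayes_factor (colsub (@sel n) (X n)) (X n) (sample_vector (@Y n) w) - 0| := Ew.
    rewrite bE subr0 (ger0_norm (bf_ge0 n (i n) (p n) x)); apply/negP; rewrite -ltNge.
    apply: (bf_lt ip pn x10 x1x eps0 _ c0).
    + by rewrite (log_rateE i p x1 n0); exact: (half_rate_le n0' h3).
    + by rewrite -ltr_pdivrMr.
apply: (@cvge0_bound _ _ (bound eta)).
- by move=> n; exact: measure_ge0.
- near=> n; apply: step.
  + by near: n; exact: regime_near reg.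
  + by near: n; apply: (cvgr_gt _ cp); lra.
  + near: n.
    have h : (1 - x1) * (1 - (p n)%:R / n%:R - eta) -
        x1 * ((p n)%:R / n%:R - (i n)%:R / n%:R + dist n + eta) @[n --> \oo] -->
        (1 - x1) * (a - eta) - x1 * (D - a + eta).
      apply: cvgB; apply: cvgM; try exact: cvg_cst.
        by apply: cvgB cp _; exact: cvg_cst.
      by apply: cvgD cw _; exact: cvg_cst.
    by apply: (cvgr_gt _ h); lra.
  + by near: n; apply: (cvgr_lt _ clim); lra.
  + by near: n; exact: nbhs_infty_gtr.
- exact: cvg_bound.
Unshelve. all: by end_near. Qed.

Lemma bayes_factor_cvgy_full : delta_rs r s < L ->
  cvg_pinfty_in_probability P
    (fun n w => bayes_factor (colsub (@sel n) (X n)) (X n)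
                  (sample_vector (@Y n) w)).
Proof.
move=> Ldelta M; have /andP[a0 a1] := a01; have ab' : a <= b := ab; have L0' : 0 <= L := L0.
have xs0 := critical_ratio_gt0 r1 rs.
have D0 : 0 < D by rewrite /D; lra.
have xsD : a / D < critical_ratio r s.
  move: Ldelta; rewrite delta_rs_critical_ratio// -/a -/b => h.
  have {}h : a / critical_ratio r s < D by rewrite /D; lra.
  by rewrite ltr_pdivrMr// mulrC -ltr_pdivrMr.
have aD1 : a / D <= 1 by rewrite ler_pdivrMr// mul1r /D; lra.
have aD0 : 0 < a / D by rewrite divr_gt0.
have xs1 := critical_ratio_le1 r1 rs.
(* [x2] will bound [Bstat] from above. [x3], still below the critical ratio so that the exponent is
   positive there, leaves room for the factor [x2 / x3 < 1] by which [sin^2 phi] may fall short of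
   1. *)
pose x2 := (a / D + critical_ratio r s) / 2.
pose x3 := (x2 + critical_ratio r s) / 2.
have x2D : a / D < x2 by rewrite /x2; lra.
have x23 : x2 < x3 by rewrite /x3 /x2; lra.
have x3s : x3 < critical_ratio r s by rewrite /x3 /x2; lra.
have x20 : 0 < x2 by lra.
have x30 : 0 < x3 by lra.
have x2le : x2 <= 1 by lra.
have x2Da : a < x2 * D by rewrite -ltr_pdivrMr.
have [eta' eta'0 heta'] : exists2 eta' : R, 0 < eta' <= pi / 2 &
    forall phi, pi / 2 - eta' <= phi <= pi / 2 -> 0 < sin phi /\ x2 / x3 <= sin phi ^+ 2.
  by apply: sin_sqr_near_pihalf; rewrite ltr_pdivrMr// mul1r.
(* Here the limit of the difference required by [ratio_le] is [x2 D - a - eta]. *)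
pose eta := Num.min ((x2 * D - a) / 2) (a / 2).
have eta0 : 0 < eta by rewrite lt_min !divr_gt0//; lra.
have eta1 : eta <= (x2 * D - a) / 2 by rewrite ge_min lexx.
have eta2 : eta <= a / 2 by rewrite ge_min lexx orbT.
pose lim := a * ln (1 + r) - b * ln (1 + r * x3).
have lim0 : 0 < lim.
  have := rate_lt r1 rs (ltW x30) x3s; rewrite critical_ratio_rate// /lim -/a -/b; lra.
have clim := cvg_scaled_rate reg (ltW x30); rewrite -/a -/b -/lim in clim.
pose c := lim / 4.
have c0 : 0 < c by rewrite /c; lra.
have k0 : 0 < 2 / pi * eta' * c.
  by rewrite !mulr_gt0 ?invr_gt0 ?pi_gt0//; case/andP: eta'0.
have step n : [/\ (0 < n)%N, (i n < p n)%N, (p n < n)%N, injective (@sel n)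
    & (X n)^T *m X n \in unitmx] ->
    eta < 1 - (p n)%:R / n%:R ->
    0 < x2 * ((p n)%:R / n%:R - (i n)%:R / n%:R + dist n - eta) -
        (1 - x2) * (1 - (p n)%:R / n%:R + eta) ->
    lim / 2 < scaled_rate i p x3 n -> M / (2 / pi * eta' * c) < n%:R ->
    (P n [set w | (bayes_factor (colsub (@sel n) (X n)) (X n)
       (sample_vector (@Y n) w) <= M)%R] <= (bound eta n)%:E)%E.
  move=> [n0 ip pn inj u] h1 h2 h3 h4.
  have n0' : 0 < n%:R :> R by rewrite ltr0n.
  apply: (bayes_factor_prob_full (Q := fun x => 0 < x <= x2) u inj n0 (sY n) (sigma0 n) eta0).
  - exact: measurable_bayes_factor_le.
  - move=> V W W0 hV hW.
    have /andP[-> _] := ratio_itv n0' W0 hV h1.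
    apply: (ratio_le n0' W0 hV hW h1); first by rewrite ltW.
    by lra.
  - move=> w x bE x1x Ew.
    have {Ew} : bayes_factor (colsub (@sel n) (X n)) (X n) (sample_vector (@Y n) w) <= M := Ew.
    rewrite bE; apply/negP; rewrite -ltNge.
    apply: (bf_gt ip pn x1x x30 eta'0 heta' (c := c)).
    + by rewrite (log_rateE i p x3 n0); exact: (half_rate_ge n0' h3).
    + by move: h4; rewrite ltr_pdivrMr; last exact: k0; rewrite mulrCA.
apply: (@cvge0_bound _ _ (bound eta)).
- by move=> n; exact: measure_ge0.
- near=> n; apply: step.
  + by near: n; exact: regime_near reg.
  + by near: n; apply: (cvgr_gt _ cp); lra.
  + near: n.
    have h : x2 * ((p n)%:R / n%:R - (i n)%:R / n%:R + dist n - eta) -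
        (1 - x2) * (1 - (p n)%:R / n%:R + eta) @[n --> \oo] -->
        x2 * (D - a - eta) - (1 - x2) * (a + eta).
      apply: cvgB; apply: cvgM; try exact: cvg_cst.
        by apply: cvgB cw _; exact: cvg_cst.
      by apply: cvgD cp _; exact: cvg_cst.
    by apply: (cvgr_gt _ h); lra.
  + by near: n; apply: (cvgr_gt _ clim); lra.
  + by near: n; exact: nbhs_infty_gtr.
- exact: cvg_bound.
Unshelve. all: by end_near. Qed.

End full_model.

Theorem theorem3 (R : realType) :
  (* sampling from the reduced model; the divergence of p - i is automatic
     when r < s and is only a restriction in the boundary case r = s *)
  (forall (i p : nat -> nat) (sel : forall n, 'I_(i n) -> 'I_(p n))
      (X : forall n, 'M[R]_(n, p n)) (r s : R),
    growth_regime sel X r s ->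
    (p n - i n)%N @[n --> \oo] --> \oo ->
    forall (d : nat -> measure_display) (T : forall n, measurableType (d n))
      (P : forall n, probability (T n) R)
      (Y : forall n, 'I_n -> {RV (P n) >-> R})
      (alpha : forall n, 'cV[R]_(i n)) (sigma : nat -> R),
    (forall n, 0 < sigma n) ->
    (forall n, normal_sample (Y n) (colsub (sel n) (X n) *m alpha n) (sigma n)) ->
    cvg_in_probability P
      (fun n w => bayes_factor (colsub (sel n) (X n)) (X n)
                    (sample_vector (Y n) w)) 0)
  /\
  (exists delta : R -> R -> R,
    (* sampling from the full model *)
    (forall (i p : nat -> nat) (sel : forall n, 'I_(i n) -> 'I_(p n))
        (X : forall n, 'M[R]_(n, p n)) (r s : R),
      growth_regime sel X r s ->
      forall (d : nat -> measure_display) (T : forall n, measurableType (d n))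
        (P : forall n, probability (T n) R)
        (Y : forall n, 'I_n -> {RV (P n) >-> R})
        (beta : forall n, 'cV[R]_(p n)) (sigma : nat -> R) (L : R),
      (forall n, 0 < sigma n) ->
      (forall n, normal_sample (Y n) (X n *m beta n) (sigma n)) ->
      model_distance (colsub (sel n) (X n)) (X n) (beta n) (sigma n)
        @[n --> \oo] --> L ->
      (delta r s < L ->
        cvg_pinfty_in_probability P
          (fun n w => bayes_factor (colsub (sel n) (X n)) (X n)
                        (sample_vector (Y n) w)))
      /\
      (L < delta r s ->
        cvg_in_probability P
          (fun n w => bayes_factor (colsub (sel n) (X n)) (X n)
                        (sample_vector (Y n) w)) 0))
    /\ (forall r s : R, 1 < r -> 1 < s -> delta r s = delta_rs r s)
    /\ (forall s : R, 1 < s ->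
         [/\ [bounded (delta r s : R^o) | r in `]1, s[],
             {in `]1, s[ &, forall r1 r2 : R, r1 < r2 -> delta r2 s < delta r1 s}
           & convex_function (`]1, s[ : set R^o) (fun r => delta r s)])
    /\ (forall r s : R, 1 < r -> r < s -> delta r s <= (ln 2)^-1 - 1)
    (* [r --> +oo] within the domain [r < s], uniformly in [s] *)
    /\ (forall eps : R, 0 < eps ->
         \forall r \near +oo, forall s : R, r < s -> `|delta r s| < eps)
    /\ (forall r : R, 1 < r -> delta r s @[s --> +oo] --> delta_r r)).
Proof.
split.
  move=> i p sel X r s reg pi_oo d T P Y alpha sigma sigma0 sY.
  exact: bayes_factor_cvg0_reduced reg pi_oo sigma0 sY.
exists (@delta_rs R); split; last split; [|by []|split; last split; last split].
- move=> i p sel X r s reg d T P Y beta sigma L sigma0 sY dL; split=> h.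
    exact: (bayes_factor_cvgy_full reg sigma0 sY dL h).
  exact: (bayes_factor_cvg0_full reg sigma0 sY dL h).
- move=> s s1; split.
  + exists ((ln 2)^-1 - 1); split; first exact: num_real.
    move=> M hM r /=; rewrite in_itv/= => /andP[r1 rs].
    rewrite ger0_norm; first by rewrite (le_trans (delta_rs_le r1 rs))// ltW.
    exact/ltW/delta_rs_gt0.
  + move=> r1 r2; rewrite !in_itv/= => /andP[r11 _] /andP[_ r2s] r12.
    exact: delta_rs_decr.
  + move=> t x y; rewrite !inE/= !in_itv/= => /andP[x1 xs] /andP[y1 ys].
    rewrite !convRE/=; apply: delta_rs_convex.
    * by rewrite x1 ltW.
    * by rewrite y1 ltW.
    * by rewrite ge0 le1.
- by move=> r s r1 rs; exact: delta_rs_le.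
- move=> eps eps0; have [M _ hM] := delta_rs_small eps0.
  by near=> r; move=> s rs; apply: hM => //; near: r; exact: nbhs_pinfty_ge.
- exact: cvg_delta_rs_s.
Unshelve. all: by end_near. Qed.
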